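(* Let $H$ be a hypergraph belonging to one of the following classes: (1) $k$-uniform hypertrees; (2) $k$-th powers $G^{(k)}$ of connected simple graphs $G$ (with $k\ge 3$); (3) complete $3$-uniform hypergraphs on at least $4$ vertices (in which case $k=3$). Then for any eigenvalue $\lambda$ of the adjacency tensor $\mathcal{A}(H)$ with modulus equal to the spectral radius of $\mathcal{A}(H)$, $$\mathrm{am}(\lambda)=|\mathbb{V}_\lambda(\mathcal{A}(H))|,$$ where the right-hand side is the number of points of the projective eigenvariety. Consequently, equality holds in the Hu-Ye inequality for $\lambda$: if $V_1,\ldots,V_\kappa$ are all the irreducible components of the affine eigenvariety $\mathcal{V}_\lambda(\mathcal{A}(H))$, then $$\mathrm{am}(\lambda)=\sum_{i=1}^{\kappa}\dim(V_i)(k-1)^{\dim(V_i)-1}.$$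
   Context: Tensors. A tensor $\mathcal{A}=(a_{i_1\ldots i_k})$ of order $k\ge 2$ and dimension $n$ is an array of entries $a_{i_1\ldots i_k}\in\mathbb{C}$, $i_1,\ldots,i_k\in[n]=\{1,\ldots,n\}$. For $x\in\mathbb{C}^n$, $(\mathcal{A}x^{k-1})_i=\sum_{i_2,\ldots,i_k\in[n]}a_{ii_2\ldots i_k}x_{i_2}\cdots x_{i_k}$, and $x^{[k-1]}=(x_1^{k-1},\ldots,x_n^{k-1})$. A number $\lambda\in\mathbb{C}$ is an eigenvalue of $\mathcal{A}$ if $\mathcal{A}x^{k-1}=\lambda x^{[k-1]}$ for some $x\in\mathbb{C}^n\setminus\{0\}$. The characteristic polynomial $\varphi_{\mathcal{A}}(\lambda)$ is the (multivariate homogeneous) resultant of the $n$ homogeneous polynomials $\lambda x_i^{k-1}-(\mathcal{A}x^{k-1})_i$ of degree $k-1$ in $x_1,\ldots,x_n$. The algebraic multiplicity $\mathrm{am}(\lambda)$ is the multiplicity of $\lambda$ as a root of $\varphi_{\mathcal{A}}$, and the spectral radius is the largest modulus of the roots of $\varphi_{\mathcal{A}}$. The affine eigenvariety is $\mathcal{V}_\lambda(\mathcal{A})=\{x\in\mathbb{C}^n:\mathcal{A}x^{k-1}=\lambda x^{[k-1]}\}$ and the projective eigenvariety is $\mathbb{V}_\lambda(\mathcal{A})=\{x\in\mathbb{P}^{n-1}:\mathcal{A}x^{k-1}=\lambda x^{[k-1]}\}$, with $\mathbb{P}^{n-1}$ complex projective space. Hypergraphs. A hypergraph $H$ consists of a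 finite vertex set $V(H)$ and a set $E(H)$ of subsets of $V(H)$ (edges); it is $k$-uniform if every edge has exactly $k$ elements. For a $k$-uniform $H$ on vertices $v_1,\ldots,v_n$, the adjacency tensor $\mathcal{A}(H)$ has order $k$ and dimension $n$, with entry $a_{i_1\ldots i_k}=\frac{1}{(k-1)!}$ if $\{v_{i_1},\ldots,v_{i_k}\}\in E(H)$ and $0$ otherwise. A hypertree is a connected hypergraph containing no cycles (in the Berge sense: a cycle of length $\ell\ge 2$ is an alternating sequence of distinct vertices and distinct edges $v_1e_1v_2e_2\cdots v_\ell e_\ell v_1$ with $v_i,v_{i+1}\in e_i$ and $v_\ell,v_1\in e_\ell$). For $k\ge 3$ and a simple graph $G$, the $k$-th power $G^{(k)}$ is the $k$-uniform hypergraph obtained by replacing each edge of $G$ by the $k$-set consisting of its two endpoints and $k-2$ new additional vertices, the new vertices being distinct for distinct edges. The complete $k$-uniform hypergraph on $n$ vertices has all $k$-subsets of its vertex set as edges. *)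

(* Defs.v *)
From HB Require Import structures.
From mathcomp Require Export all_boot all_order all_algebra.
From mathcomp Require Export complex mpoly.
From mathcomp Require Export boolp classical_sets functions cardinality reals.

Set Implicit Arguments.
Unset Strict Implicit.
Unset Printing Implicit Defensive.

Import Order.TTheory GRing.Theory Num.Theory.

Local Open Scope classical_set_scope.
Local Open Scope ring_scope.

Definition mpoly_irreducible (n : nat) (K : idomainType) (p : {mpoly K[n]}) :
    Prop :=
  [/\ p != 0, p \isn't a GRing.unit &
      forall q r : {mpoly K[n]},
        p = q * r -> q \is a GRing.unit \/ r \is a GRing.unit].

(* ------------------------------------------------------------------------ *)
(* The resultant of n homogeneous polynomials F_i of the same degree d in n *)
(* variables is a polynomial in the generic coefficients u_(i,m), where     *)
(* i < n and m runs over the monomials of degree d. The indices (i,m) form  *)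
(* the finite type [coef_index n d]; the variable of {mpoly C[_]} standing  *)
(* for u_(i,m) is the one of rank [enum_rank (i,m)].                        *)
(* ------------------------------------------------------------------------ *)

Definition coef_index (n d : nat) : finType :=
  ('I_n * {m : 'X_{1..n < d.+1} | mdeg m == d})%type.

Definition system_coefs (K : nzRingType) (n d : nat)
    (F : 'I_n -> {mpoly K[n]}) (j : 'I_#|coef_index n d|) : K :=
  (F (enum_val j).1)@_(val (val (enum_val j).2)).

(* The classical characterization: the resultant is the irreducible         *)
(* polynomial in the coefficients that vanishes exactly on the systems with *)
(* a nontrivial zero, normalized to be 1 on x_1^d, ..., x_n^d. For          *)
(* 0 < n and 0 < d there is exactly one such polynomial.                    *)
Definition is_resultant (C : closedFieldType) (n d : nat)
    (Res : {mpoly C[#|coef_index n d|]}) : Prop :=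
  [/\ mpoly_irreducible Res,
      forall F : 'I_n -> {mpoly C[n]}, (forall i, F i \is d.-homog) ->
        (Res.@[@system_coefs C n d F] = 0 <->
         exists2 x : 'I_n -> C, exists i, x i != 0 & forall i, (F i).@[x] = 0)
    & Res.@[@system_coefs C n d (fun i => 'X_i ^+ d)] = 1].

Definition generic_resultant (C : closedFieldType) (n d : nat) :
    {mpoly C[#|coef_index n d|]} :=
  xget 0 [set Res | is_resultant Res].

(* The resultant of a system with coefficients in C[lambda]. *)
Definition poly_resultant (C : closedFieldType) (n d : nat)
    (F : 'I_n -> {mpoly {poly C}[n]}) : {poly C} :=
  mmap polyC (@system_coefs {poly C} n d F) (generic_resultant C n d).

(* ------------------------------------------------------------------------ *)
(* Tensors of order k and dimension n: the entry a_(i i_2 ... i_k) is       *)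
(* [A i t] with t = (i_2, ..., i_k).                                        *)
(* ------------------------------------------------------------------------ *)

Definition tensor (C : Type) (k n : nat) : Type :=
  'I_n -> k.-1.-tuple 'I_n -> C.

Definition tensor_apply (C : nzRingType) (k n : nat) (A : tensor C k n)
    (x : 'rV[C]_n) (i : 'I_n) : C :=
  \sum_(t : k.-1.-tuple 'I_n) A i t * \prod_(j <- t) x 0 j.

Definition eigen_equation (C : nzRingType) (k n : nat) (A : tensor C k n)
    (lam : C) (x : 'rV[C]_n) : Prop :=
  forall i, tensor_apply A x i = lam * x 0 i ^+ k.-1.

Definition tensor_eigenvalue (C : nzRingType) (k n : nat) (A : tensor C k n)
    (lam : C) : Prop :=
  exists2 x : 'rV[C]_n, x != 0 & eigen_equation A lam x.

(* The form lambda x_i^(k-1) - (A x^(k-1))_i, with coefficients in          *)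
(* C[lambda]; the indeterminate 'X of {poly C} is lambda.                   *)
Definition char_system (C : comNzRingType) (k n : nat) (A : tensor C k n)
    (i : 'I_n) : {mpoly {poly C}[n]} :=
  'X *: 'X_i ^+ k.-1
  - \sum_(t : k.-1.-tuple 'I_n) (A i t)%:P *: \prod_(j <- t) 'X_j.

Definition tensor_char_poly (C : closedFieldType) (k n : nat)
    (A : tensor C k n) : {poly C} :=
  poly_resultant k.-1 (char_system A).

Definition alg_mult (C : closedFieldType) (k n : nat) (A : tensor C k n)
    (lam : C) : nat :=
  mup lam (tensor_char_poly A).

(* The characteristic polynomial has finitely many roots, and at least one  *)
(* when 0 < n and 1 < k: the supremum is the largest modulus.               *)
Definition spectral_radius (R : realType) (k n : nat) (A : tensor R[i] k n) :
    R :=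
  sup [set r : R | exists2 z : R[i],
                     root (tensor_char_poly A) z & `|z| = r%:C%C].

Definition affine_eigenvariety (C : nzRingType) (k n : nat)
    (A : tensor C k n) (lam : C) : set 'rV[C]_n :=
  [set x | eigen_equation A lam x].

(* Points of the projective space P^(n-1) are lines through 0 in C^n. *)
Definition projective_eigenvariety (C : fieldType) (k n : nat)
    (A : tensor C k n) (lam : C) : set {vspace 'rV[C]_n} :=
  [set L | \dim L = 1%N /\ forall x, x \in L -> eigen_equation A lam x].

(* ------------------------------------------------------------------------ *)
(* The Zariski topology of the affine space C^n                             *)
(* ------------------------------------------------------------------------ *)

Definition zariski_closed (C : comNzRingType) (n : nat) (X : set 'rV[C]_n) :
    Prop :=
  exists S : set {mpoly C[n]},
    X = [set x | forall p, S p -> p.@[fun i => x 0 i] = 0].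

Definition irreducible_closed (C : comNzRingType) (n : nat)
    (X : set 'rV[C]_n) : Prop :=
  [/\ zariski_closed X, X !=set0 &
      forall Y Z : set 'rV[C]_n, zariski_closed Y -> zariski_closed Z ->
        X `<=` Y `|` Z -> X `<=` Y \/ X `<=` Z].

Definition irreducible_components (C : comNzRingType) (n : nat)
    (V : set 'rV[C]_n) : set (set 'rV[C]_n) :=
  [set X | [/\ irreducible_closed X, X `<=` V &
               forall Y, irreducible_closed Y -> X `<=` Y -> Y `<=` V ->
                 Y = X]].

(* A chain Z_0 < Z_1 < ... < Z_d of irreducible closed subsets of X *)
Definition irreducible_chain (C : comNzRingType) (n : nat)
    (X : set 'rV[C]_n) (d : nat) : Prop :=
  exists Z : nat -> set 'rV[C]_n,
    (forall i, (i <= d)%N -> irreducible_closed (Z i) /\ Z i `<=` X) /\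
    (forall i, (i < d)%N -> Z i `<` Z i.+1).

Definition zariski_dim (C : comNzRingType) (n : nat) (X : set 'rV[C]_n) : nat :=
  xget 0%N [set d | irreducible_chain X d /\
                    forall e, irreducible_chain X e -> (e <= d)%N].

Local Close Scope classical_set_scope.
Local Open Scope set_scope.

(* ------------------------------------------------------------------------ *)
(* Hypergraphs                                                              *)
(* ------------------------------------------------------------------------ *)

Definition hypergraph (V : finType) : Type := {set {set V}}.

Definition uniform (k : nat) (V : finType) (H : hypergraph V) : Prop :=
  forall e : {set V}, e \in H -> #|e| = k.

(* The dimension is #|V|, for the numbering v_i = enum_val i of V. For a    *)
(* k-uniform H the condition {v_i, v_i2, ..., v_ik} \in H forces the k      *)
(* indices to be distinct.                                                  *)
Definition adjacency_tensor (C : fieldType) (k : nat) (V : finType)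
    (H : hypergraph V) : tensor C k #|V| :=
  fun i t =>
    if [set enum_val j | j in (i :: t : seq 'I_#|V|)] \in (H : {set {set V}})
    then ((k.-1)`!%:R)^-1 else 0.
Arguments adjacency_tensor C k {V} H.

Definition hadj (V : finType) (H : hypergraph V) : rel V :=
  fun u v => [exists e : {set V}, [&& e \in H, u \in e & v \in e]].

Definition hconnected (V : finType) (H : hypergraph V) : Prop :=
  (0 < #|V|)%N /\ forall u v : V, connect (hadj H) u v.

(* [ordS] is the cyclic successor on 'I_l. *)
Definition berge_cycle (V : finType) (H : hypergraph V) (l : nat)
    (v : 'I_l -> V) (e : 'I_l -> {set V}) : Prop :=
  [/\ (2 <= l)%N, injective v, injective e &
      forall i, [/\ e i \in H, v i \in e i & v (ordS i) \in e i]].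

Definition hypertree (V : finType) (H : hypergraph V) : Prop :=
  hconnected H /\
  forall (l : nat) (v : 'I_l -> V) (e : 'I_l -> {set V}),
    ~ berge_cycle H v e.

(* A simple graph is a 2-uniform hypergraph. *)
Definition connected_simple_graph (W : finType) (G : hypergraph W) : Prop :=
  uniform 2 G /\ hconnected G.

Definition power_vertex (k : nat) (W : finType) (G : hypergraph W) : finType :=
  (W + {e : {set W} | e \in G} * 'I_(k - 2))%type.

Definition power_edge (k : nat) (W : finType) (G : hypergraph W)
    (e : {e : {set W} | e \in G}) : {set power_vertex k G} :=
  [set inl w | w in val e] :|: [set inr (e, j) | j : 'I_(k - 2)].

Definition power (k : nat) (W : finType) (G : hypergraph W) :
    hypergraph (power_vertex k G) :=
  [set power_edge k e | e : {e : {set W} | e \in G}].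

Definition hypergraph_iso (V V' : finType) (H : hypergraph V)
    (H' : hypergraph V') : Prop :=
  exists2 f : V -> V', bijective f &
    H' = [set f @: (e : {set V}) | e in H].

Definition complete_uniform (k : nat) (V : finType) : hypergraph V :=
  [set e : {set V} | #|e| == k].

(* Main.v *)
(* The adjacency tensor of any connected k-uniform hypergraph is treated; the
   three classes only enter through their connectivity.

   Resultant. The polynomials vanishing on the set S of systems with a
   nontrivial zero form a prime ideal, S being the image of an affine space
   under (F, x, L) |-> L(x)^d F - F(x) L^d. Elimination over the ring of
   coefficients shows that S is the zero set of this ideal. The ideal is
   principal because polynomial rings are factorial and no nonzero polynomial
   vanishes on S + C (x_1^d, ..., x_n^d).

   Multiplicity. Let every zero p of the system F0 = lambda x^[k-1] - A x^(k-1)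
   be nondegenerate: the differential of F0 at p, on a complement of p, together
   with the vector (p_i^d) is an isomorphism. The lowest form of the resultant
   at F0 then vanishes on a hyperplane attached to each of the projective
   zeros, so that the multiplicity is at least their number. Conversely, a
   generic perturbation of F0 makes the roots of the resultant simple; the roots
   tending to 0 carry zeros converging to zeros of F0, and two of them cannot
   converge to the same one, by a first order expansion along an ultrafilter.

   Nondegeneracy. By Perron-Frobenius, an eigenvector x for an eigenvalue of
   maximal modulus has all its moduli positive, and the product of the
   coordinates over an edge e is a constant phase times that of the moduli. After
   scaling rows and columns by x, the differential becomes a constant multiple of
   the Laplacian of a connected weighted graph, whose kernel is spanned by the
   all-ones vector. *)

Require Import Defs.
From HB Require Import structures.
From mathcomp Require Import all_boot all_order all_algebra.
From mathcomp Require Import complex mpoly.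
From mathcomp Require Import boolp classical_sets functions cardinality reals.
From mathcomp Require Import filter ring lra zify.

Set Implicit Arguments.
Unset Strict Implicit.
Unset Printing Implicit Defensive.

Import Order.TTheory GRing.Theory Num.Theory.

Local Open Scope ring_scope.

(** * Polynomial rings over a factorial domain are factorial *)

Section Factorial.

(** The characteristic polynomial is defined through [xget], which returns 0 when no polynomial
    satisfies [is_resultant]; this is why a resultant has to be constructed. Afterwards it is
    accessible through three facts only: its zero set is S, it is irreducible, and it is 1 at E, the
    coefficient vector of (x_1^d, ..., x_n^d). They replace degree formulas. S is a cone, hence the
    resultant is homogeneous; its value at E makes it monic along every line of direction E; being
    prime, it is separable on a generic such line. Moving lambda is moving along E, so am(lambda) is
    the multiplicity of the root 0 of t |-> Res(F0 + t E). The number of projective zeros is not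
    known to be finite in advance; it becomes so because the lower bound applies to every finite
    family of pairwise nonproportional zeros. Limits are taken along an ultrafilter so that all
    roots, zeros and difference quotients converge at once. Maximal modulus 0 occurs only without
    edges, that is with a single vertex, and is treated apart. *)

Definition divides (R : nzRingType) (x y : R) := exists z, y = z * x.

Definition prime_elt (R : idomainType) (p : R) :=
  [/\ p != 0, p \isn't a GRing.unit &
      forall x y, divides p (x * y) -> divides p x \/ divides p y].

(** Only the existence of prime factorizations is asked: their uniqueness up to units follows from
    primality. *)
Definition factorial_domain (R : idomainType) :=
  forall x : R, x != 0 -> exists2 s : seq R,
    (forall p, p \in s -> prime_elt p) &
    exists2 u, u \is a GRing.unit & x = u * \prod_(p <- s) p.

Lemma divides_sum (R : nzRingType) (I : Type) (r : seq I) (P : pred I)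
    (F : I -> R) p :
  (forall i, P i -> divides p (F i)) -> divides p (\sum_(i <- r | P i) F i).
Proof.
move=> h; elim/big_ind: _ => //; first by exists 0; rewrite mul0r.
by move=> _ _ [a ->] [b ->]; exists (a + b); rewrite mulrDl.
Qed.

Lemma dividesMl (R : nzRingType) (p x y : R) :
  divides p y -> divides p (x * y).
Proof. by move=> [z ->]; exists (x * z); rewrite mulrA. Qed.

Lemma dividesMr (R : comNzRingType) (p x y : R) :
  divides p x -> divides p (x * y).
Proof. by rewrite mulrC; exact: dividesMl. Qed.

Lemma prime_not_unit_divides (R : idomainType) (p u : R) :
  prime_elt p -> u \is a GRing.unit -> ~ divides p u.
Proof. by case=> _ /negP np _ uu [z zE]; apply: np; move: uu; rewrite zE unitrM => /andP[]. Qed.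

Lemma prime_divides_prod (R : idomainType) (p : R) (s : seq R) :
  prime_elt p -> divides p (\prod_(q <- s) q) ->
  exists2 q, q \in s & divides p q.
Proof.
move=> pp; elim: s => [|a s IH].
  by rewrite big_nil => /prime_not_unit_divides-/(_ pp (unitr1 _)).
rewrite big_cons; case: (pp) => _ _ h /h[pa|/IH[q qs pq]].
  by exists a; rewrite ?mem_head.
by exists q; rewrite // inE qs orbT.
Qed.

Lemma prime_divides_prime (R : idomainType) (p q : R) :
  prime_elt p -> prime_elt q -> divides p q ->
  exists2 w, w \is a GRing.unit & q = w * p.
Proof.
move=> pp [q0 qnu qp] [z zE]; exists z => //.
have [|[w wE]|[w wE]] := qp z p; first by exists 1; rewrite mul1r.
  case: pp => _ /negP[]; apply/unitrP; exists w.
  have z0 : z != 0 by apply: contraNneq q0 => z0; rewrite zE z0 mul0r.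
  have : w * p = 1 by apply: (mulfI z0); rewrite mulrCA -zE -wE mulr1.
  by move=> E; rewrite E mulrC E.
have p0 : p != 0 by apply: contraNneq q0 => p0; rewrite zE p0 mulr0.
apply/unitrP; exists w; suff E : w * z = 1 by rewrite E mulrC E.
by apply: (mulIf p0); rewrite mul1r -mulrA -zE -wE.
Qed.

(** Pick a prime factor p of x: irreducibility forces the cofactor to be a unit, so x is associated
    to p. *)
Lemma factorial_irreducible_prime (R : idomainType) (x : R) :
  factorial_domain R -> x != 0 -> x \isn't a GRing.unit ->
  (forall q r, x = q * r -> q \is a GRing.unit \/ r \is a GRing.unit) ->
  prime_elt x.
Proof.
move=> fR x0 xnu xi; have [[|p s] ps [u uu xE]] := fR x x0.
  by move: xnu; rewrite xE big_nil mulr1 uu.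
rewrite big_cons in xE.
have pp : prime_elt p by apply: ps; rewrite mem_head.
have [p0 pnu pd] := pp.
have [|pu|vu] := xi p (u * \prod_(q <- s) q); first by rewrite xE mulrCA.
  by rewrite pu in pnu.
set v := u * _ in vu.
have xpE : x = v * p by rewrite xE mulrCA mulrC.
split=> // a b [z zE].
have [|[w aE]|[w bE]] := pd a b; first by exists (z * v); rewrite zE xpE mulrA.
  by left; exists (w * v^-1); rewrite aE xpE mulrA mulrVK.
by right; exists (w * v^-1); rewrite bE xpE mulrA mulrVK.
Qed.

Lemma divides_polyC (R : idomainType) (c : R) (f : {poly R}) :
  divides c%:P f <-> forall i, divides c f`_i.
Proof.
split=> [[g ->] i|h].
  by rewrite coefMC; exists g`_i.
have [z zE] := choice h.
exists (\poly_(i < size f) z i); apply/polyP => i.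
rewrite coefMC coef_poly; case: ltnP => // hi.
by rewrite mul0r nth_default.
Qed.

(** Gauss's lemma: if f_i and g_j are the first coefficients of f and g that p does not divide, p
    divides every other term of the coefficient of degree i + j of f g, so it would divide f_i
    g_j. *)
Lemma prime_polyC (R : idomainType) (p : R) :
  prime_elt p -> prime_elt (p%:P : {poly R}).
Proof.
move=> pp; have [p0 pnu pd] := pp.
split; rewrite ?polyC_eq0 //.
  apply: contra pnu; rewrite poly_unitE => /andP[_].
  by rewrite coefC eqxx.
move=> f g fg.
have [|nf] := pselect (divides p%:P f); first by left.
have [|ng] := pselect (divides p%:P g); first by right.
exfalso.
have ex (h : {poly R}) : ~ divides p%:P h ->
    exists2 i, ~ divides p h`_i & forall j, (j < i)%N -> divides p h`_j.
  rewrite divides_polyC => /existsNP[i hi].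
  have exi : exists i, `[< ~ divides p h`_i >] by exists i; apply/asboolP.
  case: (ex_minnP exi) => m /asboolP nm mmin; exists m => // j jm.
  apply: contrapT => nj; have := mmin j; rewrite leqNgt jm /=.
  by move=> H; have := H (introT (asboolP _) nj).
have [i ni hi] := ex f nf; have [j nj hj] := ex g ng.
have /divides_polyC/(_ (i + j)%N) := fg.
rewrite coefM (bigD1 (inord i)) //= inordK ?ltnS ?leq_addr //.
rewrite addKn => D.
have D2 : divides p (\sum_(i0 < (i + j).+1 | i0 != inord i) f`_i0 * g`_(i + j - i0)).
  apply: divides_sum => l li.
  have [lti|gti|eqi] := ltngtP l i; first exact/dividesMr/hi.
    apply/dividesMl/hj; have := ltn_ord l; rewrite ltnS => lij.
    by rewrite ltn_subLR // ltn_add2r.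
  by move: li; rewrite -val_eqE /= inordK ?ltnS ?leq_addr // eqi eqxx.
have : divides p (f`_i * g`_j).
  move: D D2; set S := \sum_(_ < _ | _) _ => -[a aE] [b bE].
  by exists (a - b); rewrite mulrBl -aE -bE addrK.
by move=> /pd[].
Qed.

Definition primitive_poly (R : idomainType) (f : {poly R}) :=
  forall p, prime_elt p -> ~ divides p%:P f.

(** The prime factors of c are cancelled one by one: each of them, as a constant, divides q h, hence
    q, since h is primitive. *)
Lemma primitive_divides (R : idomainType) (c : R) (f q h : {poly R}) :
  factorial_domain R -> primitive_poly h -> c != 0 -> c *: f = q * h ->
  divides h f.
Proof.
move=> fR hp c0; have [s ps [u uu ->]] := fR c c0.
elim: s ps q => [|p s IH] ps q.
  rewrite big_nil mulr1 => E; exists (u^-1 *: q).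
  by rewrite -scalerAl -E scalerA mulVr // scale1r.
rewrite big_cons => E.
have pp : prime_elt p by apply: ps; rewrite mem_head.
have [_ _ pd] := prime_polyC pp.
have [|[q1 q1E]|/hp-/(_ pp)//] := pd q h.
  exists ((u * \prod_(j <- s) j) *: f).
  by rewrite -E [RHS]mulrC mul_polyC scalerA mulrCA.
apply: (IH _ q1) => [r rs|]; first by apply: ps; rewrite inE rs orbT.
have p0 : p != 0 by case: pp.
apply: (@mulfI _ p%:P); first by rewrite polyC_eq0.
by rewrite mul_polyC scalerA mulrCA E q1E mulrA [p%:P * _]mulrC.
Qed.

(** A prime constant dividing f also divides its leading coefficient, so extraction stops after at
    most as many steps as this coefficient has prime factors. *)
Lemma primitive_part (R : idomainType) (f : {poly R}) :
  factorial_domain R -> f != 0 ->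
  exists c g, [/\ c != 0, primitive_poly g & f = c *: g].
Proof.
move=> fR f0; have lf0 : lead_coef f != 0 by rewrite lead_coef_eq0.
have [s ps [u uu lE]] := fR _ lf0.
move: {2}(size s) (leqnn (size s)) => m.
elim: m s ps u uu f f0 {lf0} lE => [|m IH] s ps u uu f f0 lE sm.
  exists 1, f; split; rewrite ?oner_neq0 ?scale1r //.
  move=> p pp [q qE]; move: sm lE; rewrite leqn0 => /nilP ->.
  rewrite big_nil mulr1 qE mulrC lead_coefM lead_coefC => E.
  by apply: (prime_not_unit_divides pp uu); exists (lead_coef q); rewrite -E mulrC.
have [pr|] := pselect (primitive_poly f).
  by exists 1, f; rewrite oner_neq0 scale1r.
move=> /existsNP[p /not_implyP[pp /contrapT[q qE]]].
have p0 : p != 0 by case: pp.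
have q0 : q != 0 by apply: contraNneq f0 => q0; rewrite qE q0 mul0r.
have lE2 : u * \prod_(j <- s) j = lead_coef q * p.
  by rewrite -lE qE lead_coefM lead_coefC.
have [_ _ pd] := pp.
have [|du|/(prime_divides_prod pp)[r rs dpr]] := pd u (\prod_(j <- s) j).
- by exists (lead_coef q).
- by have := prime_not_unit_divides pp uu du.
have [w wu rE] := prime_divides_prime pp (ps r rs) dpr.
have [] := IH (rem r s) _ (u * w) _ q q0.
- by move=> a /mem_rem; exact: ps.
- by rewrite unitrM uu.
- apply: (mulIf p0); rewrite -lE2 (perm_big _ (perm_to_rem rs)) /= big_cons rE.
  by rewrite -!mulrA; congr (_ * (_ * _)); rewrite mulrC.
- by rewrite size_rem //; case: (s) sm.
move=> c [g [c0 gp qg]]; exists (c * p), g; split=> //; first by rewrite mulf_neq0.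
by rewrite qE qg mulrC mul_polyC scalerA mulrC.
Qed.

(** The primitive part h of the pseudo-gcd of f and x divides f. If the cofactor is constant, f
    divides x up to constants. If h is constant, the Bezout relation of f and x, multiplied by y,
    shows that f divides a constant multiple of y. Primitivity of f removes the constants. *)
Lemma primitive_irreducible_prime (R : idomainType) (f : {poly R}) :
  factorial_domain R -> (1 < size f)%N -> primitive_poly f ->
  (forall a b, f = a * b -> (size a <= 1)%N \/ (size b <= 1)%N) ->
  prime_elt f.
Proof.
move=> fR sf pf fi.
have f0 : f != 0 by rewrite -size_poly_gt0 ltnW.
split => //.
  by rewrite poly_unitE; case: eqP sf => // ->.
move=> x y [z zE].
have h00 : gcdp f x != 0 by rewrite gcdp_eq0 negb_and f0.
have [c [h [c0 hp hE]]] := primitive_part fR h00.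
have [[c1 q1] c10 /= qE] := Pdiv.Idomain.dvdpP _ _ (dvdp_gcdl f x).
have [q' fE] : divides h f.
  by apply: (primitive_divides fR hp c10 (q := c *: q1)); rewrite qE hE -scalerAl -scalerAr.
have [sq|sh] := fi _ _ fE.
  left; have [[c2 q2] c20 /= xE] := Pdiv.Idomain.dvdpP _ _ (dvdp_gcdr f x).
  have q'E := size1_polyC sq.
  have e0 : q'`_0 != 0.
    by apply: contraNneq f0 => e0; rewrite fE q'E e0 mul0r.
  apply: (primitive_divides fR pf (c := q'`_0 * c2) (q := c *: q2)).
    by rewrite mulf_neq0.
  rewrite -scalerA xE hE fE [in RHS]q'E mul_polyC -!scalerAr -!scalerAl.
  by rewrite !scalerA.
right.
have cop : coprimep f x.
  rewrite /coprimep hE size_scale // eqn_leq sh /=.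
  by rewrite size_poly_gt0; apply: contraNneq h00 => h0; rewrite hE h0 scaler0.
have [[u v] /= /eqpP[[c3 c4] /= /andP[c30 c40] E]] := Bezout_coprimepP _ _ cop.
apply: (primitive_divides fR pf c40 (q := c3 *: (u * y) + c3 *: (v * z))).
rewrite -[y in LHS]mul1r scalerAl -E -scalerAl mulrDl scalerDr mulrDl.
congr (_ + _); first by rewrite -scalerAl -!mulrA [y * f]mulrC.
by rewrite -scalerAl -!mulrA zE.
Qed.

(** A primitive polynomial is split into factors of positive degree, which remain primitive, until
    none splits further; the content is factored in R. *)
Lemma factorial_poly (R : idomainType) :
  factorial_domain R -> factorial_domain {poly R}.
Proof.
move=> fR.
have main (m : nat) (f : {poly R}) : (size f <= m)%N -> f != 0 -> primitive_poly f ->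
    exists2 s : seq {poly R}, (forall p, p \in s -> prime_elt p) &
    exists2 u, u \is a GRing.unit & f = u * \prod_(p <- s) p.
  elim: m f => [f|m IH f sf f0 pf].
    by rewrite leqn0 size_poly_eq0 => /eqP ->; rewrite eqxx.
  have [s1|s1] := leqP (size f) 1.
    exists [::] => //; exists f; last by rewrite big_nil mulr1.
    have fE := size1_polyC s1.
    have c0 : f`_0 != 0 by apply: contraNneq f0 => c0; rewrite fE c0.
    have [[|p s] ps [u uu cE]] := fR _ c0.
      rewrite big_nil mulr1 in cE.
      by rewrite fE cE; apply: rmorph_unit.
    case: (pf p); first by apply: ps; rewrite mem_head.
    rewrite big_cons in cE.
    by exists (u * \prod_(j <- s) j)%:P; rewrite -polyCM [in LHS]fE cE mulrAC mulrA.
  have [fi|] := pselect (forall a b, f = a * b -> (size a <= 1)%N \/ (size b <= 1)%N).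
    exists [:: f].
      by move=> p; rewrite inE => /eqP ->; exact: primitive_irreducible_prime.
    by exists 1; rewrite ?unitr1 // big_seq1 mul1r.
  move=> /existsNP[a /existsNP[b /not_implyP[fE /not_orP[/negP sa /negP sb]]]].
  rewrite -!ltnNge in sa sb.
  have a0 : a != 0 by rewrite -size_poly_gt0 ltnW.
  have b0 : b != 0 by rewrite -size_poly_gt0 ltnW.
  have sE : size f = (size a + size b).-1 by rewrite fE size_mul.
  have pa : primitive_poly a.
    by move=> p pp da; apply: (pf p pp); rewrite fE; exact: dividesMr.
  have pb : primitive_poly b.
    by move=> p pp db; apply: (pf p pp); rewrite fE; exact: dividesMl.
  have [|//|//|s1' ps1 [u1 uu1 aE]] := IH a.
    rewrite -ltnS; apply: leq_trans sf; rewrite sE.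
    by rewrite -ltnS prednK ?addn_gt0 ?size_poly_gt0 ?a0 // -addn2 leq_add2l.
  have [|//|//|s2 ps2 [u2 uu2 bE]] := IH b.
    rewrite -ltnS; apply: leq_trans sf; rewrite sE.
    by rewrite -ltnS prednK ?addn_gt0 ?size_poly_gt0 ?a0 // -add2n leq_add2r.
  exists (s1' ++ s2).
    by move=> p; rewrite mem_cat => /orP[/ps1|/ps2].
  exists (u1 * u2); first by rewrite unitrM uu1.
  by rewrite big_cat /= fE aE bE mulrACA.
move=> f f0; have [c [g [c0 gp fE]]] := primitive_part fR f0.
have [|s ps [u uu gE]] := main _ g (leqnn _) _ gp.
  by apply: contraNneq f0 => g0; rewrite fE g0 scaler0.
have [t pt [v vu cE]] := fR c c0.
exists ([seq p%:P | p <- t] ++ s).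
  move=> p; rewrite mem_cat => /orP[/mapP[q qt ->]|/ps //].
  exact/prime_polyC/pt.
exists (v%:P * u).
  by rewrite unitrM uu andbT; apply: rmorph_unit.
rewrite big_cat /= big_map fE cE -mul_polyC gE polyCM rmorph_prod /=.
by rewrite mulrACA.
Qed.

Lemma prime_iso (R S : idomainType) (f : {rmorphism R -> S})
    (g : {rmorphism S -> R}) (p : R) :
  cancel f g -> cancel g f -> prime_elt p -> prime_elt (f p).
Proof.
move=> fK gK [p0 pnu pd]; split.
- by apply: contraNneq p0 => E; rewrite -(fK p) E rmorph0.
- by apply: contra pnu => /(rmorph_unit g); rewrite fK.
move=> a b [z zE]; have [|[w wE]|[w wE]] := pd (g a) (g b).
- by exists (g z); rewrite -rmorphM zE rmorphM fK.
- by left; exists (f w); rewrite -rmorphM -wE gK.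
- by right; exists (f w); rewrite -rmorphM -wE gK.
Qed.

Lemma factorial_iso (R S : idomainType) (f : {rmorphism R -> S})
    (g : {rmorphism S -> R}) :
  cancel f g -> cancel g f -> factorial_domain S -> factorial_domain R.
Proof.
move=> fK gK fS x x0.
have fx0 : f x != 0 by rewrite -(inj_eq (can_inj fK)) rmorph0 in x0 *.
have [s ps [u uu fE]] := fS _ fx0.
exists (map g s); last first.
  exists (g u); first exact: rmorph_unit.
  by rewrite big_map -rmorph_prod -rmorphM -fE fK.
by move=> _ /mapP[q /ps pq ->]; exact: (prime_iso gK fK).
Qed.

Lemma mpoly_rmorph_eq (n : nat) (R : nzRingType) (S : nzRingType)
    (f g : {rmorphism {mpoly R[n]} -> S}) :
  (forall c, f c%:MP = g c%:MP) -> (forall i, f 'X_i = g 'X_i) -> f =1 g.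
Proof.
move=> hC hX p; rewrite [p]mpolyE !rmorph_sum; apply: eq_bigr => m _.
rewrite -mul_mpolyC !rmorphM hC; congr (_ * _).
rewrite mpolyXE_id !rmorph_prod; apply: eq_bigr => i _.
by rewrite !rmorphXn hX.
Qed.

Definition of_muni (n : nat) (R : comNzRingType) (q : {poly {mpoly R[n]}}) :
    {mpoly R[n.+1]} := (map_poly (@mwiden n R) q).['X_ord_max].

HB.instance Definition _ (n : nat) (R : comNzRingType) :=
  GRing.RMorphism.copy (@of_muni n R)
    (horner_eval ('X_ord_max : {mpoly R[n.+1]}) \o map_poly (@mwiden n R)).

Lemma muniX_widen (n : nat) (R : nzRingType) (i : 'I_n) :
  muni ('X_(widen_ord (leqnSn n) i) : {mpoly R[n.+1]}) = ('X_i)%:P.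
Proof.
rewrite /muni mmapX mmap1U; case: splitP => [j eq|j].
  by congr ('X__)%:P; apply/val_inj=> /=; rewrite -eq.
by rewrite ord1 /= addn0 => /eqP /=; rewrite ltn_eqF.
Qed.

Lemma muniX_max (n : nat) (R : nzRingType) :
  muni ('X_ord_max : {mpoly R[n.+1]}) = 'X.
Proof.
rewrite /muni mmapX mmap1U; case: splitP=> //; case=> j lt_jn /eqP /=.
by have := lt_jn; rewrite ltn_neqAle eq_sym=> /andP[/negbTE->].
Qed.

Lemma mwidenXU (n : nat) (R : nzRingType) (i : 'I_n) :
  mwiden ('X_i : {mpoly R[n]}) = 'X_(widen_ord (leqnSn n) i).
Proof. by rewrite mwidenX mnmwiden1. Qed.

Lemma muni_mwiden (n : nat) (R : nzRingType) (p : {mpoly R[n]}) :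
  muni (mwiden p) = p%:P.
Proof.
have := @mpoly_rmorph_eq n R _ (@muni n R \o @mwiden n R) (@polyC {mpoly R[n]}).
apply=> [c|i] /=; first by rewrite mwidenC muniC.
by rewrite mwidenXU muniX_widen.
Qed.

Lemma muniK (n : nat) (R : comNzRingType) : cancel (@muni n R) (@of_muni n R).
Proof.
move=> p; have := @mpoly_rmorph_eq n.+1 R _ (@of_muni n R \o @muni n R) idfun.
apply=> [c|i] /=; first by rewrite muniC /of_muni map_polyC hornerC /= mwidenC.
case: (unliftP ord_max i) => [j ->|->].
  have -> : lift ord_max j = widen_ord (leqnSn n) j.
    by apply/val_inj; rewrite /= /bump leqNgt ltn_ord.
  by rewrite muniX_widen /of_muni map_polyC hornerC /= mwidenXU.
by rewrite muniX_max /of_muni map_polyX hornerX.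
Qed.

Lemma of_muniK (n : nat) (R : comNzRingType) : cancel (@of_muni n R) (@muni n R).
Proof.
move=> q; rewrite /of_muni; elim/poly_ind: q => [|q c IH].
  by rewrite rmorph0 horner0 muni0.
rewrite rmorphD rmorphM /= map_polyX map_polyC hornerMXaddC muniD muniM /= IH.
by rewrite muniX_max muni_mwiden.
Qed.

Lemma factorial_mpoly (K : fieldType) (n : nat) : factorial_domain {mpoly K[n]}.
Proof.
elim: n => [|n IH].
  move=> p p0; exists [::] => //; exists p; last by rewrite big_nil mulr1.
  have pE := nvar0_mpolyC p.
  rewrite pE; apply/unitrP; exists ((p@_0%MM)^-1)%:MP.
  have c0 : p@_0%MM != 0 by apply: contraNneq p0 => c0; rewrite pE c0 mpolyC0.
  by rewrite -!mpolyCM mulVf // mulfV // mpolyC1.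
exact: (factorial_iso (@muniK n K) (@of_muniK n K) (factorial_poly IH)).
Qed.

Lemma mpoly_irreducible_prime (K : fieldType) (n : nat) (p : {mpoly K[n]}) :
  mpoly_irreducible p -> prime_elt p.
Proof.
by case=> p0 pu pi; apply: factorial_irreducible_prime => //; exact: factorial_mpoly.
Qed.

End Factorial.

(** * Elimination for homogeneous ideals *)

Section Elimination.

Definition ideal_pred (R : nzRingType) (J : R -> Prop) :=
  [/\ J 0, forall x y, J x -> J y -> J (x + y) & forall x y, J y -> J (x * y)].

Lemma ideal_sum (R : nzRingType) (J : R -> Prop) (I : Type) (r : seq I)
    (P : pred I) (F : I -> R) :
  ideal_pred J -> (forall i, P i -> J (F i)) -> J (\sum_(i <- r | P i) F i).
Proof. by case=> J0 JD _ h; elim/big_ind: _. Qed.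

Lemma idealB (R : nzRingType) (J : R -> Prop) (x y : R) :
  ideal_pred J -> J x -> J y -> J (x - y).
Proof. by case=> _ JD JM Jx Jy; apply: JD => //; rewrite -mulN1r; exact: JM. Qed.

(** f lies in the radical of the ideal generated by J once e is inverted. *)
Definition radical_at (R : nzRingType) (J : R -> Prop) (e f : R) :=
  exists K N, J (e ^+ N * f ^+ K).

Section Radical.
Variables (R : comNzRingType) (J : R -> Prop) (e : R).
Hypothesis idJ : ideal_pred J.

Lemma radical_in f : J f -> radical_at J e f.
Proof. by move=> Jf; exists 1%N, 0%N; rewrite expr0 mul1r expr1. Qed.

Lemma radicalM g f : radical_at J e f -> radical_at J e (g * f).
Proof.
case: idJ => _ _ JM [K [N h]]; exists K, N.
by rewrite exprMn mulrCA; exact: JM.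
Qed.

Lemma radicalD f g : radical_at J e f -> radical_at J e g -> radical_at J e (f + g).
Proof.
case: (idJ) => _ _ JM [K [N h]] [L [M h']]; exists (K + L)%N, (N + M)%N.
rewrite exprDn mulr_sumr; apply: ideal_sum => // i _.
rewrite mulrnAr -mulr_natl; apply: (JM).
(* In each binomial term, either the exponent of g reaches L or that of f reaches K. *)
have [Li|iL] := leqP L i.
  rewrite exprD -(subnK Li) exprD.
  have -> : forall a b c d t : R, a * b * (c * (d * t)) = a * c * d * (b * t).
    by move=> a b c d t; ring.
  exact: JM.
have -> : (K + L - i = (L - i) + K)%N by rewrite -addnBA ?(ltnW iL) // addnC.
rewrite !exprD.
have -> : forall a b c d t : R, a * b * (c * d * t) = b * c * t * (a * d).
  by move=> a b c d t; ring.
exact: JM.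
Qed.

Lemma radical_sum (I : Type) (r : seq I) (P : pred I) (F : I -> R) :
  (forall i, P i -> radical_at J e (F i)) ->
  radical_at J e (\sum_(i <- r | P i) F i).
Proof.
move=> h; elim/big_ind: _ => //; last exact: radicalD.
by apply: radical_in; case: idJ.
Qed.

Lemma radical_uniform (I : finType) (F : I -> R) :
  (forall i, radical_at J e (F i)) ->
  exists K N, forall i, J (e ^+ N * F i ^+ K).
Proof.
case: idJ => _ _ JM h.
have [K hK] := choice h; have [N hN] := choice hK.
exists (\sum_i K i)%N, (\sum_i N i)%N => i.
rewrite (bigD1 i) //= [X in _ * F i ^+ X](bigD1 i) //= !exprD.
by rewrite [e ^+ _ * _]mulrC [F i ^+ _ * _]mulrC mulrACA; exact: JM.
Qed.

End Radical.

Definition graded_pred (n : nat) (R : nzRingType) (J : {mpoly R[n]} -> Prop) :=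
  forall d p, J p -> J (pihomog (@mdeg n) d p).

Lemma mnm_rcons_widen (n : nat) (m : 'X_{1..n}) (j : nat) i :
  ([multinom of rcons m j] : 'X_{1..n.+1}) (widen_ord (leqnSn n) i) = m i.
Proof.
by rewrite !(mnm_nth 0%N) /= nth_rcons size_tuple ltn_ord.
Qed.

Lemma mnm_rcons_max (n : nat) (m : 'X_{1..n}) (j : nat) :
  ([multinom of rcons m j] : 'X_{1..n.+1}) ord_max = j.
Proof. by rewrite (mnm_nth 0%N) /= nth_rcons size_tuple ltnn eqxx. Qed.

Lemma mdeg_rcons (n : nat) (m : 'X_{1..n}) (j : nat) :
  mdeg [multinom of rcons m j] = (mdeg m + j)%N.
Proof. by rewrite /mdeg /= big_rcons /= addnC. Qed.

Lemma ord_max_or_widen (n : nat) (i : 'I_n.+1) :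
  i = ord_max \/ exists j, i = widen_ord (leqnSn n) j.
Proof.
case: (unliftP ord_max i) => [j ->|->]; last by left.
by right; exists j; apply/val_inj; rewrite /= /bump leqNgt ltn_ord.
Qed.

Lemma muni_coef (n : nat) (R : comNzRingType) (p : {mpoly R[n.+1]}) j m :
  ((muni p)`_j)@_m = p@_[multinom of rcons m j].
Proof.
rewrite muniE coef_sum raddf_sum /= [in RHS](mpolyE p) raddf_sum /=.
apply: eq_bigr => m' _; rewrite coefZ coefXn mcoeffZ mcoeffX.
rewrite mulr_natr mcoeffMn mcoeffZ mcoeffX -mulrnAr -mulrnA mulnb.
congr (_ * (nat_of_bool _)%:R); apply/andP/eqP => [[/eqP <- /eqP ->]|->].
  apply/mnmP => i; have [->|[l ->]] := ord_max_or_widen i.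
    by rewrite mnm_rcons_max.
  by rewrite mnm_rcons_widen mnmE.
rewrite mnm_rcons_max eqxx; split => //; apply/eqP/mnmP => i.
by rewrite mnmE mnm_rcons_widen.
Qed.

Lemma pihomog_mwiden (n : nat) (R : comNzRingType) (p : {mpoly R[n]}) d :
  pihomog (@mdeg n.+1) d (mwiden p) = mwiden (pihomog (@mdeg n) d p).
Proof.
rewrite [in RHS]pihomogE [in LHS](mpolyE p) !(raddf_sum (@mwiden n R)) (linear_sum (pihomog _ _)) /= [RHS]big_mkcond /=.
apply: eq_bigr => m _.
rewrite mwidenZ mwidenX linearZ /= pihomogX.
have E : mdeg (mnmwiden m) = mdeg m by rewrite [LHS]mdeg_rcons addn0.
rewrite -{1}E.
by case: eqP => _; rewrite ?scaler0 // mwidenZ mwidenX.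
Qed.

(* Multiply the coefficient matrix by its adjugate. *)
Lemma det_in_ideal (R : comNzRingType) (J : {poly R} -> Prop) (m : nat)
    (h : 'I_m.+1 -> {poly R}) :
  ideal_pred J -> (forall i, J (h i)) -> (forall i, size (h i) <= m.+1)%N ->
  J (\det (\matrix_(i < m.+1, j < m.+1) (h i)`_j))%:P.
Proof.
move=> idJ Jh sh; set H := \matrix_(i, j) _.
have hE i : h i = \sum_(j < m.+1) H i j *: 'X^j.
  rewrite -[LHS](@coefK _ (h i)) (poly_def (size (h i))).
  rewrite (big_ord_widen _ (fun j => (h i)`_j *: 'X^j) (sh i)) big_mkcond /=.
  apply: eq_bigr => j _; rewrite mxE; case: ltnP => // hj.
  by rewrite nth_default // scale0r.
have -> : (\det H)%:P = \sum_i (\adj H ord0 i)%:P * h i.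
  transitivity (\sum_(j < m.+1) (\adj H *m H) ord0 j *: 'X^j : {poly R}).
    rewrite mul_adj_mx big_ord_recl big1 ?addr0 => [|j _]; rewrite !mxE.
      by rewrite eqxx mulr1n expr0 -alg_polyC.
    by rewrite /= mulr0n scale0r.
  under [RHS]eq_bigr => i _ do rewrite hE mulr_sumr.
  rewrite exchange_big /=; apply: eq_bigr => j _.
  rewrite mxE scaler_suml; apply: eq_bigr => i _.
  by rewrite mul_polyC scalerA.
by apply: ideal_sum => // i _; case: idJ => _ _; apply.
Qed.

(** An element of least degree generates the ideal; it is a constant or has a root. *)
Lemma poly_ideal_root (C : closedFieldType) (T : {poly C} -> Prop) (g : {poly C}) :
  ideal_pred T -> T g -> g != 0 -> T 1 \/ exists a, forall p, T p -> root p a.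
Proof.
move=> idT Tg g0.
have ex : exists m, `[< exists2 p, T p & p != 0 /\ size p = m >].
  by exists (size g); apply/asboolP; exists g.
case: (ex_minnP ex) => m /asboolP[p Tp [p0 sp]] pmin.
have pd q : T q -> p %| q.
  move=> Tq; apply/modp_eq0P/eqP; apply: contraT => r0.
  have : (size (q %% p)%R < size p)%N by rewrite ltn_modp.
  rewrite sp ltnNge pmin //; apply/asboolP; exists (q %% p)%R => //.
  have -> : (q %% p)%R = q - q %/ p * p by rewrite {2}(divp_eq q p) addrAC subrr add0r.
  by apply: idealB => //; case: idT => _ _; apply.
have [s1|/closed_rootP[a pa]] := eqVneq (size p) 1%N.
  left; have /size_poly1P[c c0 pE] : size p == 1%N by rewrite s1.
  have -> : 1 = c^-1%:P * p by rewrite pE -polyCM mulVf.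
  by case: idT => _ _; apply.
right; exists a => q /pd; move: pa; rewrite -!dvdp_XsubCl; exact: dvdp_trans.
Qed.

(* Projection from the point e_n. If some form g of J does not vanish there,
   then g is monic in x_n up to a scalar, so that a zero of the elimination
   ideal of J in the first n - 1 variables lifts to a zero of J: otherwise some
   f in J specializes to 1, and the determinant of the multiplication by f
   modulo g is an element of the elimination ideal that does not vanish. *)
Lemma elimination (A : idomainType) (C : closedFieldType)
    (ev : {rmorphism A -> C}) (s : C -> A) (n : nat) (J : {mpoly A[n]} -> Prop) :
  cancel s ev -> ideal_pred J -> graded_pred J ->
  (exists2 x : 'I_n -> C, exists i, x i != 0 &
     forall p, J p -> mmap ev x p = 0) \/
  (exists2 c, ev c != 0 & exists D, forall i, J (c%:MP * 'X_i ^+ D)).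
Proof.
move=> sK; elim: n J => [|n IH] J idJ grJ.
  by right; exists 1; [rewrite rmorph1 oner_neq0 | exists 0%N => -[]].
have [J0 JD JM] := idJ.
pose e := fun i : 'I_n.+1 => (i == ord_max)%:R : C.
have [ez|] := pselect (forall p, J p -> mmap ev e p = 0).
  by left; exists e => //; exists ord_max; rewrite /e eqxx oner_neq0.
move=> /existsNP[p /not_implyP[Jp /eqP pe]].
have [m mp pm] : exists2 m, ev p@_m != 0 & mmap1 e m != 0.
  apply: contrapT => H; move/eqP: pe; apply; rewrite /mmap big1_seq //= => m _.
  have [->|h1] := eqVneq (ev p@_m) 0; first by rewrite mul0r.
  have [->|h2] := eqVneq (mmap1 e m) 0; first by rewrite mulr0.
  by case: H; exists m.
have m0 i : m (widen_ord (leqnSn n) i) = 0%N.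
  apply/eqP; apply: contraNT pm => mi; rewrite /mmap1.
  rewrite (bigD1 (widen_ord (leqnSn n) i)) //= /e.
  rewrite (_ : (_ == ord_max) = false) ?expr0n ?(negPf mi) ?mul0r //.
  by apply/negP => /eqP/(congr1 val)/= E; have := ltn_ord i; rewrite E ltnn.
pose c := p@_m; pose D := m ord_max.
have mE : m = (U_(ord_max) *+ D)%MM.
  apply/mnmP => i; rewrite mulmnE mnm1E; have [->|[j ->]] := ord_max_or_widen i.
    by rewrite eqxx mul1n.
  rewrite m0 (_ : (_ == _) = false) //.
  by apply/negP => /eqP/(congr1 val)/= E; have := ltn_ord j; rewrite -E ltnn.
have dm : mdeg m = D by rewrite mE mdegMn mdeg1 mul1n.
(* This component belongs to J because J is graded. Its only monomial in the last variable alone is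
   c x^D, and c specializes to a nonzero value. *)
pose g := pihomog (@mdeg n.+1) D p.
have Jg : J g by exact: grJ.
have gco m' : g@_m' = if mdeg m' == D then p@_m' else 0.
  rewrite /g pihomogE raddf_sum /= big_mkcond /=.
  rewrite [in RHS](mpolyE p) raddf_sum /=; case: ifP => hd; last first.
    rewrite big1 // => m1 _; case: ifP => // h1; rewrite mcoeffZ mcoeffX.
    by case: eqP => [E|]; rewrite ?mulr0 //; rewrite E hd in h1.
  apply: eq_bigr => m1 _; rewrite mcoeffZ mcoeffX.
  case: ifP => h1; rewrite ?mcoeffZ ?mcoeffX //.
  by case: eqP => [E|]; rewrite ?mulr0 //; rewrite E hd in h1.
have gD : (muni g)`_D = c%:MP.
  apply/mpolyP => m1; rewrite muni_coef gco mdeg_rcons mcoeffC.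
  have [->|m10] := eqVneq m1 0%MM.
    rewrite mdeg0 add0n eqxx mulr1; congr (p@__); apply/mnmP => i.
    have [->|[j ->]] := ord_max_or_widen i; first by rewrite mnm_rcons_max.
    by rewrite mnm_rcons_widen m0 mnm0E.
  by rewrite -[X in _ == X]add0n eqn_add2r mdeg_eq0 (negPf m10) mulr0.
have c0 : c != 0 by apply: contraNneq mp => c0; rewrite -/c c0 rmorph0.
have sg : size (muni g) = D.+1.
  apply/eqP; rewrite eqn_leq; apply/andP; split.
    apply/leq_sizeP => j Dj; apply/mpolyP => m1.
    rewrite muni_coef gco mdeg_rcons mcoeff0; case: eqP => // E.
    by move: Dj; rewrite -E ltnNge leq_addl.
  by rewrite ltnNge; apply/negP => /leq_sizeP/(_ D (leqnn _))/eqP;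
     rewrite gD mpolyC_eq0 (negPf c0).
(* The elimination ideal, with c inverted. *)
pose J' (f : {mpoly A[n]}) := exists N, J (c%:MP ^+ N * mwiden f).
have idJ' : ideal_pred J'.
  split.
  - by exists 0%N; rewrite mwiden0 mulr0.
  - move=> x y [N Jx] [M Jy]; exists (N + M)%N.
    rewrite mwidenD mulrDr; apply: JD; rewrite exprD; last first.
      by rewrite -mulrA; exact: JM.
    by rewrite [_ ^+ N * _]mulrC -mulrA; exact: JM.
  - by move=> x y [N Jy]; exists N; rewrite mwidenM mulrCA; exact: JM.
have grJ' : graded_pred J'.
  move=> d f [N Jf]; exists N; rewrite -pihomog_mwiden.
  have := grJ d _ Jf.
  by rewrite -rmorphXn /= !mul_mpolyC linearZ.
have [[x [i0 xi0] xz]|[c1 c10 [D1 hD1]]] := IH J' idJ' grJ'; last first.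
  right.
  pose b : {mpoly A[n.+1]} := (c * c1)%:MP.
  have rX i : radical_at J b 'X_(widen_ord (leqnSn n) i).
    have [N] := hD1 i; rewrite mwidenM mwidenC rmorphXn /= mwidenXU => h.
    exists D1, N.+1.
    have -> : b ^+ N.+1 * 'X_(widen_ord (leqnSn n) i) ^+ D1 =
        c%:MP * c1%:MP ^+ N *
        (c%:MP ^+ N * (c1%:MP * 'X_(widen_ord (leqnSn n) i) ^+ D1)).
      by rewrite /b mpolyCM exprS exprMn; ring.
    exact: JM.
  have rXm : radical_at J b 'X_ord_max.
    (* Every monomial of c x^D - g contains one of the other variables, which are already in the
       radical. *)
    have low : radical_at J b (c%:MP * 'X_ord_max ^+ D).
      have -> : c%:MP * 'X_ord_max ^+ D = g + (c%:MP * 'X_ord_max ^+ D - g).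
        by rewrite addrCA subrr addr0.
      apply: radicalD => //; first exact: radical_in.
      set q := _ - g; rewrite [q]mpolyE; rewrite big_seq.
      apply: radical_sum => // m1 m1q.
      rewrite -mul_mpolyC; apply: radicalM => //.
      have [i mi] : exists i, m1 (widen_ord (leqnSn n) i) != 0%N.
        apply: contrapT => H.
        have m1E : m1 = (U_(ord_max) *+ m1 ord_max)%MM.
          apply/mnmP => i; rewrite mulmnE mnm1E.
          have [->|[j ->]] := ord_max_or_widen i; first by rewrite eqxx mul1n.
          rewrite (_ : (ord_max == _) = false); last first.
            by apply/negP => /eqP/(congr1 val)/= E; have := ltn_ord j; rewrite -E ltnn.
          by apply/eqP/negPn/negP => h; apply: H; exists j.
        have : q@_m1 != 0 by rewrite -mcoeff_msupp.
        rewrite /q mcoeffB gco mcoeffCM mcoeffXn -mE {2}m1E mdegMn mdeg1 mul1n.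
        have [E|E] := eqVneq (m1 ord_max) D.
          by rewrite m1E E -mE eqxx mulr1 subrr eqxx.
        by rewrite (_ : (m == m1) = false) ?mulr0 ?subrr ?eqxx //;
           apply: contraNF E => /eqP <-.
      rewrite -(@submK _ U_(widen_ord (leqnSn n) i)%MM m1) ?lep1mP // mpolyXD.
      exact: radicalM.
    have [K [N h]] := low; exists (D * K)%N, (N + K)%N.
    have -> : b ^+ (N + K) * 'X_ord_max ^+ (D * K) =
        c1%:MP ^+ K * (b ^+ N * (c%:MP * 'X_ord_max ^+ D) ^+ K).
      by rewrite exprD {2}/b mpolyCM !exprMn -exprM; ring.
    exact: JM.
  have [|K [N h]] := @radical_uniform _ J b idJ _ (fun i : 'I_n.+1 => 'X_i).
    by move=> i; have [->|[j ->]] := ord_max_or_widen i.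
  exists ((c * c1) ^+ N); first by rewrite rmorphXn rmorphM /= expf_neq0 ?mulf_neq0.
  by exists K => i; rewrite rmorphXn; exact: h.
left.
have [phi phiE] : exists phi : {rmorphism {mpoly A[n]} -> C},
    forall q, phi q = mmap ev x q by exists (mmap ev x).
(* J restricted to the line above x; the section [s] of [ev] lifts coefficients, which makes T an
   ideal of C[X]. *)
pose T (q : {poly C}) := exists2 f, J f & q = map_poly phi (muni f).
have phiC a : phi a%:MP = ev a by rewrite phiE mmapC.
have idT : ideal_pred T.
  split.
  - by exists 0; rewrite ?muni0 ?rmorph0.
  - by move=> _ _ [f Jf ->] [h Jh ->]; exists (f + h); [exact: JD|rewrite muniD rmorphD].
  - move=> q _ [f Jf ->].
    exists (of_muni (\poly_(i < size q) (s q`_i)%:MP) * f); first exact: JM.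
    rewrite muniM of_muniK rmorphM; congr (_ * _).
    apply/polyP => j; rewrite coef_map coef_poly.
    case: ltnP => jq; first by rewrite [RHS]phiC sK.
    by rewrite [RHS](rmorph0 phi) nth_default.
have Tg : T (map_poly phi (muni g)) by exists g.
have lg : lead_coef (muni g) = c%:MP by rewrite lead_coefE sg /= gD.
have sgp : size (map_poly phi (muni g)) = D.+1.
  by rewrite size_map_poly_id0 ?sg // lg phiC.
have [|[f Jf fE]|[a Ta]] := poly_ideal_root idT Tg; last first.
- pose y := fun i : 'I_n.+1 => if unlift ord_max i is Some j then x j else a.
  have yw j : y (widen_ord (leqnSn n) j) = x j.
    rewrite /y (_ : widen_ord _ j = lift ord_max j) ?liftK //.
    by apply/val_inj; rewrite /= /bump leqNgt ltn_ord.
  exists y; first by exists (widen_ord (leqnSn n) i0); rewrite yw.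
  move=> q Jq; have /rootP <- : root (map_poly phi (muni q)) a by apply: Ta; exists q.
  pose psi : {rmorphism {mpoly A[n.+1]} -> C} :=
    horner_eval a \o map_poly phi \o @muni n A.
  apply: (@mpoly_rmorph_eq _ _ _ (mmap ev y) psi) => [b|i] /=.
    by rewrite mmapC muniC map_polyC /= /horner_eval hornerC phiC.
  rewrite mmapX mmap1U; have [->|[j ->]] := ord_max_or_widen i.
    by rewrite muniX_max map_polyX /horner_eval hornerX /y unlift_none.
  by rewrite muniX_widen map_polyC /horner_eval hornerC [RHS]phiE mmapX mmap1U yw.
- exfalso.
  have J'z f' : J' f' -> phi f' = 0 by rewrite phiE; exact: xz.
  have [D0|] := posnP D.
    have : J' 1.
      exists 1%N; rewrite mwiden1 mulr1 expr1; suff -> : c%:MP = g by [].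
      rewrite -[g]muniK [muni g]size1_polyC ?sg ?D0 // -{1}D0 gD.
      by rewrite /of_muni map_polyC hornerC /= mwidenC.
    by move/J'z/eqP; rewrite rmorph1 oner_eq0.
  case DE : D => [//|m'] _.
  pose F := muni f; pose G := muni g.
  (* Pseudo-remainders: up to powers of c, the rows of the matrix of multiplication by f modulo
     g. *)
  pose h (i : 'I_m'.+1) := ('X^i * F) %% G.
  have G0 : G != 0 by rewrite -size_poly_gt0 sg.
  have hE (i : 'I_m'.+1) : exists k,
      h i = c%:MP ^+ k *: ('X^i * F) - ('X^i * F) %/ G * G.
    exists (scalp ('X^i * F) G).
    by have := Pdiv.Idomain.divp_eq ('X^i * F) G; rewrite {1}/G lg => ->; rewrite addrAC subrr add0r.
  have sh (i : 'I_m'.+1) : (size (h i) <= m'.+1)%N.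
    by rewrite -ltnS -DE -sg ltn_modp.
  pose Jm (q : {poly {mpoly A[n]}}) := J (of_muni q).
  have idJm : ideal_pred Jm.
    split; rewrite /Jm ?rmorph0 // => u v.
      by rewrite rmorphD; exact: JD.
    by rewrite rmorphM; exact: JM.
  have Jh i : Jm (h i).
    have [_ _ JmM] := idJm.
    have [k ->] := hE i; apply: idealB => //; last by apply: JmM; rewrite /Jm muniK.
    by rewrite -mul_polyC mulrA; apply: JmM; rewrite /Jm muniK.
  have := det_in_ideal idJm Jh sh; set H := \matrix_(_, _) _ => Jdet.
  have : J' (\det H).
    by exists 0%N; move: Jdet; rewrite expr0 mul1r /Jm /of_muni map_polyC hornerC.
  move/J'z/eqP; rewrite -det_map_mx; apply/negP.
  have [k kE] := choice hE.
  rewrite (_ : map_mx phi H = diag_mx (\row_i ev c ^+ k i)).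
    by rewrite det_diag; apply/prodf_neq0 => i _; rewrite mxE expf_neq0.
  apply/matrixP => i j; rewrite !mxE.
  (* F specializes to 1, so the two sides are congruent modulo the specialization of G, which has
     degree D, while both have degree less than D. *)
  have hpE : map_poly phi (h i) = ev c ^+ k i *: 'X^i.
    apply/eqP; rewrite -subr_eq0; apply/negPn/negP => nz.
    have E : map_poly phi (h i) - ev c ^+ k i *: 'X^i =
         - map_poly phi (('X^i * F) %/ G) * map_poly phi G.
      have e1 : map_poly phi (c%:MP ^+ k i *: ('X^i * F)) = ev c ^+ k i *: 'X^i.
        rewrite map_polyZ; congr (_ *: _).
          by rewrite (rmorphXn phi); congr (_ ^+ _); exact: phiC.
        apply: etrans (rmorphM (map_poly phi) _ _) _.
        by rewrite [X in _ * X](_ : _ = 1) ?mulr1 //; exact: map_polyXn.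
      have e2 : map_poly phi (('X^i * F) %/ G * G) =
          map_poly phi (('X^i * F) %/ G) * map_poly phi G.
        exact: (rmorphM (map_poly phi)).
      have e3 : map_poly phi (h i) = map_poly phi (c%:MP ^+ k i *: ('X^i * F))
          - map_poly phi (('X^i * F) %/ G * G).
        by rewrite kE; exact: (rmorphB (map_poly phi)).
      by rewrite e3 e1 e2 addrAC subrr add0r mulNr.
    have : (size (map_poly phi (h i) - ev c ^+ k i *: 'X^i)%R <= D)%N.
      apply: leq_trans (size_polyD _ _) _.
      rewrite geq_max size_polyN DE; apply/andP; split.
        exact: leq_trans (size_poly _ _) (sh i).
      by apply: leq_trans (size_scale_leq _ _) _; rewrite size_polyXn.
    move: nz; rewrite E => nz; rewrite leqNgt => /negP; apply.
    rewrite size_mul ?sgp ?addnS /= ?leq_addl //.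
    - rewrite -[X in (X < _)%N]add0n ltn_add2r size_poly_gt0.
      by apply: contraNneq nz => ->; rewrite mul0r.
    - by apply: contraNneq nz => ->; rewrite mul0r.
    - by rewrite -size_poly_gt0 sgp.
  by rewrite -coef_map /= hpE coefZ coefXn -val_eqE /= eq_sym; case: eqP; rewrite ?mulr1 ?mulr0.
- by rewrite -size_poly_gt0 sgp.
Qed.

End Elimination.

(** * Systems of forms and their coefficients *)

Section Forms.
Variables (n d : nat).
Notation M := #|coef_index n d|.

(** Inverse to [system_coefs] on systems of forms of degree d. Systems are handled as coefficient
    vectors so that polynomials in the coefficients can be evaluated at them. *)
Definition sform (K : nzRingType) (a : 'I_M -> K) (i : 'I_n) : {mpoly K[n]} :=
  \sum_(j < M) (if (enum_val j).1 == i then a j else 0)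
     *: 'X_[val (val (enum_val j).2)].

Definition lform (K : nzRingType) (L : 'I_n -> K) : {mpoly K[n]} :=
  \sum_l L l *: 'X_l.

(** The direction denoted E below: adding t E to a system adds t x_i^d to its i-th form. *)
Definition power_coefs (K : nzRingType) : 'I_M -> K :=
  system_coefs (fun i => 'X_i ^+ d).

Lemma coef_index_mdeg (j : coef_index n d) : mdeg (val (val j.2)) = d.
Proof. exact: (eqP (valP j.2)). Qed.

Lemma coef_indexP (i : 'I_n) (m : 'X_{1..n}) :
  mdeg m = d -> exists j : 'I_M, (enum_val j).1 = i /\ val (val (enum_val j).2) = m.
Proof.
move=> md; have lt : (mdeg m < d.+1)%N by rewrite md.
have hd : mdeg (BMultinom lt) == d by rewrite /= md.
pose c : coef_index n d := (i, Sub (BMultinom lt) hd).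
by exists (enum_rank c); rewrite enum_rankK.
Qed.

Lemma coef_index_inj (j j' : 'I_M) :
  (enum_val j).1 = (enum_val j').1 ->
  val (val (enum_val j).2) = val (val (enum_val j').2) -> j = j'.
Proof.
move=> h1 h2; apply: enum_val_inj.
case: (enum_val j) (enum_val j') h1 h2 => [i m] [i' m'] /= -> h.
by congr (_, _); apply/val_inj/val_inj.
Qed.

Lemma sform_coef (K : nzRingType) (a : 'I_M -> K) (j : 'I_M) :
  (sform a (enum_val j).1)@_(val (val (enum_val j).2)) = a j.
Proof.
rewrite /sform raddf_sum /= (bigD1 j) //= eqxx mcoeffZ mcoeffX eqxx mulr1.
rewrite big1 ?addr0 // => l lj; rewrite mcoeffZ mcoeffX.
case: eqP => [e1|]; last by rewrite mul0r.
case: eqP => [e2|]; last by rewrite mulr0.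
by case/eqP: lj; exact: coef_index_inj.
Qed.

Lemma system_coefs_sform (K : nzRingType) (a : 'I_M -> K) :
  system_coefs (sform a) = a.
Proof. by apply/funext => j; exact: sform_coef. Qed.

Lemma sform_homog (K : nzRingType) (a : 'I_M -> K) i : sform a i \is d.-homog.
Proof.
apply: rpred_sum => j _; apply: rpredZ.
by rewrite dhomogX; apply/eqP; exact: coef_index_mdeg.
Qed.

Lemma sform_system_coefs (K : nzRingType) (F : 'I_n -> {mpoly K[n]}) i :
  (forall i, F i \is d.-homog) -> sform (@system_coefs K n d F) i = F i.
Proof.
move=> hF; apply/mpolyP => m.
have [md|md] := eqVneq (mdeg m) d.
  by have [j [<- <-]] := coef_indexP i md; rewrite sform_coef.
rewrite (dhomog_nemf_coeff (sform_homog _ _)) //.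
by rewrite (dhomog_nemf_coeff (hF i)).
Qed.

Lemma sformD (K : nzRingType) (a b : 'I_M -> K) i :
  sform (fun j => a j + b j) i = sform a i + sform b i.
Proof.
rewrite -big_split; apply: eq_bigr => j _ /=; rewrite -scalerDl.
by case: ifP; rewrite ?addr0.
Qed.

Lemma sformZ (K : nzRingType) (c : K) (a : 'I_M -> K) i :
  sform (fun j => c * a j) i = c *: sform a i.
Proof.
rewrite scaler_sumr; apply: eq_bigr => j _ /=.
by case: ifP; rewrite ?scale0r ?scaler0 // scalerA.
Qed.

Lemma sform_map (K K' : nzRingType) (f : {rmorphism K -> K'}) (a : 'I_M -> K) i :
  map_mpoly f (sform a i) = sform (fun j => f (a j)) i.
Proof.
rewrite raddf_sum; apply: eq_bigr => j _ /=.
rewrite map_mpolyZ map_mpolyX; congr (_ *: _).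
by case: ifP; rewrite ?rmorph0.
Qed.

Lemma mmap_map_mpoly (k : nat) (K : nzRingType) (K' : comNzRingType)
    (f : {rmorphism K -> K'}) (x : 'I_k -> K') (p : {mpoly K[k]}) :
  mmap f x p = (map_mpoly f p).@[x].
Proof.
apply: (@mpoly_rmorph_eq _ _ _ (mmap f x) (meval x \o map_mpoly f)) => [c|i] /=.
  by rewrite mmapC map_mpolyC mevalC.
by rewrite mmapX mmap1U map_mpolyX mevalXU.
Qed.

Lemma rmorph_meval (k : nat) (K K' : comNzRingType)
    (f : {rmorphism K -> K'}) (x : 'I_k -> K) (p : {mpoly K[k]}) :
  f p.@[x] = (map_mpoly f p).@[fun i => f (x i)].
Proof.
apply: (@mpoly_rmorph_eq _ _ _ (f \o meval x) (meval (fun i => f (x i)) \o map_mpoly f)) => [c|i] /=.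
  by rewrite mevalC map_mpolyC mevalC.
by rewrite map_mpolyX !mevalXU.
Qed.

Lemma rmorph_mmap (k : nat) (K : nzRingType) (K' K'' : comNzRingType)
    (g : {rmorphism K -> K'}) (f : {rmorphism K' -> K''})
    (x : 'I_k -> K') (p : {mpoly K[k]}) :
  f (mmap g x p) = mmap (f \o g) (fun i => f (x i)) p.
Proof.
apply: (@mpoly_rmorph_eq _ _ _ (f \o mmap g x) (mmap (f \o g) (fun i => f (x i)))) => [c|i] /=.
  by rewrite !mmapC.
by rewrite !mmapX !mmap1U.
Qed.

Lemma lform_eval (K : comNzRingType) (L x : 'I_n -> K) :
  (lform L).@[x] = \sum_l L l * x l.
Proof.
by rewrite raddf_sum; apply: eq_bigr => l _ /=; rewrite mevalZ mevalXU.
Qed.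

Lemma lform_homog (K : nzRingType) (L : 'I_n -> K) : lform L \is 1.-homog.
Proof. by apply: rpred_sum => l _; apply: rpredZ; rewrite dhomogX; apply/eqP; exact: mdeg1. Qed.

Lemma lform_map (K K' : nzRingType) (f : {rmorphism K -> K'}) (L : 'I_n -> K) :
  map_mpoly f (lform L) = lform (fun l => f (L l)).
Proof.
rewrite raddf_sum; apply: eq_bigr => l _ /=.
by rewrite map_mpolyZ map_mpolyX.
Qed.

Lemma powX_homog (K : comNzRingType) (i : 'I_n) : ('X_i ^+ d : {mpoly K[n]}) \is d.-homog.
Proof. by rewrite mpolyXn dhomogX; apply/eqP; rewrite [LHS]mdegMn mdeg1 mul1n. Qed.

Lemma lformX_homog (K : comNzRingType) (L : 'I_n -> K) : lform L ^+ d \is d.-homog.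
Proof. by have := dhomogMn d (lform_homog L); rewrite mul1n. Qed.

Lemma sform_power (K : comNzRingType) i : sform (@power_coefs K) i = 'X_i ^+ d.
Proof. by rewrite sform_system_coefs // => l; exact: powX_homog. Qed.

(* Modify the system a so that it vanishes at x; nothing changes if it already
   does and the linear form L takes the value 1 at x. *)
Definition corr_system (K : comNzRingType) (a : 'I_M -> K) (x L : 'I_n -> K) i :=
  (lform L).@[x] ^+ d *: sform a i - (sform a i).@[x] *: lform L ^+ d.

Definition corr (K : comNzRingType) (a : 'I_M -> K) (x L : 'I_n -> K) : 'I_M -> K :=
  system_coefs (corr_system a x L).

Lemma corr_homog (K : comNzRingType) (a : 'I_M -> K) (x L : 'I_n -> K) i :
  corr_system a x L i \is d.-homog.
Proof.
by apply: rpredB; apply: rpredZ; rewrite ?sform_homog ?lformX_homog.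
Qed.

Lemma sform_corr (K : comNzRingType) (a : 'I_M -> K) (x L : 'I_n -> K) i :
  sform (corr a x L) i = corr_system a x L i.
Proof. by rewrite sform_system_coefs // => l; exact: corr_homog. Qed.

Lemma corr_eval (K : comNzRingType) (a : 'I_M -> K) (x L : 'I_n -> K) i :
  (sform (corr a x L) i).@[x] = 0.
Proof.
by rewrite sform_corr mevalB !mevalZ mulrC rmorphXn /= subrr.
Qed.

Lemma corr_map (K K' : comNzRingType) (f : {rmorphism K -> K'})
    (a : 'I_M -> K) (x L : 'I_n -> K) j :
  f (corr a x L j) = corr (fun j => f (a j)) (fun i => f (x i)) (fun i => f (L i)) j.
Proof.
rewrite /corr /system_coefs /corr_system -mcoeff_map_mpoly rmorphB /=.
by rewrite !map_mpolyZ !rmorphXn /= !rmorph_meval !sform_map !lform_map.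
Qed.

Lemma corr_id (K : comNzRingType) (a : 'I_M -> K) (x L : 'I_n -> K) :
  (forall i, (sform a i).@[x] = 0) -> (lform L).@[x] = 1 -> corr a x L = a.
Proof.
move=> h1 h2; rewrite -[RHS]system_coefs_sform; apply/funext => j.
by rewrite /corr /system_coefs /corr_system h1 h2 scale0r subr0 expr1n scale1r.
Qed.

End Forms.

(** * Systems with a nontrivial zero and the polynomials vanishing on them *)

Section Zeros.
Variables (C : numClosedFieldType) (n d : nat).
Hypotheses (n0 : (0 < n)%N) (d0 : (0 < d)%N).
Notation M := #|coef_index n d|.

Definition has_zero (a : 'I_M -> C) :=
  exists2 x : 'I_n -> C, exists i, x i != 0 & forall i, (sform a i).@[x] = 0.

Definition vanishing (P : {mpoly C[M]}) := forall a, has_zero a -> P.@[a] = 0.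

Lemma has_zero0 : has_zero (fun _ => 0).
Proof.
exists (fun _ => 1); first by exists (Ordinal n0); rewrite oner_neq0.
move=> i; have -> : (fun=> 0) = (fun j => 0 * (0 : C)) :> ('I_M -> C).
  by apply/funext => j; rewrite mul0r.
by rewrite sformZ scale0r meval0.
Qed.

Lemma sform_eval0 (a : 'I_M -> C) i : (sform a i).@[fun=> 0] = 0.
Proof.
rewrite /sform raddf_sum big1 //= => j _; rewrite mevalZ mevalX.
have := coef_index_mdeg (enum_val j); set m := val _ => md.
have [l ml] : exists l, m l != 0%N.
  apply: contrapT => H; move: d0; rewrite -md mdegE big1 // => l _.
  by apply/eqP/negPn/negP => h; apply: H; exists l.
by rewrite (bigD1 l) //= expr0n (negPf ml) mul0r mulr0.
Qed.

(** If x is not 0, it is a zero of the corrected system. If x = 0, the corrected system is 0 because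
    d > 0. Thus [corr] sends curves of triples (a, x, L) to curves inside S. *)
Lemma has_zero_corr (a : 'I_M -> C) (x L : 'I_n -> C) : has_zero (corr a x L).
Proof.
have [[i xi]|x0] := pselect (exists i, x i != 0).
  by exists x; [exists i|move=> l; exact: corr_eval].
have xE : x = fun=> 0.
  by apply/funext => i; apply/eqP/negPn/negP => xi; apply: x0; exists i.
suff -> : corr a x L = fun=> 0 by exact: has_zero0.
rewrite xE; apply/funext => j; rewrite /corr /system_coefs /corr_system sform_eval0.
rewrite lform_eval big1 => [|l _]; last by rewrite mulr0.
by rewrite expr0n -[d == _]negbK -lt0n d0 !scale0r subrr mcoeff0.
Qed.

Lemma poly_eq0_fun (p : {poly C}) : (forall t, p.[t] = 0) -> p = 0.
Proof.
move=> h; apply/eqP; apply: contraT => p0.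
pose rs := [seq (i%:R : C) | i <- iota 0 (size p)].
have : (size rs < size p)%N.
  apply: max_poly_roots => //; first by apply/allP => x _; apply/rootP.
  by rewrite map_inj_uniq ?iota_uniq // => i j /eqP; rewrite eqr_nat => /eqP.
by rewrite size_map size_iota ltnn.
Qed.

Lemma mpoly_curve_eval (k : nat) (P : {mpoly C[k]}) (c : 'I_k -> {poly C}) t :
  (mmap polyC c P).[t] = P.@[fun j => (c j).[t]].
Proof.
apply: etrans (rmorph_mmap polyC (horner_eval t) c P) _.
apply: (@mpoly_rmorph_eq _ _ _ (mmap (horner_eval t \o polyC) _) (meval _)) => [a|i] /=.
  by rewrite mmapC mevalC /= /horner_eval hornerC.
by rewrite mmapX mmap1U mevalXU.
Qed.

(** If P(a) and Q(b) are nonzero at points of S, [corr] along the segment joining the data of a to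
    those of b is a polynomial curve inside S. P Q is zero on it, so P or Q is zero on the whole
    curve, which contains both a and b. *)
Lemma vanishing_prime (P Q : {mpoly C[M]}) :
  vanishing (P * Q) -> vanishing P \/ vanishing Q.
Proof.
move=> h; apply: contrapT => /not_orP[/existsNP[a /not_implyP[[x [i xi] xa] Pa]]].
move=> /existsNP[b /not_implyP[[y [j yj] yb] Qb]].
(* A linear form with value 1 at x, for which [corr] leaves a unchanged. *)
pose Lx l := if l == i then (x i)^-1 else 0.
pose Ly l := if l == j then (y j)^-1 else 0.
have LxE : (lform Lx).@[x] = 1.
  rewrite lform_eval (bigD1 i) //= /Lx eqxx mulVf // big1 ?addr0 // => l /negPf ->.
  by rewrite mul0r.
have LyE : (lform Ly).@[y] = 1.
  rewrite lform_eval (bigD1 j) //= /Ly eqxx mulVf // big1 ?addr0 // => l /negPf ->.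
  by rewrite mul0r.
pose seg (u v : C) : {poly C} := u%:P + (v - u)%:P * 'X.
have seg0 u v : (seg u v).[0] = u.
  by rewrite hornerD hornerCM !hornerC hornerX mulr0 addr0.
have seg1 u v : (seg u v).[1] = v.
  by rewrite hornerD hornerCM !hornerC hornerX mulr1 addrCA subrr addr0.
pose c := corr (fun l => seg (a l) (b l)) (fun l => seg (x l) (y l))
  (fun l => seg (Lx l) (Ly l)).
have cE t : (fun l => (c l).[t]) = corr (fun l => (seg (a l) (b l)).[t])
    (fun l => (seg (x l) (y l)).[t]) (fun l => (seg (Lx l) (Ly l)).[t]).
  by apply/funext => l; apply: (corr_map (horner_eval t)).
have /eqP : mmap polyC c P * mmap polyC c Q = 0.
  rewrite -rmorphM; apply: poly_eq0_fun => t.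
  by rewrite mpoly_curve_eval cE h //; exact: has_zero_corr.
have c0 : (fun l => (c l).[0]) = a.
  rewrite cE -[RHS](corr_id xa LxE).
  by congr (corr _ _ _); apply/funext => l; rewrite seg0.
have c1 : (fun l => (c l).[1]) = b.
  rewrite cE -[RHS](corr_id yb LyE).
  by congr (corr _ _ _); apply/funext => l; rewrite seg1.
rewrite mulf_eq0 => /orP[] /eqP E.
  by apply: Pa; rewrite -c0 -mpoly_curve_eval E horner0.
by apply: Qb; rewrite -c1 -mpoly_curve_eval E horner0.
Qed.

Lemma has_zero_power : ~ has_zero (@power_coefs n d C).
Proof.
move=> [x [i xi] /(_ i)]; rewrite sform_power rmorphXn /= mevalXU => /eqP.
by rewrite expf_eq0 d0 (negPf xi).
Qed.

(** Hence an ideal generated by forms is graded, as [elimination] requires. *)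
Lemma pihomog_homogM (k : nat) (K : comNzRingType) (e D : nat) (g F : {mpoly K[k]}) :
  F \is e.-homog -> exists g', pihomog (@mdeg k) D (g * F) = g' * F.
Proof.
move=> hF; rewrite [g]mpolyE mulr_suml raddf_sum /=.
elim/big_ind: _ => [|p q [g1 ->] [g2 ->]|m _].
- by exists 0; rewrite mul0r.
- by exists (g1 + g2); rewrite mulrDl.
rewrite -scalerAl linearZ /=.
have hX : 'X_[m] * F \is (mdeg m + e).-homog.
  by apply: dhomogM => //; rewrite dhomogX.
have [E|E] := eqVneq (mdeg m + e)%N D.
  by exists (g@_m *: 'X_[m]); rewrite pihomog_dE -?E // scalerAl.
by exists 0; rewrite (pihomog_ne0 E) // scaler0 mul0r.
Qed.

(* Elimination applied to the generic system and specialized at a0. *)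
Lemma vanishing_separates (a0 : 'I_M -> C) :
  ~ has_zero a0 -> exists2 c, vanishing c & c.@[a0] != 0.
Proof.
move=> na0; pose A : idomainType := {mpoly C[M]}.
pose F : 'I_n -> {mpoly A[n]} := sform (fun j => 'X_j : A).
pose J (p : {mpoly A[n]}) := exists g : 'I_n -> {mpoly A[n]}, p = \sum_i g i * F i.
have idJ : ideal_pred J.
  split.
  - by exists (fun=> 0); rewrite big1 // => i _; rewrite mul0r.
  - move=> _ _ [g ->] [h ->]; exists (fun i => g i + h i).
    by rewrite -big_split; apply: eq_bigr => i _; rewrite mulrDl.
  - move=> q _ [g ->]; exists (fun i => q * g i).
    by rewrite mulr_sumr; apply: eq_bigr => i _; rewrite mulrA.
have grJ : graded_pred J.
  move=> D _ [g ->]; rewrite raddf_sum /=.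
  have [g' g'E] := choice (fun i => pihomog_homogM D (g i) (sform_homog (fun j => 'X_j : A) i)).
  by exists g'; apply: eq_bigr => i _; rewrite g'E.
have Fz (a : 'I_M -> C) (x : 'I_n -> C) i : mmap (meval a) x (F i) = (sform a i).@[x].
  rewrite mmap_map_mpoly /F sform_map; congr (_.@[_]); congr sform.
  by apply/funext => j; exact: mevalXU.
have [|[x [i xi] xz]|[c ca0 [D hD]]] := @elimination A C (meval a0) (@mpolyC M C) n J _ idJ grJ.
- by move=> c; exact: mevalC.
- case: na0; exists x; first by exists i.
  move=> l; rewrite -Fz; apply: xz.
  exists (fun i => (i == l)%:R); rewrite (bigD1 l) //= eqxx mul1r big1 ?addr0 // => j.
  by move=> /negPf ->; rewrite mul0r.
exists c => // a [x [i xi] xz].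
have [g gE] := hD i.
have /eqP : mmap (meval a) x (c%:MP * 'X_i ^+ D) = 0.
  rewrite gE raddf_sum big1 //= => l _; rewrite rmorphM /=.
  by rewrite (Fz a x l) xz mulr0.
rewrite rmorphM rmorphXn /= mmapC mmapX mmap1U mulf_eq0 expf_eq0 (negPf xi) andbF orbF.
by move=> /eqP.
Qed.

(** By primality, a nonconstant common factor of T and Q over the fraction field would be a multiple
    of T up to constants, and T would divide Q. Clearing denominators in the Bezout relation leaves
    the nonzero constant D. *)
Lemma bezout_prime (A : idomainType) (T Q : {poly A}) :
  prime_elt T -> (1 < size T)%N -> ~ divides T Q ->
  exists D u v, D != 0 /\ D%:P = u * T + v * Q.
Proof.
move=> pT sT nTQ; have [T0 _ Td] := pT.
have [/Bezout_coprimepP[[u v] /= /eqpP[[c3 c4] /= /andP[c30 c40] E]]|nc] := boolP (coprimep T Q).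
  exists c4, (c3 *: u), (c3 *: v); split => //.
  by rewrite -!scalerAl -scalerDr E alg_polyC.
exfalso; set g := gcdp T Q.
have g0 : g != 0 by rewrite gcdp_eq0 negb_and T0.
have sg : (1 < size g)%N.
  by rewrite ltn_neqAle eq_sym size_poly_gt0 g0 andbT; exact: nc.
have [[c1 q1] c10 /= E1] := Pdiv.Idomain.dvdpP _ _ (dvdp_gcdl T Q).
have [[c2 q2] c20 /= E2] := Pdiv.Idomain.dvdpP _ _ (dvdp_gcdr T Q).
have nC c : c != 0 -> ~ divides T c%:P.
  move=> c0 [w wE]; move: sT; have : size (w * T) = 1%N by rewrite -wE size_polyC c0.
  have w0 : w != 0 by apply: contraNneq c0 => w0; move: wE; rewrite w0 mul0r => /eqP; rewrite polyC_eq0.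
  rewrite size_mul // => H; rewrite ltnNge; apply/negP/negPn.
  have : (0 < size w)%N by rewrite size_poly_gt0.
  by case: (size w) H => // k <- _; rewrite addSn leq_addl.
have [|[w wE]|[w wE]] := Td q1 g; first by exists c1%:P; rewrite mul_polyC -E1.
  have : c1%:P = w * g.
    apply: (mulIf T0); rewrite mul_polyC E1 wE -/g.
    by rewrite -!mulrA [T * _]mulrC.
  move=> /(congr1 (fun p : {poly A} => size p)); rewrite size_polyC c10.
  have w0 : w != 0.
    apply: contraNneq c10 => w0; move: E1; rewrite wE w0 !mul0r => /eqP.
    by rewrite scale_poly_eq0 (negPf T0) orbF.
  rewrite size_mul // => H; have : (0 < size w)%N by rewrite size_poly_gt0.
  case: (size w) H => // k H _.
  by move: sg; rewrite ltnNge [1%N]H addSn leq_addl.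
have [|dc|//] := Td c2%:P Q; last exact: (nC c2).
by exists (q2 * w); rewrite mul_polyC E2 -/g {1}wE mulrA.
Qed.

(** * Restriction of a polynomial to the lines of a fixed direction *)

Section Translate.
Variable E : 'I_M -> C.
Notation A := {mpoly C[M]}.

(** p(a + t c E) as a polynomial in t, the coordinates of a being the variables of A. *)
Definition translate (c : C) : A -> {poly A} :=
  mmap (polyC \o @mpolyC M C) (fun j => ('X_j)%:P + (c * E j)%:MP%:P * 'X).

HB.instance Definition _ c := GRing.RMorphism.copy (translate c)
  (mmap (polyC \o @mpolyC M C) (fun j => ('X_j)%:P + (c * E j)%:MP%:P * 'X)).

Lemma translateC c b : translate c b%:MP = b%:MP%:P.
Proof. by rewrite /translate mmapC. Qed.

Lemma translateX c j : translate c 'X_j = ('X_j)%:P + (c * E j)%:MP%:P * 'X.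
Proof. by rewrite /translate mmapX mmap1U. Qed.

(** The automorphism of A[t] that fixes t and extends [translate c]. Its inverse is [shear (- c)],
    so that the translate of a prime is prime. *)
Definition shear (c : C) (q : {poly A}) : {poly A} := (map_poly (translate c) q).['X].

HB.instance Definition _ c := GRing.RMorphism.copy (shear c)
  (horner_eval ('X : {poly A}) \o map_poly (translate c)).

Lemma shearC c p : shear c p%:P = translate c p.
Proof. by rewrite /shear map_polyC hornerC. Qed.

Lemma shearX c : shear c 'X = 'X.
Proof. by rewrite /shear map_polyX hornerX. Qed.

Lemma shearD c p q : shear c (p + q) = shear c p + shear c q.
Proof. exact: (rmorphD (shear c)). Qed.

Lemma shearMX c p : shear c (p * 'X) = shear c p * 'X.
Proof. by rewrite -{2}(shearX c); exact: (rmorphM (shear c)). Qed.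

Lemma shearK c : cancel (shear c) (shear (- c)).
Proof.
have shearP p : shear (- c) (shear c p%:P) = p%:P.
  rewrite shearC; apply: (@mpoly_rmorph_eq _ _ _ (shear (- c) \o translate c) polyC) => [b|j] /=.
    by rewrite translateC shearC translateC.
  rewrite translateX rmorphD rmorphM /= !shearC shearX translateX translateC.
  by rewrite mulNr mpolyCN polyCN mulNr addrNK.
elim/poly_ind => [|p b IH]; first by rewrite -polyC0; exact: shearP.
rewrite (shearD c (p * 'X) b%:P) (shearMX c p).
rewrite (shearD (- c) (shear c p * 'X) (shear c b%:P)).
rewrite (shearMX (- c) (shear c p)).
exact: (congr2 +%R (congr1 (fun q => q * 'X) IH) (shearP b)).
Qed.

Lemma translate_prime p : prime_elt p -> prime_elt (translate 1 p).
Proof.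
move=> /prime_polyC pp; rewrite -shearC; apply: (prime_iso (shearK 1)) => //.
by move=> q; have := shearK (- 1) q; rewrite opprK.
Qed.

Definition eval2 (a : 'I_M -> C) (t : C) (q : {poly A}) : C := (map_poly (meval a) q).[t].

HB.instance Definition _ a t := GRing.RMorphism.copy (eval2 a t)
  (horner_eval t \o map_poly (meval a)).

Lemma eval2D a t p q : eval2 a t (p + q) = eval2 a t p + eval2 a t q.
Proof. exact: (rmorphD (eval2 a t)). Qed.

Lemma eval2M a t p q : eval2 a t (p * q) = eval2 a t p * eval2 a t q.
Proof. exact: (rmorphM (eval2 a t)). Qed.

Lemma eval2C a t p : eval2 a t p%:P = p.@[a].
Proof. by rewrite /eval2 map_polyC hornerC. Qed.

Lemma eval2_translate a t p : eval2 a t (translate 1 p) = p.@[fun j => a j + t * E j].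
Proof.
apply: (@mpoly_rmorph_eq _ _ _ (eval2 a t \o translate 1) (meval _)) => [b|j] /=.
  by rewrite translateC eval2C !mevalC.
rewrite translateX rmorphD rmorphM /= !eval2C mul1r mevalC !mevalXU.
by rewrite {1}/eval2 map_polyX hornerX mulrC.
Qed.

Lemma translate0 p : (translate 1 p).[0] = p.
Proof.
apply: (@mpoly_rmorph_eq _ _ _ (horner_eval 0 \o translate 1) idfun) => [b|j] /=.
  by rewrite translateC /horner_eval hornerC.
by rewrite translateX /horner_eval hornerD hornerM hornerX !hornerC mulr0 addr0.
Qed.

End Translate.

End Zeros.

(** * Existence of the resultant *)

Section Order.
Variable C : numClosedFieldType.

Lemma mpoly_eq0_fun (n : nat) (P : {mpoly C[n]}) :
  (forall a, P.@[a] = 0) -> P = 0.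
Proof.
elim: n P => [|n IH] P h.
  by rewrite (nvar0_mpolyC P) -[X in X%:MP](@mevalC 0 C (fun=> 0)) -nvar0_mpolyC h.
rewrite -[P]muniK; suff -> : muni P = 0 by rewrite rmorph0.
apply/polyP => j; rewrite coef0; apply: IH => a.
suff : map_poly (meval a) (muni P) = 0.
  by move=> /(congr1 (fun p : {poly C} => p`_j)); rewrite coef_map coef0.
apply: poly_eq0_fun => t.
pose y (i : 'I_n.+1) := if unlift ord_max i is Some j then a j else t.
have yw l : y (widen_ord (leqnSn n) l) = a l.
  rewrite /y (_ : widen_ord _ l = lift ord_max l) ?liftK //.
  by apply/val_inj; rewrite /= /bump leqNgt ltn_ord.
rewrite -(h y).
apply: (@mpoly_rmorph_eq _ _ _ (horner_eval t \o map_poly (meval a) \o @muni n C) (meval y)) => [c|i] /=.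
  by rewrite muniC map_polyC /horner_eval hornerC /= !mevalC.
rewrite mevalXU; have [->|[l ->]] := ord_max_or_widen i.
  by rewrite muniX_max map_polyX /horner_eval hornerX /y unlift_none.
by rewrite muniX_widen map_polyC /horner_eval hornerC /= mevalXU yw.
Qed.

Lemma mpoly_neq0_witness (n : nat) (P : {mpoly C[n]}) :
  P != 0 -> exists a, P.@[a] != 0.
Proof.
move=> /eqP P0; apply: contrapT => H; apply: P0; apply: mpoly_eq0_fun => a.
by apply/eqP/negPn/negP => h; apply: H; exists a.
Qed.

Lemma mmap_homog_scale (n : nat) (K : comNzRingType) (f : {rmorphism C -> K})
    (c : K) (b : 'I_n -> K) (p : {mpoly C[n]}) j :
  p \is j.-homog -> mmap f (fun i => c * b i) p = c ^+ j * mmap f b p.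
Proof.
move=> hp; rewrite /mmap mulr_sumr big_seq [RHS]big_seq; apply: eq_bigr => m mp.
rewrite mulrCA; congr (_ * _); rewrite /mmap1.
have <- : mdeg m = j by exact: (dhomog_mf hp mp).
rewrite mdegE -prodrXr -big_split /=.
by apply: eq_bigr => i _; rewrite exprMn.
Qed.

Definition lowest_degree (n : nat) (Q : {mpoly C[n]}) (nu : nat) :=
  pihomog (@mdeg n) nu Q != 0 /\
  forall j, (j < nu)%N -> pihomog (@mdeg n) j Q = 0.

Lemma lowest_degree_ex (n : nat) (Q : {mpoly C[n]}) :
  Q != 0 -> exists nu, lowest_degree Q nu.
Proof.
move=> Q0; have ex : exists j, pihomog (@mdeg n) j Q != 0.
  apply: contrapT => H; move/eqP: Q0; apply.
  rewrite (pihomog_partitionE (leqnn (msize Q))) big1 // => j _.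
  by apply/eqP/negPn/negP => h; apply: H; exists j.
case: (ex_minnP ex) => nu h hmin; exists nu; split=> // j jn.
by apply/eqP; apply: contraTT jn => /hmin; rewrite -leqNgt.
Qed.

Lemma mmap_scaleX (n : nat) (Q : {mpoly C[n]}) (nu : nat) (b : 'I_n -> {poly C}) :
  lowest_degree Q nu ->
  exists q, mmap polyC (fun j => 'X * b j) Q =
    'X^nu * (mmap polyC b (pihomog (@mdeg n) nu Q) + 'X * q).
Proof.
move=> [Qn0 Ql].
have nl : (nu < msize Q)%N.
  have [m mQ] : exists m, m \in msupp (pihomog (@mdeg n) nu Q).
    move: Qn0; rewrite -msupp_eq0; case: (msupp _) => // m s _.
    by exists m; rewrite mem_head.
  have dm : mdeg m = nu := dhomog_mf (pihomogP _ _ _) mQ.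
  rewrite -dm; apply: msize_mdeg_lt; move: mQ; rewrite !mcoeff_msupp.
  apply: contraNneq => h.
  rewrite pihomogE raddf_sum /= big1_seq // => m' /andP[_ m'Q].
  rewrite mcoeffZ mcoeffX; case: eqP => [e|]; last by rewrite mulr0.
  by rewrite e h mul0r.
exists (\sum_(j < msize Q | (nu < j)%N)
   'X^((j - nu).-1) * mmap polyC b (pihomog (@mdeg n) j Q)).
rewrite {1}(pihomog_partitionE (leqnn (msize Q))) raddf_sum /=.
rewrite (bigID (fun j : 'I__ => (j <= nu)%N)) /=.
rewrite mulrDr; congr (_ + _).
  rewrite (bigD1 (Ordinal nl)) //= big1 ?addr0 => [|j /andP[jn]].
    by rewrite (mmap_homog_scale _ _ _ (pihomogP _ _ _)).
  rewrite -val_eqE /= => jn'; rewrite Ql ?mmap0 //.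
  by rewrite ltn_neqAle jn'.
rewrite !mulr_sumr; apply: eq_big => [j|j]; first by rewrite ltnNge.
rewrite -ltnNge => jn; rewrite (mmap_homog_scale _ _ _ (pihomogP _ _ _)).
rewrite !mulrA; congr (_ * _); rewrite -exprSr -exprD; congr (_ ^+ _).
by rewrite addSnnS prednK ?subn_gt0 // subnKC // ltnW.
Qed.

(** Tangent cone: X b(X) is a curve through the origin on which Q vanishes, and the coefficient of
    X^nu of Q along it is the value of the lowest form at b(0). *)
Lemma low_vanish (n : nat) (Q : {mpoly C[n]}) (nu : nat) (b : 'I_n -> {poly C}) :
  lowest_degree Q nu -> mmap polyC (fun j => 'X * b j) Q = 0 ->
  (pihomog (@mdeg n) nu Q).@[fun j => (b j).[0]] = 0.
Proof.
move=> Qn; have [q ->] := mmap_scaleX b Qn => /eqP.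
rewrite mulf_eq0 expf_eq0 polyX_eq0 andbF /= => /eqP/(congr1 (horner^~ 0)) /=.
by rewrite hornerD hornerM hornerX mul0r addr0 horner0 mpoly_curve_eval.
Qed.

Definition shift (n : nat) (a : 'I_n -> C) (Q : {mpoly C[n]}) : {mpoly C[n]} :=
  mmap (@mpolyC n C) (fun j => 'X_j + (a j)%:MP) Q.

Lemma mmap_shift (n : nat) (a : 'I_n -> C) (Q : {mpoly C[n]}) (b : 'I_n -> {poly C}) :
  mmap polyC b (shift a Q) = mmap polyC (fun j => b j + (a j)%:P) Q.
Proof.
apply: (@mpoly_rmorph_eq _ _ _ (mmap polyC b \o mmap (@mpolyC n C) _) (mmap polyC _)) => [c|i] /=.
  by rewrite !mmapC.
by rewrite !mmapX !mmap1U rmorphD /= mmapC mmapX mmap1U.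
Qed.

Lemma meval_shift (n : nat) (a : 'I_n -> C) (Q : {mpoly C[n]}) (b : 'I_n -> C) :
  (shift a Q).@[b] = Q.@[fun j => b j + a j].
Proof.
apply: (@mpoly_rmorph_eq _ _ _ (meval b \o mmap (@mpolyC n C) _) (meval _)) => [c|i] /=.
  by rewrite mmapC !mevalC.
by rewrite mmapX mmap1U rmorphD /= mevalC !mevalXU.
Qed.

Lemma shift_neq0 (n : nat) (a : 'I_n -> C) (Q : {mpoly C[n]}) :
  Q != 0 -> shift a Q != 0.
Proof.
apply: contraNneq => h; apply/eqP; apply: mpoly_eq0_fun => b.
have := meval_shift a Q (fun j => b j - a j); rewrite h meval0 => ->.
by apply: meval_eq => j; rewrite subrK.
Qed.

Lemma factorX (p : {poly C}) : exists q, p = p.[0]%:P + 'X * q.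
Proof.
elim/poly_ind: p => [|p c _]; first by exists 0; rewrite horner0 mulr0 addr0.
by exists p; rewrite hornerMXaddC mulr0 add0r addrC [p * _]mulrC.
Qed.

End Order.

(** * The vanishing ideal is principal *)

Section Existence.
Variables (C : numClosedFieldType) (n d : nat).
Hypotheses (n0 : (0 < n)%N) (d0 : (0 < d)%N).
Notation M := #|coef_index n d|.
Notation E := (@power_coefs n d C).

(* A curve a(s) + tau(s) E inside the set of systems with a zero, starting at
   the system (x_i x_o^(d-1), 0) with tangent direction H + theta E: the lowest
   form of D at that system vanishes at every H. *)
Lemma translate_vanish_zero (D : {mpoly C[M]}) :
  (forall a t, has_zero (fun j => a j + t * E j) -> D.@[a] = 0) -> D = 0.
Proof.
move=> hD; apply/eqP; apply: contraT => D0; exfalso.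
pose o : 'I_n := Ordinal n0.
(* F0 vanishes at e, its differential there is eta |-> eta_i in the equations i <> o, and E
   contributes 1 in the equation o alone: any H can be compensated to first order. *)
pose F0 i : {mpoly C[n]} := if i == o then 0 else 'X_i * 'X_o ^+ d.-1.
have F0h i : F0 i \is d.-homog.
  rewrite /F0; case: ifP => _; first exact: dhomog0.
  rewrite mpolyXn -mpolyXD dhomogX; apply/eqP.
  by rewrite [LHS]mdegD mdegMn !mdeg1 mul1n add1n prednK.
pose a0 : 'I_M -> C := system_coefs F0.
have [nu Dn] := lowest_degree_ex (shift_neq0 a0 D0).
move: (Dn) => [/negP Dn0 _]; apply: Dn0; apply/eqP; apply: mpoly_eq0_fun => H.
pose e (i : 'I_n) : C := (i == o)%:R.
pose h i := (sform H i).@[e].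
pose theta := - h o.
pose aS j : {poly C} := (a0 j)%:P + 'X * ((H j)%:P + (theta * E j)%:P).
pose xS i : {poly C} := if i == o then 1 else (- h i)%:P * 'X.
pose L i : {poly C} := (i == o)%:R.
have LxS : (lform L).@[xS] = 1.
  rewrite lform_eval (bigD1 o) //= /L /xS !eqxx mul1r big1 ?addr0 // => i /negPf ->.
  by rewrite mul0r.
have v2 i : exists w, (sform aS i).@[xS] = 'X^2 * w.
  have -> : sform aS i = map_mpoly polyC (F0 i)
      + 'X *: (map_mpoly polyC (sform H i) + theta%:P *: 'X_i ^+ d).
    rewrite -(sform_system_coefs _ F0h) !sform_map -/a0 -sform_power -sformZ.
    rewrite -sformD -sformZ -sformD; congr sform; apply/funext => j.
    rewrite /aS polyCM; congr (_ + 'X * (_ + _ * _)).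
    rewrite /power_coefs /system_coefs -[LHS]mcoeff_map_mpoly.
    by rewrite rmorphXn /= map_mpolyX.
  rewrite mevalD mevalZ mevalD mevalZ rmorphXn /= mevalXU.
  have [q qE] := factorX (map_mpoly polyC (sform H i)).@[xS].
  have q0 : ((map_mpoly polyC (sform H i)).@[xS]).[0] = h i.
    rewrite -mmap_map_mpoly mpoly_curve_eval; apply: meval_eq => l.
    by rewrite /xS /e; case: eqP => _; rewrite ?hornerC // hornerM hornerX mulr0.
  rewrite {}q0 in qE; rewrite qE /F0; have [->|io] := eqVneq i o.
    exists q; rewrite rmorph0 meval0 /xS eqxx expr1n /theta polyCN; ring.
  rewrite rmorphM rmorphXn /= !map_mpolyX mevalM rmorphXn /= !mevalXU.
  rewrite /xS (negPf io) eqxx expr1n mulr1 polyCN.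
  exists (q + theta%:P * ((- (h i)%:P) ^+ d * 'X^(d.-1))).
  rewrite exprMn (_ : 'X^d = 'X * 'X^(d.-1) :> {poly C}); first by ring.
  by rewrite -exprS prednK.
have [w wE] := choice v2.
(* The values along xS being divisible by X^2, the correction keeps the tangent of aS. *)
pose b := corr aS xS L.
have [r rE] : exists r : 'I_M -> {poly C}, forall j, b j = aS j - 'X^2 * r j.
  exists (fun j => w (enum_val j).1 * (lform L ^+ d)@_(val (val (enum_val j).2))) => j.
  rewrite /b /corr /system_coefs /corr_system LxS expr1n scale1r mcoeffB.
  by rewrite sform_coef mcoeffZ wE mulrA.
have := low_vanish (b := fun j => (H j)%:P - 'X * r j) Dn.
rewrite (_ : (fun j => _.[0]) = H); last first.
  apply/funext => j.
  by rewrite hornerD hornerN hornerM hornerX mul0r subr0 hornerC.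
apply; rewrite mmap_shift; apply: poly_eq0_fun => t; rewrite mpoly_curve_eval.
apply: (hD _ (theta * t)).
have -> : (fun j => ('X * ((H j)%:P - 'X * r j) + (a0 j)%:P).[t] + theta * t * E j)
   = corr (fun j => (aS j).[t]) (fun i => (xS i).[t]) (fun i => (L i).[t]).
  apply/funext => j.
  transitivity (b j).[t]; last exact: (corr_map (horner_eval t) aS xS L j).
  by rewrite rE /aS !(hornerD, hornerN, hornerM, hornerX, hornerC, hornerXn); ring.
exact: has_zero_corr.
Qed.

Lemma unit_not_vanishing (u : {mpoly C[M]}) : u \is a GRing.unit -> ~ vanishing u.
Proof.
move=> uu hu; have := hu _ (@has_zero0 C n d n0).
have /(congr1 (meval (fun=> 0 : C))) := mulVr uu.
by rewrite mevalM meval1 => + h; rewrite h mulr0 => /eqP; rewrite eq_sym oner_eq0.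
Qed.

Lemma vanishing_prime_factor (s : seq {mpoly C[M]}) u :
  u \is a GRing.unit -> vanishing (u * \prod_(p <- s) p) ->
  exists2 p, p \in s & vanishing p.
Proof.
elim: s u => [|p s IH] u uu; first by rewrite big_nil mulr1 => /(unit_not_vanishing uu).
rewrite big_cons mulrCA => /(vanishing_prime n0 d0)[hp|/(IH _ uu)[q qs hq]].
  by exists p; rewrite ?mem_head.
by exists q; rewrite // inE qs orbT.
Qed.

(** If Q does not divide P, eliminating t between Q(a + t E) and P(a + t E) leaves a nonzero
    polynomial in a that vanishes whenever the line a + C E meets S, against
    [translate_vanish_zero]. *)
Lemma vanishing_divides (Q P : {mpoly C[M]}) :
  prime_elt Q -> vanishing Q -> vanishing P -> divides Q P.
Proof.
move=> pQ vQ vP; apply: contrapT => nQP.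
have pT := translate_prime E pQ.
have Q0 : Q != 0 by case: pQ.
(* If Q(a + t E) does not depend on t, Q itself vanishes wherever the line meets S. *)
have [s1|sT] := leqP (size (translate E 1 Q)) 1.
  have QE : translate E 1 Q = Q%:P.
    by rewrite [LHS]size1_polyC // -horner_coef0 translate0.
  move/eqP: Q0; apply; apply: translate_vanish_zero => a t /vQ.
  by rewrite -eval2_translate QE eval2C.
have [|D [u [v [D0 DE]]]] := bezout_prime (Q := translate E 1 P) pT sT.
  move=> [z zE]; apply: nQP; exists z.[0].
  by rewrite -(translate0 E P) zE hornerM translate0.
move/eqP: D0; apply; apply: translate_vanish_zero => a t ha.
apply: etrans (esym (eval2C a t D)) _; apply: etrans (congr1 (eval2 a t) DE) _.
apply: etrans (eval2D a t _ _) _.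
have z p w : vanishing p -> eval2 a t (w * translate E 1 p) = 0.
  move=> vp; apply: etrans (eval2M a t _ _) _.
  apply: etrans (congr1 ( *%R _) (eval2_translate E a t p)) _.
  by rewrite (vp _ ha) mulr0.
apply: etrans (congr2 +%R (z _ u vQ) (z _ v vP)) _.
exact: addr0.
Qed.

Lemma prime_irreducible (p : {mpoly C[M]}) : prime_elt p -> mpoly_irreducible p.
Proof.
move=> [p0 pnu pd]; split=> // q r pE.
have q0 : q != 0 by apply: contraNneq p0 => q0; rewrite pE q0 mul0r.
have r0 : r != 0 by apply: contraNneq p0 => r0; rewrite pE r0 mulr0.
have [|[w wE]|[w wE]] := pd q r; first by exists 1; rewrite mul1r.
  right; apply/unitrP; exists w; suff h : w * r = 1 by rewrite h mulrC h.
  by apply: (mulfI q0); rewrite mulrCA -pE -wE mulr1.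
left; apply/unitrP; exists w; suff h : w * q = 1 by rewrite h mulrC h.
by apply: (mulIf r0); rewrite -mulrA -pE -wE mul1r.
Qed.

Lemma has_zero_system (F : 'I_n -> {mpoly C[n]}) :
  (forall i, F i \is d.-homog) ->
  (has_zero (@system_coefs C n d F) <->
   exists2 x : 'I_n -> C, exists i, x i != 0 & forall i, (F i).@[x] = 0).
Proof.
by move=> hF; split=> -[x x0 h]; exists x => // i; have := h i;
   rewrite sform_system_coefs.
Qed.

(** E is outside S, so some vanishing c is nonzero at E. A vanishing prime factor Q of c divides all
    vanishing polynomials. Dividing c, it is nonzero at E and can be normalized there; its zeros are
    exactly S because vanishing polynomials separate S from any other system. *)
Lemma resultant_exists : exists Res, @is_resultant C n d Res.
Proof.
have [c vc cE] := vanishing_separates (has_zero_power (C := C) (n := n) d0).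
have c0 : c != 0 by apply: contraNneq cE => ->; rewrite meval0.
have [s ps [u uu cE']] := factorial_mpoly c0.
have [|Q Qs vQ] := vanishing_prime_factor (u := u) (s := s) uu; first by rewrite -cE'.
have pQ := ps Q Qs.
have QE : Q.@[E] != 0.
  apply: contraNneq cE => h; have [z ->] := vanishing_divides pQ vQ vc.
  by rewrite mevalM h mulr0.
pose e := (Q.@[E])^-1.
have e0 : e != 0 by rewrite invr_eq0.
exists (e *: Q); split.
- have [Q0 Qnu Qi] := prime_irreducible pQ.
  have eu : (e%:MP : {mpoly C[M]}) \is a GRing.unit.
    by apply: rmorph_unit; rewrite unitfE.
  split; first by rewrite mscalerI negb_or e0.
    by rewrite -mul_mpolyC unitrM negb_and Qnu orbT.
  move=> q r qr; have [|h|h] := Qi (Q.@[E] *: q) r; last by right.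
    by rewrite -scalerAl -qr scalerA divff // scale1r.
  by left; move: h; rewrite -mul_mpolyC unitrM => /andP[].
- move=> F hF; rewrite -has_zero_system // mevalZ; split; last first.
    by move=> /vQ ->; rewrite mulr0.
  move=> /eqP; rewrite mulf_eq0 (negPf e0) /= => /eqP h.
  apply: contrapT => nz; have [P vP] := vanishing_separates nz.
  by have [z ->] := vanishing_divides pQ vQ vP; rewrite mevalM h mulr0 eqxx.
- by rewrite mevalZ mulVf.
Qed.

(** [xget] thus does not fall back on its default 0. *)
Lemma generic_resultantP : is_resultant (generic_resultant C n d).
Proof. exact: (xgetPex 0 resultant_exists). Qed.

End Existence.

(** * Nondegenerate zeros bound the multiplicity from below *)

Section Expansion.
Variables (C : numClosedFieldType) (n : nat).

Lemma mpoly_ring_ind (P : {mpoly C[n]} -> Prop) :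
  (forall c, P c%:MP) -> (forall i, P 'X_i) ->
  (forall p q, P p -> P q -> P (p + q)) -> (forall p q, P p -> P q -> P (p * q)) ->
  forall p, P p.
Proof.
move=> hC hX hD hM p; rewrite [p]mpolyE.
have h0 : P 0 by rewrite -mpolyC0.
have h1 : P 1 by rewrite -mpolyC1.
apply: (big_ind P h0 hD) => m _; rewrite -mul_mpolyC; apply: (hM) => //.
rewrite mpolyXE_id; apply: (big_ind P h1 hM) => i _.
by move: (m i) => e; elim: e => [|k IH]; rewrite ?expr0 // exprS; apply: (hM).
Qed.

Definition diff (g : {mpoly C[n]}) (p eta : 'I_n -> C) : C :=
  \sum_l eta l * (g^`M(l)).@[p].

Lemma diffD g h p eta : diff (g + h) p eta = diff g p eta + diff h p eta.
Proof.
by rewrite -big_split; apply: eq_bigr => l _; rewrite mderivD mevalD mulrDr.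
Qed.

Lemma diffM g h p eta :
  diff (g * h) p eta = diff g p eta * h.@[p] + g.@[p] * diff h p eta.
Proof.
rewrite mulr_suml mulr_sumr -big_split; apply: eq_bigr => l _ /=.
by rewrite mderivM mevalD !mevalM; ring.
Qed.

Lemma diffC c p eta : diff c%:MP p eta = 0.
Proof. by rewrite /diff big1 // => l _; rewrite mderivC meval0 mulr0. Qed.

Lemma diffX i p eta : diff 'X_i p eta = eta i.
Proof.
rewrite /diff (bigD1 i) //= mderivX mevalZ mnm1E eqxx mul1r.
rewrite (_ : (U_(i) - U_(i) = 0)%MM) ?mpolyX0 ?meval1 ?mulr1; last first.
  by apply/mnmP => l; rewrite mnmBE mnm0E subnn.
rewrite big1 ?addr0 // => l li; rewrite mderivX mnm1E.
by rewrite eq_sym (negPf li) scale0r meval0 mulr0.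
Qed.

Lemma diffZ c g p eta : diff (c *: g) p eta = c * diff g p eta.
Proof. by rewrite -mul_mpolyC diffM diffC mul0r add0r mevalC. Qed.

Lemma diff_Xn i k p eta : diff ('X_i ^+ k) p eta = k%:R * eta i * p i ^+ k.-1.
Proof.
elim: k => [|k IH]; first by rewrite expr0 -mpolyC1 diffC !mul0r.
rewrite exprS diffM diffX mevalXU IH rmorphXn /= mevalXU.
case: k {IH} => [|k]; first by rewrite !mul0r mulr0 addr0 expr0 mulr1 !mul1r mulr1.
by rewrite /= exprS -[k.+2]addn1 natrD; ring.
Qed.

Lemma diff_eta (g : {mpoly C[n]}) p (a b : C) eta eta' :
  diff g p (fun l => a * eta l + b * eta' l) = a * diff g p eta + b * diff g p eta'.
Proof.
rewrite /diff !mulr_sumr -big_split; apply: eq_bigr => l _ /=.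
by rewrite mulrDl !mulrA.
Qed.

Lemma taylor2 (p eta : 'I_n -> C) (g : {mpoly C[n]}) :
  exists q, (map_mpoly polyC g).@[fun i => (p i)%:P + 'X * (eta i)%:P] =
    (g.@[p])%:P + 'X * (diff g p eta)%:P + 'X^2 * q.
Proof.
elim/mpoly_ring_ind: g => [c|i|g h [q1 E1] [q2 E2]|g h [q1 E1] [q2 E2]].
- by exists 0; rewrite map_mpolyC !mevalC diffC polyC0 !mulr0 !addr0.
- by exists 0; rewrite map_mpolyX !mevalXU diffX mulr0 addr0.
- exists (q1 + q2); rewrite rmorphD !mevalD E1 E2 diffD !polyCD; ring.
exists (g.@[p]%:P * q2 + q1 * h.@[p]%:P + (diff g p eta)%:P * (diff h p eta)%:P
  + 'X * ((diff g p eta)%:P * q2 + q1 * (diff h p eta)%:P) + 'X^2 * (q1 * q2)).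
by rewrite rmorphM !mevalM E1 E2 diffM !(polyCD, polyCM); ring.
Qed.

End Expansion.

(** * Order of the resultant at a system with nondegenerate zeros *)

Section Resultant.
Variables (C : numClosedFieldType) (n d : nat).
Hypotheses (n0 : (0 < n)%N) (d0 : (0 < d)%N).
Notation M := #|coef_index n d|.
Notation E := (@power_coefs n d C).
Variable Res : {mpoly C[M]}.
Hypothesis hRes : is_resultant Res.

Lemma res_zero (a : 'I_M -> C) : Res.@[a] = 0 <-> has_zero a.
Proof.
case: hRes => _ h _; have := h (sform a) (sform_homog a).
rewrite system_coefs_sform => ->; split=> -[x x0 hx]; by exists x.
Qed.

Lemma res_neq0 : Res != 0. Proof. by case: hRes => -[]. Qed.

Lemma res_power : Res.@[E] = 1. Proof. by case: hRes. Qed.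

Lemma has_zeroZ c (a : 'I_M -> C) : c != 0 ->
  has_zero (fun j => c * a j) -> has_zero a.
Proof.
move=> c0 [x x0 h]; exists x => // i; have /eqP := h i.
by rewrite sformZ mevalZ mulf_eq0 (negPf c0) => /eqP.
Qed.

Lemma poly_one_coef (p : {poly C}) : (forall t, root p t -> t = 0) ->
  p != 0 -> exists m, forall j, p`_j != 0 -> j = m.
Proof.
move=> h p0; have [m [q]] := multiplicity_XsubC p 0.
rewrite p0 /= subr0 => q0 pE; exists m => j.
have sq : size q = 1%N.
  apply/eqP/negPn/negP => /closed_rootP[t qt].
  have t0 : t = 0 by apply: h; rewrite pE rootM qt.
  by rewrite -t0 qt in q0.
rewrite pE (size1_polyC (eq_leq sq)) mul_polyC coefZ coefXn.
by have [//|_] := eqVneq j m; rewrite mulr0 eqxx.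
Qed.

(** If Res(a) <> 0, the polynomial t |-> Res(t a) has no root besides 0, S being a cone, so it is a
    monomial and a single homogeneous component of Res is nonzero at a. Hence Res times two distinct
    components is identically 0. *)
Lemma res_homog : exists D, Res \is D.-homog.
Proof.
have [nu [nu0 _]] := lowest_degree_ex res_neq0.
exists nu; suff h j : j != nu -> pihomog (@mdeg M) j Res = 0.
  rewrite (pihomog_partitionE (leqnn (msize Res))); apply: rpred_sum => j _.
  have [->|/h ->] := eqVneq (val j) nu; first exact: pihomogP.
  exact: dhomog0.
move=> jn; set Rj := pihomog _ j _; set Rn := pihomog _ nu _ in nu0.
suff /eqP : Res * Rn * Rj = 0.
  by rewrite !mulf_eq0 (negPf res_neq0) (negPf nu0) => /eqP.
apply: mpoly_eq0_fun => a; rewrite !mevalM.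
have [->|Ra] := eqVneq Res.@[a] 0; first by rewrite !mul0r.
pose q := mmap polyC (fun j => 'X * (a j)%:P) Res.
have qE t : q.[t] = Res.@[fun j => t * a j].
  by rewrite mpoly_curve_eval; apply: meval_eq => l; rewrite hornerM hornerX hornerC.
have qj i : q`_i = (pihomog (@mdeg M) i Res).@[a].
  rewrite /q {1}(pihomog_partitionE (leq_maxl (msize Res) i.+1)).
  set N := maxn _ _; have iN : (i < N)%N by rewrite leq_maxr.
  rewrite raddf_sum coef_sum (bigD1 (Ordinal iN)) //= big1 ?addr0 => [|l].
    rewrite (mmap_homog_scale _ _ _ (pihomogP _ _ _)) coefXnM ltnn subnn.
    rewrite -horner_coef0 mpoly_curve_eval.
    by apply: meval_eq => l; rewrite hornerC.
  rewrite -val_eqE /= => li.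
  rewrite (mmap_homog_scale _ _ _ (pihomogP _ _ _)).
  have -> : mmap polyC (fun j => (a j)%:P) (pihomog mdeg l Res) = (pihomog mdeg l Res).@[a]%:P.
    by rewrite (rmorph_meval polyC) mmap_map_mpoly.
  by rewrite mulrC mul_polyC coefZ coefXn eq_sym (negPf li) mulr0.
have q0 : q != 0.
  apply: contraNneq Ra => h; have := qE 1; rewrite h horner0 => ->.
  by apply/eqP/meval_eq => l; rewrite mul1r.
have [|m hm] := poly_one_coef _ q0.
  move=> t /rootP; rewrite qE => /res_zero ht; apply: contrapT => /eqP t0.
  by move: Ra; rewrite (_ : Res.@[a] = 0) ?eqxx //; apply/res_zero/(has_zeroZ t0).
have [h|h] := eqVneq Rj.@[a] 0; first by rewrite h mulr0.
have [->|h'] := eqVneq Rn.@[a] 0; first by rewrite mulr0 mul0r.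
by move: jn; rewrite (hm j) ?qj // (hm nu) ?qj // eqxx.
Qed.

Definition res_line (a b : 'I_M -> C) : {poly C} :=
  mmap polyC (fun j => (a j)%:P + (b j)%:P * 'X) Res.

Lemma res_line_eval a b t : (res_line a b).[t] = Res.@[fun j => a j + b j * t].
Proof.
rewrite mpoly_curve_eval; apply: meval_eq => j.
by rewrite hornerD hornerM hornerX !hornerC.
Qed.

(** c may be 0, which keeps the notion stable under sums. *)
Definition top_coef (k : nat) (p : {poly C}) (c : C) :=
  (size p <= k.+1)%N /\ p`_k = c.

Lemma top_coefM k l p q c e :
  top_coef k p c -> top_coef l q e -> top_coef (k + l)%N (p * q) (c * e).
Proof.
move=> [sp pc] [sq qe]; split.
  by apply: leq_trans (size_polyMleq _ _) _; lia.
have kl : (k < (k + l).+1)%N by lia.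
rewrite coefM (bigD1 (Ordinal kl)) //= pc addKn qe big1 ?addr0 // => i ik.
have [lt|gt|eq] := ltngtP (i : nat) k.
- by rewrite [q`__]nth_default ?mulr0 //; apply: leq_trans sq _; lia.
- by rewrite [p`__]nth_default ?mul0r //; apply: leq_trans sp _.
- by case/eqP: ik; apply/val_inj.
Qed.

Lemma top_coef_prod (I : Type) (r : seq I) (k : I -> nat) (p : I -> {poly C})
    (c : I -> C) : (forall i, top_coef (k i) (p i) (c i)) ->
  top_coef (\sum_(i <- r) k i)%N (\prod_(i <- r) p i) (\prod_(i <- r) c i).
Proof.
move=> h; elim: r => [|i r IH]; last by rewrite !big_cons; apply: top_coefM.
by rewrite !big_nil /top_coef size_poly1 coef1.
Qed.

Lemma top_coefX k l p c : top_coef k p c -> top_coef (k * l)%N (p ^+ l) (c ^+ l).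
Proof.
move=> h; elim: l => [|l IH]; last by rewrite mulnS !exprS; apply: top_coefM.
by rewrite muln0 !expr0 /top_coef size_poly1 coef1.
Qed.

Lemma line_top (D : nat) (Q : {mpoly C[M]}) (a b : 'I_M -> C) :
  Q \is D.-homog ->
  top_coef D (mmap polyC (fun j => (a j)%:P + (b j)%:P * 'X) Q) Q.@[b].
Proof.
move=> hQ; pose f j : {poly C} := (a j)%:P + (b j)%:P * 'X.
have hf j : top_coef 1 (f j) (b j).
  split; last by rewrite coefD coefC coefMX coefC /= add0r.
  rewrite /f addrC -cons_poly_def size_cons_poly; case: ifP => // _.
  by rewrite ltnS size_polyC_leq1.
have hm m : m \in msupp Q -> top_coef D (mmap1 f m) (mmap1 b m).
  move=> mQ; have <- : mdeg m = D := dhomog_mf hQ mQ.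
  rewrite mdegE; apply: top_coef_prod => i; rewrite -[X in top_coef X]mul1n.
  exact: top_coefX.
rewrite /meval /mmap big_seq [X in top_coef _ _ X]big_seq.
apply: (big_ind2 (top_coef D)).
- by split; rewrite ?size_poly0 ?coef0.
- move=> p c q e [sp pc] [sq qe]; split; last by rewrite coefD pc qe.
  by apply: leq_trans (size_polyD _ _) _; rewrite geq_max sp.
move=> m /hm; rewrite -[D in top_coef D _ _ -> _]add0n -[D]add0n.
apply: top_coefM; split; first exact: size_polyC_leq1.
by rewrite coefC.
Qed.

(** The leading coefficient along E is the value of Res at E. D = 0 would make Res constant, whereas
    it is 1 at E and 0 at the zero system. *)
Lemma res_line_monic : exists2 D, (0 < D)%N &
  Res \is D.-homog /\ forall a, top_coef D (res_line a E) 1.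
Proof.
have [D hD] := res_homog; exists D; last first.
  by split=> // a; rewrite -res_power; exact: line_top.
rewrite lt0n; apply/negP => /eqP D0; rewrite D0 in hD.
have := mmap_homog_scale idfun 0 E hD; rewrite expr0 mul1r -/(meval _ _) -/(meval _ _).
rewrite res_power => /eqP; apply/negP.
rewrite (_ : meval _ _ = 0) 1?eq_sym ?oner_neq0 //; apply/res_zero.
rewrite (_ : (fun i => _) = fun=> 0); last by apply/funext => i; rewrite mul0r.
exact: has_zero0.
Qed.

Lemma res_prime : prime_elt Res.
Proof. by apply: mpoly_irreducible_prime; case: hRes. Qed.

Lemma map_translate a : map_poly (meval a) (translate E 1 Res) = res_line a E.
Proof.
apply: (@mpoly_rmorph_eq _ _ _ (map_poly (meval a) \o translate E 1) (mmap polyC _)) => [b|j] /=.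
  by rewrite translateC map_polyC /= mevalC mmapC.
rewrite translateX rmorphD rmorphM /= !map_polyC map_polyX /= mevalC mevalXU mul1r.
by rewrite mmapX mmap1U.
Qed.

(** Delta acts as a discriminant in t of Res(a + t E): it is a combination of this polynomial and of
    its derivative, which the former, being prime and of larger degree, does not divide. *)
Lemma res_line_separable : exists2 Delta : {mpoly C[M]}, Delta != 0 &
  forall a t, Delta.@[a] != 0 -> root (res_line a E) t -> ~~ root (res_line a E)^`() t.
Proof.
have [D D0 [_ hD]] := res_line_monic.
set T := translate E 1 Res.
have sT : (1 < size T)%N.
  have [_ c1] := hD (fun=> 0); rewrite ltnNge; apply/negP => sT.
  move: c1; rewrite -map_translate coef_map /= nth_default ?meval0.
    by move/eqP; rewrite eq_sym oner_eq0.
  exact: leq_trans sT D0.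
have [|Delta [u [v [De DE]]]] := bezout_prime (Q := T^`()) (translate_prime E res_prime) sT.
  move=> [w wE]; rewrite -/T in wE.
  have T'0 : T^`() != 0.
    apply/eqP => /(congr1 (map_poly (meval (fun=> 0)))).
    rewrite -deriv_map map_translate rmorph0 => /(congr1 (fun p : {poly C} => p`_D.-1)).
    have [_ c1] := hD (fun=> 0).
    rewrite coef_deriv coef0 prednK // c1 => /eqP.
    by rewrite pnatr_eq0 eqn0Ngt D0.
  have T0 : T != 0 by rewrite -size_poly_gt0 ltnW.
  have w0 : w != 0 by apply: contraNneq T'0 => h; rewrite wE h mul0r.
  have := lt_size_deriv T0; rewrite wE size_mul // ltnNge.
  have : (0 < size w)%N by rewrite size_poly_gt0.
  by case: (size w) => // k _; rewrite addSn leq_addl.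
exists Delta => // a t Da ra; apply/negP => ra'.
have e' : map_poly (meval a) T^`() = (res_line a E)^`().
  by rewrite -deriv_map map_translate.
have : (Delta.@[a])%:P = map_poly (meval a) u * res_line a E +
    map_poly (meval a) v * (res_line a E)^`().
  rewrite -e' -map_translate -map_polyC DE.
  by rewrite (rmorphD (map_poly (meval a))) !(rmorphM (map_poly (meval a))).
move=> /(congr1 (horner^~ t)); rewrite hornerC hornerD !hornerM.
rewrite (rootP ra) (rootP ra') !mulr0 addr0 => /eqP.
by rewrite (negPf Da).
Qed.

(* The point p is normalized by p_r = 1, so that the vectors eta with eta_r = 0
   represent the tangent space of the projective space at p. *)
Definition nondegenerate (a : 'I_M -> C) (p : 'I_n -> C) (r : 'I_n) :=
  [/\ p r = 1, forall i, (sform a i).@[p] = 0 &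
      forall eta theta, eta r = 0 ->
        (forall i, diff (sform a i) p eta + theta * p i ^+ d = 0) ->
        (forall l, eta l = 0) /\ theta = 0].

(** Matrix, on row vectors, of the linear map of [nondegenerate] in (eta, theta). The coordinate r,
    free since eta_r = 0, stores theta, which makes the matrix square. *)
Definition nd_mx (a : 'I_M -> C) (p : 'I_n -> C) (r : 'I_n) : 'M[C]_n :=
  \matrix_(l, i) if l == r then p i ^+ d else ((sform a i)^`M(l)).@[p].

Lemma nd_mxE a p r (z : 'rV[C]_n) i :
  (z *m nd_mx a p r) 0 i =
  diff (sform a i) p (fun l => if l == r then 0 else z 0 l) + z 0 r * p i ^+ d.
Proof.
rewrite mxE (bigD1 r) //= mxE eqxx addrC; congr (_ + _).
rewrite /diff [RHS](bigD1 r) //= eqxx mul0r add0r; apply: eq_bigr => l /negPf lr.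
by rewrite mxE lr.
Qed.

Lemma nd_unit a p r : nondegenerate a p r -> nd_mx a p r \in unitmx.
Proof.
move=> [pr pz nd]; rewrite -row_free_unit; apply/inj_row_free => z zB.
have [|i|h1 h2] := nd (fun l => if l == r then 0 else z 0 l) (z 0 r).
- by rewrite eqxx.
- by rewrite -nd_mxE zB mxE.
apply/rowP => l; rewrite mxE; have := h1 l; have [->|//] := eqVneq l r.
by rewrite h2.
Qed.

(* The kernel of nd_theta, as a linear form in H, is the tangent hyperplane to
   the resultant along the branch through the zero p. *)
Definition nd_theta a p r (H : 'I_M -> C) : C :=
  (- (\row_i (sform H i).@[p]) *m invmx (nd_mx a p r)) 0 r.

Lemma nd_solve a p r H : nondegenerate a p r -> exists2 eta : 'I_n -> C, eta r = 0 &
  forall i, diff (sform a i) p eta + nd_theta a p r H * p i ^+ d = - (sform H i).@[p].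
Proof.
move=> nd; set z := - (\row_i (sform H i).@[p]) *m invmx (nd_mx a p r).
exists (fun l => if l == r then 0 else z 0 l); first by rewrite eqxx.
move=> i; rewrite /nd_theta -/z -nd_mxE /z mulmxKV ?nd_unit // !mxE //.
Qed.

(** Moving p by X eta compensates H + theta E to first order, so the system a + X (H + theta E) is
    of order X^2 at the moved point; [corr] turns it into a curve in S with the same tangent, and
    [low_vanish] applies. *)
Lemma lowest_theta a p r H nu : nondegenerate a p r ->
  lowest_degree (shift a Res) nu ->
  (pihomog (@mdeg M) nu (shift a Res)).@[fun j => H j + nd_theta a p r H * E j] = 0.
Proof.
move=> nd hnu; have [eta etar etaE] := nd_solve H nd; set theta := nd_theta _ _ _ _ in etaE *.
have [pr pz _] := nd.
pose aS j : {poly C} := (a j)%:P + 'X * (H j + theta * E j)%:P.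
pose xS i : {poly C} := (p i)%:P + 'X * (eta i)%:P.
pose L i : {poly C} := (i == r)%:R.
have LxS : (lform L).@[xS] = 1.
  rewrite lform_eval (bigD1 r) //= /L /xS !eqxx mul1r pr etar mulr0 addr0.
  by rewrite big1 ?addr0 // => i /negPf ->; rewrite mul0r.
have v2 i : exists w, (sform aS i).@[xS] = 'X^2 * w.
  pose G := sform H i + theta *: 'X_i ^+ d.
  have -> : sform aS i = map_mpoly polyC (sform a i) + 'X *: map_mpoly polyC G.
    rewrite /G -sform_power -sformZ -sformD !sform_map -sformZ -sformD.
    by congr sform; apply/funext.
  rewrite mevalD mevalZ.
  have [q1 ->] := taylor2 p eta (sform a i); have [q2 ->] := taylor2 p eta G.
  exists (q1 + (diff G p eta)%:P + 'X * q2).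
  have hG : G.@[p] = - diff (sform a i) p eta.
    rewrite /G mevalD mevalZ rmorphXn /= mevalXU.
    by rewrite -[(sform H i).@[p]]opprK -etaE opprD subrK.
  by rewrite hG pz polyCN; ring.
have [w wE] := choice v2.
pose b := corr aS xS L.
have [s sE] : exists s : 'I_M -> {poly C}, forall j, b j = aS j - 'X^2 * s j.
  exists (fun j => w (enum_val j).1 * (lform L ^+ d)@_(val (val (enum_val j).2))) => j.
  rewrite /b /corr /system_coefs /corr_system LxS expr1n scale1r mcoeffB.
  by rewrite sform_coef mcoeffZ wE mulrA.
have := low_vanish (b := fun j => (H j + theta * E j)%:P - 'X * s j) hnu.
rewrite (_ : (fun j => _.[0]) = fun j => H j + theta * E j); last first.
  apply/funext => j.
  by rewrite hornerD hornerN hornerM hornerX mul0r subr0 hornerC.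
apply; rewrite mmap_shift; apply: poly_eq0_fun => t; rewrite mpoly_curve_eval.
apply/res_zero.
have -> : (fun j => ('X * ((H j + theta * E j)%:P - 'X * s j) + (a j)%:P).[t])
   = corr (fun j => (aS j).[t]) (fun i => (xS i).[t]) (fun i => (L i).[t]).
  apply/funext => j.
  transitivity (b j).[t]; last exact: (corr_map (horner_eval t) aS xS L j).
  by rewrite sE /aS !(hornerD, hornerN, hornerM, hornerX, hornerC, hornerXn); ring.
exact: has_zero_corr.
Qed.

Lemma nd_theta_poly a p r : exists Th : {mpoly C[M]},
  forall H, Th.@[H] = nd_theta a p r H.
Proof.
exists (- \sum_i (sform (fun j => 'X_j : {mpoly C[M]}) i).@[fun l => (p l)%:MP]
   * (invmx (nd_mx a p r) i r)%:MP) => H.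
rewrite /nd_theta mulNmx mxE mevalN; congr (- _); rewrite raddf_sum mxE.
apply: eq_bigr => i _ /=; rewrite mevalM mevalC mxE; congr (_ * _).
rewrite (rmorph_meval (meval H)) sform_map.
have -> : (fun j => ('X_j).@[H]) = H by apply/funext => j; rewrite mevalXU.
by apply: meval_eq => l; exact: mevalC.
Qed.

Lemma nd_theta_uniq a p r H eta theta : nondegenerate a p r -> eta r = 0 ->
  (forall i, diff (sform a i) p eta + theta * p i ^+ d = - (sform H i).@[p]) ->
  nd_theta a p r H = theta.
Proof.
move=> nd e0 h; have [eta' e0' h'] := nd_solve H nd.
have [_ _ nd'] := nd.
have [||_ /eqP] := nd' (fun l => 1 * eta' l + (- 1) * eta l) (nd_theta a p r H - theta).
- by rewrite e0 e0' !mulr0 addr0.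
- move=> i; rewrite diff_eta mulrBl mul1r mulN1r addrACA -opprD h h'.
  by rewrite subrr.
by rewrite subr_eq0 => /eqP.
Qed.

Lemma nd_theta_sep a p q r s : nondegenerate a p r -> nondegenerate a q s ->
  ~ (exists c, forall l, q l = c * p l) ->
  exists H, nd_theta a p r H != nd_theta a q s H.
Proof.
move=> ndp ndq npq; have [pr _ _] := ndp.
have [l hl] : exists l, q l != q r * p l.
  apply: contrapT => hN; apply: npq; exists (q r) => l.
  by apply/eqP/negPn/negP => h; apply: hN; exists l.
pose e := (q l - q r * p l)^-1.
have e0 : q l - q r * p l != 0 by rewrite subr_eq0.
(* A perturbation with value p_i^d at p and 0 at q, compensated with eta = 0 by theta = -1 at p and
   by theta = 0 at q. *)
pose G i : {mpoly C[n]} := (p i ^+ d * e) *: ((q l *: 'X_r - q r *: 'X_l) * 'X_r ^+ d.-1).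
have hX i : ('X_i : {mpoly C[n]}) \is 1.-homog.
  by rewrite dhomogX; apply/eqP; exact: mdeg1.
have hG i : G i \is d.-homog.
  apply: rpredZ.
  have h1 : q l *: 'X_r - q r *: 'X_l \is [in C[n], 1.-homog].
    by apply: rpredB; apply: rpredZ.
  have := dhomogM h1 (dhomogMn d.-1 (hX r)).
  by rewrite mul1n add1n prednK.
exists (system_coefs G).
rewrite (nd_theta_uniq (eta := fun=> 0) (theta := - 1) ndp) //; last first.
  move=> i; rewrite sform_system_coefs // /diff big1 => [|j _]; last by rewrite mul0r.
  rewrite /G mevalZ mevalM mevalB !mevalZ !mevalXU rmorphXn /= mevalXU pr expr1n.
  by rewrite !mulr1 -mulrA mulVf // mulr1 add0r mulN1r.
rewrite (nd_theta_uniq (eta := fun=> 0) (theta := 0) ndq) //; last first.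
  move=> i; rewrite sform_system_coefs // /diff big1 => [|j _]; last by rewrite mul0r.
  rewrite /G mevalZ mevalM mevalB !mevalZ !mevalXU [q r * _]mulrC subrr.
  by rewrite !mul0r mulr0 oppr0 addr0.
by rewrite oppr_eq0 oner_eq0.
Qed.

(** Let nu be the order of Res at a. On a generic line H + t E its lowest form W is a nonzero
    polynomial of degree at most nu in t, with the N values [nd_theta] as distinct roots, so N <=
    nu; and X^nu divides the restriction of Res to the line through a. *)
Lemma lower_bound (a : 'I_M -> C) (N : nat) (p : 'I_N -> 'I_n -> C) (r : 'I_N -> 'I_n) :
  (forall i, nondegenerate a (p i) (r i)) ->
  (forall i j, i != j -> ~ exists c, forall l, p j l = c * p i l) ->
  (N <= mup 0 (res_line a E))%N.
Proof.
move=> nd sep; have [nu hnu] := lowest_degree_ex (shift_neq0 a res_neq0).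
have [D D0 [_ hD]] := res_line_monic.
have l0 : res_line a E != 0.
  by apply: contraTneq (oner_neq0 C) => h; have [_ <-] := hD a; rewrite h coef0 eqxx.
have [Th ThE] := choice (fun i => nd_theta_poly a (p i) (r i)).
set W := pihomog (@mdeg M) nu (shift a Res).
have W0 : W != 0 by case: hnu.
(* Where P is nonzero, W is nonzero and the N values of theta are distinct. *)
pose P := W * \prod_i \prod_(j | j != i) (Th i - Th j).
have P0 : P != 0.
  rewrite mulf_neq0 //; apply/prodf_neq0 => i _; apply/prodf_neq0 => j ji.
  have [|H] := nd_theta_sep (nd i) (nd j); first by apply: sep; rewrite eq_sym.
  by apply: contraNneq => /(congr1 (meval H)); rewrite mevalB meval0 !ThE => /eqP; rewrite subr_eq0.
have [H] := mpoly_neq0_witness P0.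
rewrite /P mevalM mulf_eq0 negb_or => /andP[WH PH].
pose R := mmap polyC (fun j => (H j)%:P + (E j)%:P * 'X) W.
have RE t : R.[t] = W.@[fun j => H j + t * E j].
  rewrite mpoly_curve_eval; apply: meval_eq => j.
  by rewrite hornerD hornerM hornerX !hornerC mulrC.
have R0 : R != 0.
  apply: contraNneq WH => h; have := RE 0; rewrite h horner0 => ->.
  by apply/eqP/meval_eq => j; rewrite mul0r addr0.
have Nnu : (N <= nu)%N.
  have [sR _] := line_top H E (pihomogP (@mdeg M) nu (shift a Res)).
  rewrite -ltnS; apply: leq_trans sR.
  pose rs := [seq nd_theta a (p i) (r i) H | i <- enum 'I_N].
  have -> : N = size rs by rewrite size_map size_enum_ord.
  apply: max_poly_roots => //.
    apply/allP => _ /mapP[i _ ->]; apply/rootP; rewrite RE.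
    exact: (lowest_theta H (nd i) hnu).
  rewrite map_inj_uniq ?enum_uniq // => i j ij.
  apply/eqP/negPn/negP => nij; move/negP: PH; apply; apply/eqP.
  rewrite rmorph_prod (bigD1 i) //= rmorph_prod (bigD1 j) 1?eq_sym //=.
  by rewrite mevalB !ThE ij subrr !mul0r.
apply: leq_trans Nnu _; rewrite mup_geq // subr0.
have [q qE] := mmap_scaleX (fun j => (E j)%:P) hnu.
rewrite (_ : res_line a E = mmap polyC (fun j => 'X * (E j)%:P) (shift a Res)).
  by rewrite qE dvdp_mulr.
rewrite mmap_shift /res_line; congr (mmap _ _ _); apply/funext => j.
by rewrite addrC mulrC.
Qed.

End Resultant.

(** * Limits along an ultrafilter *)

Section UltraLimit.
Local Open Scope classical_set_scope.
Variables (U : set_system nat).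
Hypothesis UU : UltraFilter U.

(** Along an ultrafilter bounded sequences converge, so no subsequence is extracted when many
    sequences are handled at once. In [R[i]] the condition 0 < e forces e to be real. *)
Definition ulim (K : numFieldType) (u : nat -> K) (l : K) :=
  forall e, 0 < e -> U [set m | `|u m - l| < e].

Lemma ultraS (A B : set nat) : U A -> (forall m, A m -> B m) -> U B.
Proof. by move=> UA AB; apply: filterS UA; exact: AB. Qed.

Lemma ultraI (A B : set nat) : U A -> U B -> U [set m | A m /\ B m].
Proof. exact: filterI. Qed.

Lemma ultraT (A : set nat) : (forall m, A m) -> U A.
Proof. by move=> h; apply: filterS (@filterT _ U _) => m _; exact: h. Qed.

Lemma ultra_ex (A : set nat) : U A -> exists m, A m.
Proof. by move=> /filter_ex. Qed.

Lemma ultra_compl (A : set nat) : ~ U A -> U [set m | ~ A m].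
Proof. by move=> nA; have [|//] := in_ultra_setVsetC A UU. Qed.

Lemma ultra_pigeonhole (T : finType) (f : nat -> T) :
  exists t, U [set m | f m = t].
Proof.
apply: contrapT => H.
have h (s : seq T) : U [set m | f m \notin s].
  elim: s => [|t s IH]; first exact: ultraT.
  have /ultra_compl ht : ~ U [set m | f m = t] by move=> h; apply: H; exists t.
  apply: (ultraS (ultraI ht IH)) => m [/= /eqP h1 h2].
  by rewrite inE negb_or h1.
by have [m] := ultra_ex (h (enum T)); rewrite /= mem_enum.
Qed.

Section Field.
Variable K : numFieldType.
Implicit Types (u v : nat -> K) (a b : K).

Lemma ulim_near u v a : U [set m | u m = v m] -> ulim u a -> ulim v a.
Proof.
by move=> h hu e e0; apply: (ultraS (ultraI h (hu e e0))) => m [/= <-].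
Qed.

Lemma ulim_ext u v a : u =1 v -> ulim u a -> ulim v a.
Proof. by move=> h; apply: ulim_near; apply: ultraT. Qed.

Lemma ulim_cst a : ulim (fun=> a) a.
Proof. by move=> e e0; apply: ultraT => m /=; rewrite subrr normr0. Qed.

Lemma ulimD u v a b : ulim u a -> ulim v b -> ulim (fun m => u m + v m) (a + b).
Proof.
move=> hu hv e e0; have e2 : 0 < e / 2 by rewrite divr_gt0.
apply: (ultraS (ultraI (hu _ e2) (hv _ e2))) => m [/= h1 h2].
rewrite opprD addrACA [e]splitr.
by apply: le_lt_trans (ler_normD _ _) _; exact: ltrD.
Qed.

Lemma ulimM u v a b : ulim u a -> ulim v b -> ulim (fun m => u m * v m) (a * b).
Proof.
move=> hu hv e e0.
pose c := e + 1 + `|a| + `|b|.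
have ea : 0 <= `|a| := normr_ge0 a. have eb : 0 <= `|b| := normr_ge0 b.
have c0 : 0 < c by rewrite /c -!addrA ltr_pwDl // !addr_ge0.
have d0 : 0 < e / c by rewrite divr_gt0.
apply: (ultraS (ultraI (hu _ d0) (hv _ d0))) => m [/= h1 h2].
have -> : u m * v m - a * b =
  (u m - a) * (v m - b) + (a * (v m - b) + (u m - a) * b) by ring.
set x := u m - a in h1 *; set y := v m - b in h2 *.
apply: le_lt_trans (ler_normD _ _) _; rewrite normrM.
have h3 : `|a * y + x * b| <= `|a| * (e / c) + e / c * `|b|.
  apply: le_trans (ler_normD _ _) _; rewrite !normrM.
  by apply: lerD; [apply: ler_wpM2l => //; exact: ltW|apply: ler_wpM2r => //; exact: ltW].
have h4 : `|x| * `|y| <= e / c * (e / c).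
  by apply: ler_pM => //; exact: ltW.
apply: le_lt_trans (lerD h4 h3) _.
have -> : e / c * (e / c) + (`|a| * (e / c) + e / c * `|b|) = e / c * (e / c + `|a| + `|b|) by ring.
rewrite -[ltRHS](divfK (lt0r_neq0 c0)) ltr_pM2l // [ltRHS](_ : c = e + 1 + `|a| + `|b|) // !ltrD2r.
have h5 : e / c < 1.
  by rewrite ltr_pdivrMr // mul1r /c -!addrA ltrDl ltr_pwDl ?addr_ge0.
by apply: lt_trans h5 _; rewrite ltrDr.
Qed.

Lemma ulimN u a : ulim u a -> ulim (fun m => - u m) (- a).
Proof.
move=> hu; have := ulimM (ulim_cst (- 1)) hu; rewrite mulN1r.
by apply: ulim_ext => m; rewrite mulN1r.
Qed.

Lemma ulimB u v a b : ulim u a -> ulim v b -> ulim (fun m => u m - v m) (a - b).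
Proof. by move=> hu hv; exact: ulimD hu (ulimN hv). Qed.

Lemma ulim_norm u a : ulim u a -> ulim (fun m => `|u m|) `|a|.
Proof.
move=> hu e e0; apply: (ultraS (hu e e0)) => m /=.
exact: le_lt_trans (ler_dist_dist _ _).
Qed.

Lemma ulim_uniq u a b : ulim u a -> ulim u b -> a = b.
Proof.
move=> ha hb; apply/eqP; rewrite -subr_eq0 -normr_eq0; apply/negPn/negP => ab.
have e0 : 0 < `|a - b| / 2 by rewrite divr_gt0 // lt_def ab normr_ge0.
have [m [/= h1 h2]] := ultra_ex (ultraI (ha _ e0) (hb _ e0)).
have : `|a - b| < `|a - b|.
  rewrite [ltRHS]splitr; apply: le_lt_trans (_ : _ <= `|u m - a| + `|u m - b|) _; last exact: ltrD.
  by rewrite -[`|u m - a|]normrN opprB; apply: le_trans (ler_normD _ _); rewrite addrA subrK.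
by rewrite ltxx.
Qed.

Lemma ulim_neq0 u a : ulim u a -> a != 0 -> U [set m | u m != 0].
Proof.
move=> hu a0; have a1 : 0 < `|a| by rewrite normr_gt0.
apply: (ultraS (hu _ a1)) => m /=; apply: contraTneq => ->.
by rewrite sub0r normrN ltxx.
Qed.

Lemma ulimV u a : a != 0 -> ulim u a -> ulim (fun m => (u m)^-1) a^-1.
Proof.
move=> a0 hu e e0; have a1 : 0 < `|a| by rewrite normr_gt0.
have d0 : 0 < `|a| / 2 by rewrite divr_gt0.
have d1 : 0 < e * (`|a| * (`|a| / 2)) by rewrite mulr_gt0 // mulr_gt0.
apply: (ultraS (ultraI (hu _ d0) (hu _ d1))) => m [/= h1 h2].
have um : `|a| / 2 < `|u m|.
  rewrite -(ltrD2l (`|a| / 2)) -splitr -ltrBlDr; apply: le_lt_trans h1.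
  rewrite -[`|u m - a|]normrN opprB lerBlDr; apply: le_trans (ler_normD _ _).
  by rewrite subrK.
have um0 : u m != 0 by rewrite -normr_gt0; apply: lt_trans um.
have -> : (u m)^-1 - a^-1 = (a - u m) / (a * u m) by field; rewrite ?a0 ?um0.
rewrite normrM normfV normrM -normrN opprB.
rewrite ltr_pdivrMr ?mulr_gt0 ?normr_gt0 //.
apply: lt_le_trans h2 _; rewrite ler_pM2l // ler_pM2l //; exact: ltW.
Qed.

Lemma ulim_sum (I : Type) (r : seq I) (P : pred I) (u : I -> nat -> K) (a : I -> K) :
  (forall i, ulim (u i) (a i)) ->
  ulim (fun m => \sum_(i <- r | P i) u i m) (\sum_(i <- r | P i) a i).
Proof.
move=> h; elim: r => [|i r IH].
  by rewrite big_nil; apply: ulim_ext (ulim_cst 0) => m; rewrite big_nil.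
rewrite big_cons; case: ifP => Pi; last first.
  by apply: ulim_ext IH => m; rewrite big_cons Pi.
by apply: ulim_ext (ulimD (h i) IH) => m; rewrite big_cons Pi.
Qed.

Lemma ulim_prod (I : Type) (r : seq I) (P : pred I) (u : I -> nat -> K) (a : I -> K) :
  (forall i, ulim (u i) (a i)) ->
  ulim (fun m => \prod_(i <- r | P i) u i m) (\prod_(i <- r | P i) a i).
Proof.
move=> h; elim: r => [|i r IH].
  by rewrite big_nil; apply: ulim_ext (ulim_cst 1) => m; rewrite big_nil.
rewrite big_cons; case: ifP => Pi; last first.
  by apply: ulim_ext IH => m; rewrite big_cons Pi.
by apply: ulim_ext (ulimM (h i) IH) => m; rewrite big_cons Pi.
Qed.

Lemma ulimX u a k : ulim u a -> ulim (fun m => u m ^+ k) (a ^+ k).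
Proof.
move=> h; elim: k => [|k IH]; first exact: ulim_cst.
by rewrite exprS; apply: ulim_ext (ulimM h IH) => m; rewrite exprS.
Qed.

Lemma ulim_meval (n : nat) (P : {mpoly K[n]}) (x : nat -> 'I_n -> K) (a : 'I_n -> K) :
  (forall i, ulim (fun m => x m i) (a i)) -> ulim (fun m => P.@[x m]) P.@[a].
Proof.
move=> h; rewrite mevalE.
apply: (ulim_ext (u := fun m => \sum_(k <- msupp P) P@_k * \prod_i x m i ^+ k i)).
  by move=> m; rewrite mevalE.
apply: ulim_sum => k; apply: ulimM; first exact: ulim_cst.
by apply: ulim_prod => i; exact: ulimX.
Qed.

End Field.

Lemma ulim_le (R : realFieldType) (u : nat -> R) (a b : R) :
  ulim u a -> U [set m | u m <= b] -> a <= b.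
Proof.
move=> h hb; rewrite leNgt; apply/negP => ba.
have e0 : 0 < a - b by rewrite subr_gt0.
have [m [/= h1 h2]] := ultra_ex (ultraI (h _ e0) hb).
have := le_lt_trans (ler_norm _) (_ : `|a - u m| < a - b).
by rewrite distrC => /(_ h1); rewrite ltrD2l ltrN2 ltNge h2.
Qed.

Lemma ulim_ge (R : realFieldType) (u : nat -> R) (a b : R) :
  ulim u a -> U [set m | b <= u m] -> b <= a.
Proof.
move=> h hb; rewrite -lerN2; apply: (ulim_le (ulimN h)).
by apply: (ultraS hb) => m /=; rewrite lerN2.
Qed.

(** The limit is the supremum of the numbers that bound u from below on a set of U; when a lower
    bound fails, the ultrafilter property makes it an upper bound on a set of U. *)
Lemma ulim_bounded_real (R : realType) (u : nat -> R) (B : R) :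
  (forall m, `|u m| <= B) -> exists l, ulim u l.
Proof.
move=> hB; pose S := [set x : R | U [set m | x <= u m]].
have S0 : S (- B).
  by apply: ultraT => m /=; have := hB m; rewrite ler_norml => /andP[].
have Sb x : S x -> x <= B.
  move=> /ultra_ex[m /= h]; apply: le_trans h _; apply: le_trans (hB m).
  exact: ler_norm.
have hS : has_sup S by split; [exists (- B)|exists B => x; exact: Sb].
exists (sup S) => e e0.
have e2 : 0 < e / 2 by rewrite divr_gt0.
have [x Sx xe] := sup_adherent e2 hS.
have : ~ S (sup S + e / 2).
  move=> h; have := ub_le_sup (proj2 hS) h; rewrite leNgt => /negP; apply.
  by rewrite ltrDl.
move=> /ultra_compl h; apply: (ultraS (ultraI Sx h)) => m [/= h1 /negP].
rewrite -ltNge => h2; rewrite ltr_norml; lra.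
Qed.

Lemma ulim_bounded (R : realType) (u : nat -> R[i]) (B : R[i]) :
  (forall m, `|u m| <= B) -> exists l, ulim u l.
Proof.
move=> hB.
have hb m : complex.Re `|u m| <= complex.Re B.
  by have := hB m; rewrite lecE => /andP[].
have hRe m : `|complex.Re (u m)| <= complex.Re B.
  apply: le_trans (hb m); have := normc_ge_Re (u m).
  by rewrite normc_def /= lecR.
have hIm m : `|complex.Im (u m)| <= complex.Re B.
  apply: le_trans (hb m); rewrite normc_def /= -sqrtr_sqr ler_wsqrtr //.
  by rewrite lerDr sqr_ge0.
have [a ha] := ulim_bounded_real hRe; have [b hb'] := ulim_bounded_real hIm.
have hC (v : nat -> R) (c : R) : ulim v c -> ulim (fun m => (v m)%:C%C) c%:C%C.
  move=> hv e; rewrite ltcE /= => /andP[/eqP e0 /hv h].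
  apply: (ultraS h) => m /= hm.
  rewrite -rmorphB /= normc_def /= expr0n /= addr0 sqrtr_sqr ltcE /=.
  by rewrite -e0 eqxx.
exists (a%:C + 'i%C * b%:C)%C.
apply: ulim_ext (ulimD (hC _ _ ha) (ulimM (ulim_cst 'i%C) (hC _ _ hb'))) => m /=.
by rewrite -complexE.
Qed.

End UltraLimit.

Lemma ultrafilter_ex : exists U : set_system nat, UltraFilter U /\
  forall N, U [set m | (N <= m)%N]%classic.
Proof.
have [U [UU h]] := ultraFilterLemma eventually_filter.
by exists U; split => // N; apply: h; exists N.
Qed.

Lemma ulim_invS (R : realType) (U : set_system nat) :
  UltraFilter U -> (forall N, U [set m | (N <= m)%N]%classic) ->
  ulim U (fun m => m.+1%:R^-1 : R) 0.
Proof.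
move=> UU Uge e e0; pose N := Num.bound e^-1.
have hN : e^-1 < N%:R by rewrite archi_boundP // invr_ge0 ltW.
apply: (ultraS UU (Uge N)) => m /= Nm; rewrite subr0 ger0_norm ?invr_ge0 ?ler0n //.
rewrite invf_plt ?posrE ?ltr0n //; apply: lt_trans hN _.
by rewrite ltr_nat.
Qed.

Lemma ulim_le_invS (R : realType) (U : set_system nat) (u : nat -> R[i]) :
  UltraFilter U -> (forall N, U [set m | (N <= m)%N]%classic) ->
  (forall m, `|u m| <= m.+1%:R^-1) -> ulim U u 0.
Proof.
move=> UU Uge hu e; rewrite ltcE /= => /andP[/eqP e0 e1].
apply: (ultraS UU (ulim_invS UU Uge e1)) => m /=; rewrite !subr0 => hm.
apply: le_lt_trans (hu m) _.
have -> : (m.+1%:R^-1 : R[i]) = (m.+1%:R^-1)%:C%C by rewrite fmorphV rmorph_nat.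
rewrite ltcE /= e0 eqxx /=; apply: le_lt_trans hm; exact: ler_norm.
Qed.

(** * Nondegenerate zeros bound the multiplicity from above *)

Section DividedDifferences.
Variables (C : numClosedFieldType) (n : nat) (U : set_system nat).
Hypothesis UU : UltraFilter U.
Variables (y y' : nat -> 'I_n -> C) (p : 'I_n -> C).
Hypotheses (hy : forall l, ulim U (fun m => y m l) (p l))
  (hy' : forall l, ulim U (fun m => y' m l) (p l)).

(** An exact first order expansion between two moving points, with slopes converging to the partial
    derivatives at p. Being exact, it can be divided by the distance of the points before passing to
    the limit. *)
Lemma divided_difference (g : {mpoly C[n]}) : exists gam : nat -> 'I_n -> C,
  (forall m, g.@[y m] - g.@[y' m] = \sum_l (y m l - y' m l) * gam m l) /\
  forall l, ulim U (fun m => gam m l) (g^`M(l)).@[p].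
Proof.
elim/mpoly_ring_ind: g => [c|i|g h [g1 [E1 L1]] [g2 [E2 L2]]|g h [g1 [E1 L1]] [g2 [E2 L2]]].
- exists (fun _ _ => 0); split=> [m|l].
    by rewrite !mevalC subrr big1 // => l _; rewrite mulr0.
  by rewrite mderivC meval0; exact: ulim_cst.
- exists (fun _ l => (l == i)%:R); split=> [m|l].
    rewrite !mevalXU (bigD1 i) //= eqxx mulr1 big1 ?addr0 // => l /negPf ->.
    by rewrite mulr0.
  rewrite mderivX mevalZ mnm1E; have [->|li] := eqVneq l i.
    rewrite (_ : (U_(i) - U_(i) = 0)%MM) ?mpolyX0 ?meval1 ?mulr1; last first.
      by apply/mnmP => j; rewrite mnmBE mnm0E subnn.
    by rewrite ?eqxx; exact: ulim_cst.
  by rewrite ?(eq_sym i) ?(negPf li) mul0r; exact: ulim_cst.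
- exists (fun m l => g1 m l + g2 m l); split=> [m|l].
    rewrite !mevalD opprD addrACA E1 E2 -big_split; apply: eq_bigr => l _.
    by rewrite mulrDr.
  by rewrite mderivD mevalD; exact: ulimD.
exists (fun m l => g1 m l * h.@[y m] + g.@[y' m] * g2 m l); split=> [m|l].
  have -> : (g * h).@[y m] - (g * h).@[y' m] =
    (g.@[y m] - g.@[y' m]) * h.@[y m] + g.@[y' m] * (h.@[y m] - h.@[y' m]).
    by rewrite !mevalM; ring.
  rewrite E1 E2 mulr_suml mulr_sumr -big_split; apply: eq_bigr => l _ /=.
  by ring.
rewrite mderivM mevalD !mevalM; apply: (ulimD UU).
  by apply: (ulimM UU) => //; exact: ulim_meval.
by apply: (ulimM UU) => //; exact: ulim_meval.
Qed.

End DividedDifferences.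

Section UpperBound.
Variables (R : realType) (n d : nat).
Notation C := R[i].
Hypotheses (n0 : (0 < n)%N) (d0 : (0 < d)%N).
Notation M := #|coef_index n d|.
Notation E := (@power_coefs n d C).
Variable Res : {mpoly C[M]}.
Hypothesis hRes : is_resultant Res.

Lemma meval_homog_scale (k : nat) (c : C) (x : 'I_k -> C) (p : {mpoly C[k]}) j :
  p \is j.-homog -> p.@[fun i => c * x i] = c ^+ j * p.@[x].
Proof. exact: mmap_homog_scale. Qed.

(** Division by a coordinate of largest modulus keeps the zeros bounded and one coordinate equal to
    1, so that their limits exist and are not 0. *)
Lemma has_zero_normalized (a : 'I_M -> C) : has_zero a ->
  exists rho (x : 'I_n -> C), [/\ x rho = 1, forall l, `|x l| <= 1 &
    forall i, (sform a i).@[x] = 0].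
Proof.
move=> [x [i0 xi0] xz].
pose f l := complex.Re `|x l|.
have fE l : `|x l| = (f l)%:C%C by rewrite /f normc_def.
have [rho _ hrho] := @Order.TotalTheory.arg_maxP _ _ _ i0 xpredT f isT.
have xr : x rho != 0.
  apply: contraNneq xi0 => xr; rewrite -normr_le0 fE lecR.
  have := hrho i0 isT; rewrite /f xr normr0 /=; exact.
exists rho, (fun l => (x rho)^-1 * x l); split.
- by rewrite mulVf.
- move=> l; rewrite normrM normfV mulrC ler_pdivrMr ?normr_gt0 // mul1r !fE lecR.
  exact: hrho.
- by move=> i; rewrite (meval_homog_scale _ _ (sform_homog a i)) xz mulr0.
Qed.

(** At a normalized zero, the equation of the coordinate equal to 1 expresses t through coefficients
    of a and monomials of modulus at most 1. *)
Lemma root_bound (a : 'I_M -> C) t : root (res_line Res a E) t -> `|t| <= \sum_j `|a j|.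
Proof.
move=> /rootP; rewrite res_line_eval => /(res_zero hRes)/has_zero_normalized.
move=> [r [x [xr xb xz]]]; have := xz r.
have -> : (fun j => a j + E j * t) = (fun j => a j + t * E j).
  by apply/funext => j; rewrite mulrC.
rewrite sformD sformZ sform_power mevalD mevalZ rmorphXn /= mevalXU xr expr1n mulr1.
move=> /eqP; rewrite addrC addr_eq0 => /eqP ->; rewrite normrN.
rewrite /sform raddf_sum /=; apply: le_trans (ler_norm_sum _ _ _) _.
apply: ler_sum => j _; rewrite mevalZ mevalX normrM.
apply: (@le_trans _ _ (`|if (enum_val j).1 == r then a j else 0| * 1)); last first.
  by rewrite mulr1; case: ifP => // _; rewrite normr0.
rewrite ler_wpM2l // normr_prod; apply: prodr_ile1 => l _.
by rewrite normr_ge0 /= normrX exprn_ile1.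
Qed.

Lemma upper_bound (a0 : 'I_M -> C) (N : nat) (p : 'I_N -> 'I_n -> C) (r : 'I_N -> 'I_n) :
  (forall i, nondegenerate a0 (p i) (r i)) ->
  (forall x : 'I_n -> C, (exists i, x i != 0) -> (forall i, (sform a0 i).@[x] = 0) ->
     exists k c, forall l, x l = c * p k l) ->
  (mup 0%R (res_line Res a0 E) <= N)%N.
Proof.
move=> nd compl; have [U [UU Uge]] := ultrafilter_ex.
have [D D0 [_ hD]] := res_line_monic n0 d0 hRes.
have [Delta Del0 hDel] := res_line_separable n0 d0 hRes.
have [a1 Del1] := mpoly_neq0_witness Del0.
(* Delta is not identically 0 on the line through a0 and a1, so there are parameters s_m tending to
   0 for which the roots along E are simple. *)
pose g j := a1 j - a0 j.
pose q := mmap polyC (fun j => (a0 j)%:P + (g j)%:P * 'X) Delta.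
have qE t : q.[t] = Delta.@[fun j => a0 j + t * g j].
  rewrite mpoly_curve_eval; apply: meval_eq => j.
  by rewrite hornerD hornerM hornerX !hornerC mulrC.
have q0 : q != 0.
  apply: contraNneq Del1 => h; have := qE 1; rewrite h horner0 => ->.
  by apply/eqP/meval_eq => j; rewrite mul1r /g addrCA subrr addr0.
have s_ex (m : nat) : exists t : C, `|t| <= m.+1%:R^-1 /\ q.[t] != 0.
  apply: contrapT => H.
  (* All these numbers have modulus at most 1/(m+1), and there are more of them than roots of q. *)
  pose rs := [seq ((m.+1 + i)%:R^-1 : C) | i <- iota 0 (size q)].
  have : (size rs < size q)%N.
    apply: max_poly_roots => //.
      apply/allP => _ /mapP[i _ ->]; apply/rootP/eqP/negPn/negP => h; apply: H.
      exists ((m.+1 + i)%:R^-1); split => //.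
      rewrite normfV normr_nat lef_pV2 ?posrE ?ltr0n // ler_nat; exact: leq_addr.
    rewrite map_inj_uniq ?iota_uniq // => i j /invr_inj/eqP.
    by rewrite eqr_nat eqn_add2l => /eqP.
  by rewrite size_map size_iota ltnn.
have [s sP] := choice s_ex.
have s1 m : `|s m| <= 1.
  apply: le_trans (proj1 (sP m)) _; rewrite invf_le1 ?ltr0n //.
  by rewrite ler1n.
have slim : ulim U s 0 by apply: ulim_le_invS => // m; case: (sP m).
pose am m j := a0 j + s m * g j.
have amlim j : ulim U (fun m => am m j) (a0 j).
  have := ulimD UU (ulim_cst UU (a0 j)) (ulimM UU slim (ulim_cst UU (g j))).
  by rewrite mul0r addr0.
have tau_ex (m : nat) : exists t : 'I_D -> C,
    res_line Res (am m) E = \prod_i ('X - (t i)%:P).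
  have [sz lc] := hD (am m).
  have szE : size (res_line Res (am m) E) = D.+1.
    apply/eqP; rewrite eqn_leq sz ltnNge; apply/negP => h.
    by move: lc; rewrite nth_default // => /eqP; rewrite eq_sym oner_eq0.
  have [rs rsE] := closed_field_poly_normal (res_line Res (am m) E).
  rewrite lead_coefE szE /= lc scale1r in rsE.
  have srs : size rs = D by move: szE; rewrite rsE size_prod_XsubC => -[].
  exists (fun i => nth 0 rs i).
  by rewrite {1}rsE (big_nth 0) srs big_mkord.
have [tau tauE] := choice tau_ex.
have tau_root m i : root (res_line Res (am m) E) (tau m i).
  by rewrite tauE (bigD1 i) //= rootM root_XsubC eqxx.
have tau_inj m : injective (tau m).
  move=> i j tij; apply/eqP/negPn/negP => ij.
  have := hDel (am m) (tau m i) _ (tau_root m i).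
  rewrite -qE (proj2 (sP m)) => /(_ isT) /negP; apply.
  rewrite tauE (bigD1 i) //= (bigD1 j) 1?eq_sym //= -tij.
  rewrite derivM !rootE hornerD !hornerM hornerXsubC subrr.
  by rewrite !(mul0r, mulr0, addr0).
have am_bound m j : `|am m j| <= `|a0 j| + `|g j|.
  apply: le_trans (ler_normD _ _) _; rewrite lerD2l normrM.
  by rewrite -[leRHS]mul1r ler_wpM2r.
have tau_lim i : exists l, ulim U (fun m => tau m i) l.
  apply: (ulim_bounded UU (B := \sum_j (`|a0 j| + `|g j|))) => m.
  apply: le_trans (root_bound (tau_root m i)) _.
  by apply: ler_sum => j _; exact: am_bound.
have [sig sigE] := choice tau_lim.
(* The limits of the roots are the roots of the limit polynomial, with multiplicity; it remains to
   count the indices whose root tends to 0. *)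
have prodE : res_line Res a0 E = \prod_i ('X - (sig i)%:P).
  apply/eqP; rewrite -subr_eq0; apply/eqP/poly_eq0_fun => t.
  rewrite hornerD hornerN; apply/eqP; rewrite subr_eq0; apply/eqP.
  rewrite horner_prod res_line_eval.
  apply: (ulim_uniq UU (u := fun m => (res_line Res (am m) E).[t])).
    apply: (ulim_ext UU (u := fun m => Res.@[fun j => am m j + E j * t])).
      by move=> m; rewrite res_line_eval.
    apply: (ulim_meval UU) => j; apply: (ulimD UU) => //; exact: ulim_cst.
  apply: (ulim_ext UU (u := fun m => \prod_i (t - tau m i))).
    by move=> m; rewrite tauE horner_prod; apply: eq_bigr => i _; rewrite hornerXsubC.
  under eq_bigr do rewrite hornerXsubC.
  by apply: (ulim_prod UU) => i; apply: (ulimB UU) => //; exact: ulim_cst.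
pose I0 := [set i | sig i == 0]%SET.
have -> : mup 0 (res_line Res a0 E) = #|I0|.
  rewrite prodE -(big_map sig xpredT (fun y => 'X - y%:P)) mu_prod_XsubC.
  rewrite count_map -sum1_count -sum1_card; apply: eq_bigl => i /=.
  by rewrite inE.
have rx_ex (mi : nat * 'I_D) : exists w : 'I_n * ('I_n -> C),
    [/\ w.2 w.1 = 1, forall l, `|w.2 l| <= 1 &
      forall l, (sform (fun j => am mi.1 j + tau mi.1 mi.2 * E j) l).@[w.2] = 0].
  case: mi => m i /=.
  have /rootP := tau_root m i; rewrite res_line_eval => /(res_zero hRes)/has_zero_normalized.
  move=> [rho [x [h1 h2 h3]]]; exists (rho, x); split=> // l.
  rewrite -[RHS](h3 l); congr (_.@[_]); congr sform; apply/funext => j.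
  by rewrite mulrC.
have [rx' rxE'] := choice rx_ex.
pose rx m i := rx' (m, i).
have rxE m i : [/\ (rx m i).2 (rx m i).1 = 1, forall l, `|(rx m i).2 l| <= 1 &
    forall l, (sform (fun j => am m j + tau m i * E j) l).@[(rx m i).2] = 0].
  exact: (rxE' (m, i)).
have xi_ex (il : 'I_D * 'I_n) : exists z, ulim U (fun m => (rx m il.1).2 il.2) z.
  by apply: (ulim_bounded UU (B := 1)) => m; case: (rxE m il.1).
have [xi' xiE'] := choice xi_ex.
pose xi i l := xi' (i, l).
have xiE i l : ulim U (fun m => (rx m i).2 l) (xi i l) by exact: (xiE' (i, l)).
have xi_neq0 i : exists l, xi i l != 0.
  have [rho hrho] := ultra_pigeonhole UU (fun m => (rx m i).1).
  exists rho; suff -> : xi i rho = 1 by rewrite oner_neq0.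
  apply: (ulim_uniq UU (xiE i rho)).
  apply: (ulim_near UU _ (ulim_cst UU 1)); apply: (ultraS UU hrho) => m /= <-.
  by case: (rxE m i) => ->.
have sform_lim (x : nat -> 'I_n -> C) (z : 'I_n -> C) (t : nat -> C) l :
    ulim U t 0 -> (forall i, ulim U (fun m => x m i) (z i)) ->
    ulim U (fun m => (sform (fun j => am m j + t m * E j) l).@[x m]) (sform a0 l).@[z].
  move=> ht hx.
  apply: (ulim_ext UU (u := fun m => \sum_j (if (enum_val j).1 == l then am m j + t m * E j else 0)
     * ('X_[val (val (enum_val j).2)] : {mpoly C[n]}).@[x m])).
    by move=> m; rewrite raddf_sum; apply: eq_bigr => j _ /=; rewrite mevalZ.
  rewrite raddf_sum /=; under eq_bigr do rewrite mevalZ.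
  apply: (ulim_sum UU) => j; apply: (ulimM UU); last exact: ulim_meval.
  case: ifP => _; last exact: ulim_cst.
  by have := ulimD UU (amlim j) (ulimM UU ht (ulim_cst UU (E j))); rewrite mul0r addr0.
have xi_zero i : i \in I0 -> forall l, (sform a0 l).@[xi i] = 0.
  rewrite inE => /eqP si l.
  have ti : ulim U (fun m => tau m i) 0 by rewrite -si.
  apply: (ulim_uniq UU (sform_lim _ _ _ l ti (xiE i))).
  by apply: (ulim_ext UU _ (ulim_cst UU 0)) => m; case: (rxE m i) => _ _ ->.
have xi_pt (i : {i : 'I_D | i \in I0}) : exists kc : 'I_N * C,
    forall l, xi (val i) l = kc.2 * p kc.1 l.
  have [k [c h]] := compl _ (xi_neq0 (val i)) (xi_zero _ (valP i)).
  by exists (k, c).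
have [kc kcE] := choice xi_pt.
(* To be excluded: two indices whose roots tend to 0 and whose zeros tend to the same projective
   point. *)
suff kinj : injective (fun i => (kc i).1).
  by have := leq_card _ kinj; rewrite card_sig card_ord (eq_card (B := I0)).
move=> i j kij; apply/val_inj/eqP/negPn/negP => ij.
pose k := (kc i).1; pose rr := r k.
have [pr pz ndk] := nd k.
have xi_r (h : {i : 'I_D | i \in I0}) : (kc h).1 = k -> xi (val h) rr != 0.
  move=> hk; have [l] := xi_neq0 (val h); rewrite !kcE hk pr mulr1.
  by apply: contraNneq => ->; rewrite mul0r.
pose y (h : {i : 'I_D | i \in I0}) m l := (rx m (val h)).2 l / (rx m (val h)).2 rr.
have ylim h l : (kc h).1 = k -> ulim U (fun m => y h m l) (p k l).
  move=> hk; have x0 := xi_r h hk.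
  suff -> : p k l = xi (val h) l / xi (val h) rr.
    by apply: (ulimM UU) => //; exact: ulimV.
  move: x0; rewrite !kcE hk pr mulr1 => x0.
  by rewrite mulrAC divff // mul1r.
have yzero h : (kc h).1 = k -> U [set m | forall l,
    (sform (fun j => am m j + tau m (val h) * E j) l).@[y h m] = 0]%classic.
  move=> hk; apply: (ultraS UU (ulim_neq0 UU (xiE (val h) rr) (xi_r h hk))) => m /= x0 l.
  have -> : y h m = fun l => ((rx m (val h)).2 rr)^-1 * (rx m (val h)).2 l.
    by apply/funext => l'; rewrite /y mulrC.
  by rewrite (meval_homog_scale _ _ (sform_homog _ _)); case: (rxE m (val h)) => _ _ ->; rewrite mulr0.
have yr h : (kc h).1 = k -> U [set m | y h m rr = 1]%classic.
  move=> hk; apply: (ultraS UU (ulim_neq0 UU (xiE (val h) rr) (xi_r h hk))) => m /= x0.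
  by rewrite /y divff.
pose del m l := y i m l - y j m l.
pose eps m := tau m (val i) - tau m (val j).
(* Size of the difference of the two pairs (zero, root), positive since the roots differ. After
   division by it the differences have norm 1, so their limit (eta, theta) is not 0, although
   nondegeneracy forces it to be. *)
pose S m := \sum_l `|del m l| + `|eps m|.
have eps0 m : eps m != 0.
  by rewrite subr_eq0; apply: contra ij => /eqP/tau_inj ->.
have S0 m : 0 < S m.
  by rewrite ltr_wpDl ?normr_gt0 ?sumr_ge0.
have hS m : `|S m| = S m by rewrite ger0_norm // ltW.
have sumE m : \sum_l `|del m l / S m| + `|eps m / S m| = 1.
  under eq_bigr do rewrite normrM normfV hS.
  by rewrite -mulr_suml normrM normfV hS -mulrDl -/(S m) divff // lt0r_neq0.
have del_b m l : `|del m l / S m| <= 1.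
  rewrite -(sumE m) (bigD1 l) //= -addrA lerDl; apply: addr_ge0 => //.
  by apply: sumr_ge0 => ? _; exact: normr_ge0.
have eps_b m : `|eps m / S m| <= 1 by rewrite -(sumE m) lerDr; apply: sumr_ge0 => ? _; exact: normr_ge0.
have [eta etaE] := choice (fun l => ulim_bounded UU (fun m => del_b m l)).
have [theta thetaE] := ulim_bounded UU eps_b.
have lim1 : \sum_l `|eta l| + `|theta| = 1.
  apply: (ulim_uniq UU (u := fun=> 1)); last exact: ulim_cst.
  apply: (ulim_ext UU sumE); apply: (ulimD UU); last exact: ulim_norm.
  by apply: (ulim_sum UU) => l; exact: ulim_norm.
have jk : (kc j).1 = k by rewrite /k kij.
have eta_r : eta rr = 0.
  apply: (ulim_uniq UU (etaE rr)); apply: (ulim_near UU _ (ulim_cst UU 0)).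
  apply: (ultraS UU (ultraI UU (yr i erefl) (yr j jk))) => m [/= h1 h2].
  by rewrite /del h1 h2 subrr mul0r.
have ti : ulim U (fun m => tau m (val i)) 0.
  by have := sigE (val i); have := valP i; rewrite inE => /eqP ->.
have tj : ulim U (fun m => tau m (val j)) 0.
  by have := sigE (val j); have := valP j; rewrite inE => /eqP ->.
have ylim_i l : ulim U (fun m => y i m l) (p k l) by exact: ylim.
have ylim_j l : ulim U (fun m => y j m l) (p k l) by exact: ylim.
have key l : diff (sform a0 l) (p k) eta + theta * p k l ^+ d = 0.
  have [gm gmE] := choice (fun w : 'I_M => divided_difference UU ylim_i ylim_j
    'X_[val (val (enum_val w).2)]).
  have [gx [gxE gxL]] := divided_difference UU ylim_i ylim_j ('X_l ^+ d).
  (* Slopes of the perturbed form for the root of index j; the difference of the two roots gives the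
     separate term in eps. *)
  pose Gam m e := \sum_w (if (enum_val w).1 == l then am m w else 0) * gm w m e
    + tau m (val j) * gx m e.
  have GamL e : ulim U (fun m => Gam m e) ((sform a0 l)^`M(e)).@[p k].
    have -> : ((sform a0 l)^`M(e)).@[p k] =
       \sum_w (if (enum_val w).1 == l then a0 w else 0)
         * (('X_[val (val (enum_val w).2)] : {mpoly C[n]})^`M(e)).@[p k]
       + 0 * (('X_l ^+ d : {mpoly C[n]})^`M(e)).@[p k].
      rewrite mul0r addr0 /sform (linear_sum (mderiv e)) (raddf_sum (meval _)) /=.
      apply: eq_bigr => w _ /=.
      by rewrite mderivZ mevalZ.
    apply: (ulimD UU); last exact: (ulimM UU tj (gxL e)).
    apply: (ulim_sum UU) => w; apply: (ulimM UU); last by case: (gmE w).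
    by case: ifP => _ //; exact: ulim_cst.
  apply: (ulim_uniq UU (u := fun m => \sum_e (del m e / S m) * Gam m e
     + eps m / S m * y i m l ^+ d)).
    apply: (ulimD UU); first by apply: (ulim_sum UU) => e; exact: ulimM.
    by apply: (ulimM UU) => //; exact: ulimX.
  apply: (ulim_near UU _ (ulim_cst UU 0)).
  apply: (ultraS UU (ultraI UU (yzero i erefl) (yzero j jk))) => m [/= h1 h2].
  have e1 := h1 l; have e2 := h2 l.
  rewrite sformD sformZ sform_power mevalD mevalZ rmorphXn /= mevalXU in e1.
  rewrite sformD sformZ sform_power mevalD mevalZ rmorphXn /= mevalXU in e2.
  have e3 : (sform (am m) l).@[y i m] - (sform (am m) l).@[y j m] =
      \sum_e del m e * \sum_w (if (enum_val w).1 == l then am m w else 0) * gm w m e.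
    rewrite /sform !(raddf_sum (meval _)) -sumrB /=.
    under [RHS]eq_bigr do rewrite mulr_sumr.
    rewrite exchange_big; apply: eq_bigr => w _ /=.
    rewrite !mevalZ -mulrBr; have [-> _] := gmE w; rewrite mulr_sumr.
    by apply: eq_bigr => e _; rewrite mulrCA.
  have e4 : y i m l ^+ d - y j m l ^+ d = \sum_e del m e * gx m e.
    by have := gxE m; rewrite !rmorphXn /= !mevalXU.
  have e5 : \sum_e del m e * Gam m e + eps m * y i m l ^+ d = 0.
    rewrite /Gam; under eq_bigr do rewrite mulrDr.
    rewrite big_split /= -e3.
    under [X in _ + X + _]eq_bigr do rewrite mulrCA.
    rewrite -mulr_sumr -e4 /eps -[RHS](subrr 0) -{1}e1 -e2; ring.
  apply/esym; transitivity ((\sum_e del m e * Gam m e + eps m * y i m l ^+ d) / S m).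
    rewrite [RHS]mulrDl [X in _ = X + _]mulr_suml; congr (_ + _); last by rewrite mulrAC.
    by apply: eq_bigr => e _; rewrite mulrAC.
  by rewrite e5 mul0r.
have [e0 t0] := ndk eta theta eta_r key.
move: lim1; rewrite t0 normr0 addr0 big1 => [/eqP|l _]; last by rewrite e0 normr0.
by rewrite eq_sym oner_eq0.
Qed.

End UpperBound.

(** * The characteristic polynomial of a tensor *)

Section Tensors.
Variables (R : realType) (k n : nat).
Notation C := R[i].
Hypotheses (n0 : (0 < n)%N) (k2 : (1 < k)%N).
Notation d := k.-1.
Notation M := #|coef_index n d|.
Notation E := (@power_coefs n d C).
Notation Res := (generic_resultant C n d).
Variable A : tensor C k n.

Lemma d_gt0 : (0 < d)%N. Proof. by case: k k2 => [|[]]. Qed.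

Lemma tensor_resultantP : @is_resultant C n d Res.
Proof. exact: (@generic_resultantP C n d n0 d_gt0). Qed.

Definition tensor_form (i : 'I_n) : {mpoly C[n]} :=
  \sum_(t : d.-tuple 'I_n) A i t *: \prod_(j <- t) 'X_j.

Lemma tensor_form_homog i : tensor_form i \is d.-homog.
Proof.
have h (s : seq 'I_n) : \prod_(j <- s) 'X_j \is [in C[n], (size s).-homog].
  elim: s => [|j s IH]; first by rewrite big_nil; exact: dhomog1.
  rewrite big_cons /= -add1n; apply: dhomogM => //.
  by rewrite dhomogX; apply/eqP; exact: mdeg1.
by apply: rpred_sum => t _; apply: rpredZ; have := h t; rewrite size_tuple.
Qed.

Lemma tensor_form_eval (x : 'rV[C]_n) i : (tensor_form i).@[fun j => x 0 j] = tensor_apply A x i.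
Proof.
rewrite /tensor_form (raddf_sum (meval _)) /=; apply: eq_bigr => t _.
by rewrite mevalZ rmorph_prod; congr (_ * _); apply: eq_bigr => j _; exact: mevalXU.
Qed.

Definition tensor_coefs : 'I_M -> C := system_coefs tensor_form.

(** The system lambda x^[k-1] - A x^(k-1) as a point of the line of direction E through -A: the
    characteristic polynomial is the resultant along this line. *)
Definition eigen_coefs (lam : C) : 'I_M -> C := fun j => (- tensor_coefs j) + lam * E j.

Lemma sform_eigen lam i : sform (eigen_coefs lam) i = lam *: 'X_i ^+ d - tensor_form i.
Proof.
rewrite sformD sformZ sform_power addrC; congr (_ + _).
rewrite -[RHS]scaleN1r -(sform_system_coefs _ tensor_form_homog) -sformZ.
by congr sform; apply/funext => j; rewrite mulN1r.
Qed.

Lemma sform_eigen_eval lam (x : 'rV[C]_n) i :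
  (sform (eigen_coefs lam) i).@[fun j => x 0 j] = lam * x 0 i ^+ d - tensor_apply A x i.
Proof.
by rewrite sform_eigen mevalB mevalZ rmorphXn /= mevalXU tensor_form_eval.
Qed.

Lemma eigen_equationP lam (x : 'rV[C]_n) :
  eigen_equation A lam x <-> forall i, (sform (eigen_coefs lam) i).@[fun j => x 0 j] = 0.
Proof.
split=> h i; first by rewrite sform_eigen_eval h subrr.
by have /eqP := h i; rewrite sform_eigen_eval subr_eq0 => /eqP.
Qed.

Lemma row_fun (x : 'I_n -> C) : (fun j => (\row_l x l) 0 j) = x.
Proof. by apply/funext => j; rewrite mxE. Qed.

Lemma char_polyE : tensor_char_poly A = res_line Res (fun j => - tensor_coefs j) E.
Proof.
rewrite /tensor_char_poly /poly_resultant /res_line; congr (mmap _ _ _).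
apply/funext => j; rewrite /system_coefs /char_system.
rewrite mcoeffB mcoeffZ addrC [X in _ + X = _]mulrC; congr (_ + _ * _).
  rewrite rmorphN /= /tensor_coefs /system_coefs; congr (- _).
  rewrite -[RHS]mcoeff_map_mpoly; congr (_@__); rewrite /tensor_form (raddf_sum (map_mpoly polyC)) /=.
  apply: eq_bigr => t _; rewrite map_mpolyZ rmorph_prod; congr (_ *: _).
  by apply: eq_bigr => l _; rewrite [RHS]map_mpolyX.
by rewrite /power_coefs /system_coefs -mcoeff_map_mpoly rmorphXn /= map_mpolyX.
Qed.

Lemma char_poly_comp lam :
  res_line Res (eigen_coefs lam) E = tensor_char_poly A \Po ('X + lam%:P).
Proof.
apply/eqP; rewrite -subr_eq0; apply/eqP/poly_eq0_fun => t.
rewrite hornerD hornerN horner_comp char_polyE !res_line_eval.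
apply/eqP; rewrite subr_eq0; apply/eqP/meval_eq => j.
by rewrite hornerD hornerX hornerC /eigen_coefs; ring.
Qed.

Lemma char_poly_neq0 : tensor_char_poly A != 0.
Proof.
have [D D0 [_ hD]] := res_line_monic n0 d_gt0 tensor_resultantP.
rewrite char_polyE; have [_] := hD (fun j => - tensor_coefs j).
by apply: contra_eq_neq => ->; rewrite coef0 eq_sym oner_eq0.
Qed.

Lemma alg_multE lam : alg_mult A lam = mup 0 (res_line Res (eigen_coefs lam) E).
Proof.
rewrite char_poly_comp /alg_mult.
have [m [q]] := multiplicity_XsubC (tensor_char_poly A) lam.
rewrite char_poly_neq0 /= => qr ->.
rewrite (mupMr _ qr) mup_XsubCX eqxx.
rewrite comp_polyM rmorphXn /= comp_polyB comp_polyX comp_polyC addrK.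
rewrite mupMr; last by rewrite rootE horner_comp hornerD hornerX hornerC add0r -rootE.
by have := mup_XsubCX m (0 : C) 0; rewrite subr0 eqxx.
Qed.

Lemma char_poly_root lam : root (tensor_char_poly A) lam <-> tensor_eigenvalue A lam.
Proof.
rewrite rootE char_polyE res_line_eval.
have -> : (fun j => - tensor_coefs j + E j * lam) = eigen_coefs lam.
  by apply/funext => j; rewrite mulrC.
split.
  move=> /eqP/(res_zero tensor_resultantP)[x [i xi] h]; exists (\row_l x l).
    apply: contraNneq xi => hx; have := congr1 (fun v : 'rV[C]_n => v 0 i) hx.
    by rewrite !mxE => ->.
  by apply/eigen_equationP; rewrite row_fun.
move=> [x x0 /eigen_equationP h]; apply/eqP/(res_zero tensor_resultantP).
exists (fun j => x 0 j) => //; apply: contrapT => H; move/eqP: x0; apply.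
by apply/rowP => i; rewrite mxE; apply/eqP/negPn/negP => xi; apply: H; exists i.
Qed.

Section Points.
Variable lam : C.
Hypothesis ND : forall (p : 'I_n -> C) r, p r = 1 ->
  (forall i, (sform (eigen_coefs lam) i).@[p] = 0) ->
  nondegenerate (eigen_coefs lam) p r.

Definition independent_zeros (N : nat) (p : 'I_N -> 'I_n -> C) :=
  [/\ forall i, exists r, p i r = 1,
      forall i l, (sform (eigen_coefs lam) l).@[p i] = 0 &
      forall i j, i != j -> ~ exists c, forall l, p j l = c * p i l].

(** The lower bound limits the size of independent families, so there is one of maximal size. It is
    complete, for any further zero could be normalized and added; the upper bound then makes its
    size equal to the multiplicity. *)
Lemma eigen_points : exists p : 'I_(alg_mult A lam) -> 'I_n -> C,
  independent_zeros p /\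
  forall x : 'I_n -> C, (exists i, x i != 0) ->
     (forall i, (sform (eigen_coefs lam) i).@[x] = 0) ->
     exists k c, forall l, x l = c * p k l.
Proof.
have lower N (p : 'I_N -> 'I_n -> C) : independent_zeros p -> (N <= alg_mult A lam)%N.
  move=> [p1 pz pi]; have [r rE] := choice p1.
  rewrite alg_multE; apply: (lower_bound n0 d_gt0 tensor_resultantP (p := p) (r := r)) => // i.
  by apply: ND.
have ex0 : exists N, `[< exists p : 'I_N -> 'I_n -> C, independent_zeros p >].
  by exists 0%N; apply/asboolP; exists (fun _ _ => 0); split; case.
have ub N : `[< exists p : 'I_N -> 'I_n -> C, independent_zeros p >] -> (N <= alg_mult A lam)%N.
  by move=> /asboolP[p /lower].
case: (ex_maxnP ex0 ub) => N /asboolP[p hp] Nmax.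
have [p1 pz pi] := hp.
have compl (x : 'I_n -> C) : (exists i, x i != 0) ->
     (forall i, (sform (eigen_coefs lam) i).@[x] = 0) ->
     exists k c, forall l, x l = c * p k l.
  move=> [r xr] xz; apply: contrapT => H.
  pose x' l := (x r)^-1 * x l.
  have x'r : x' r = 1 by rewrite /x' mulVf.
  pose q (i : 'I_N.+1) := if unlift ord_max i is Some j then p j else x'.
  have qm : q ord_max = x' by rewrite /q unlift_none.
  have ql j : q (lift ord_max j) = p j by rewrite /q liftK.
  suff hq : independent_zeros q.
    have := Nmax N.+1 (introT (asboolP _) (ex_intro _ q hq)).
    by rewrite ltnn.
  split.
  - move=> i; case: (unliftP ord_max i) => [j ->|->]; first by rewrite ql.
    by rewrite qm; exists r.
  - move=> i l; case: (unliftP ord_max i) => [j ->|->]; first by rewrite ql.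
    by rewrite qm (meval_homog_scale _ _ (sform_homog _ _)) xz mulr0.
  - move=> i j; case: (unliftP ord_max i) => [i' ->|->];
      case: (unliftP ord_max j) => [j' ->|->].
    + by rewrite (inj_eq lift_inj) !ql; exact: pi.
    + rewrite ql qm => _ [c h]; apply: H; exists i', (x r * c) => l.
      by rewrite -mulrA -h /x' mulrA divff // mul1r.
    + rewrite ql qm => _ [c h]; have [s ps] := p1 j'.
      have c0 : c != 0.
        by apply: contra_eq_neq ps => c0; rewrite h c0 mul0r eq_sym oner_eq0.
      apply: H; exists j', (x r / c) => l.
      by rewrite h /x'; field; rewrite xr c0.
    + by rewrite eqxx.
have upper : (alg_mult A lam <= N)%N.
  have [r rE] := choice p1.
  rewrite alg_multE; apply: (upper_bound n0 d_gt0 tensor_resultantP (p := p) (r := r)) => // i.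
  by apply: ND.
have eN : N = alg_mult A lam by apply/eqP; rewrite eqn_leq upper (lower _ _ hp).
by rewrite -eN; exists p.
Qed.

End Points.
End Tensors.

(** * Eigenvarieties that are finite unions of lines *)

Section Zariski.
Local Open Scope classical_set_scope.
Variables (C : numClosedFieldType) (n : nat).
Implicit Types (X Y Z : set 'rV[C]_n) (v x : 'rV[C]_n).

Definition line v : set 'rV[C]_n := [set x | exists c, x = c *: v].

Lemma zariski_closedU Y Z :
  zariski_closed Y -> zariski_closed Z -> zariski_closed (Y `|` Z).
Proof.
move=> [S ->] [T ->]; exists [set f | exists p q, [/\ S p, T q & f = p * q]].
apply/seteqP; split=> x /=.
  move=> [h|h] _ [p [q [Sp Tq ->]]]; rewrite mevalM.
    by rewrite (h _ Sp) mul0r.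
  by rewrite (h _ Tq) mulr0.
move=> h; apply: contrapT => /not_orP[/existsNP[p /not_implyP[Sp /eqP px]]].
move=> /existsNP[q /not_implyP[Tq /eqP qx]].
have /eqP := h (p * q) (ex_intro _ p (ex_intro _ q (And3 Sp Tq erefl))).
by rewrite mevalM mulf_eq0 (negPf px) (negPf qx).
Qed.

Lemma zariski_closed0 : zariski_closed (set0 : set 'rV[C]_n).
Proof.
exists [set 1]; apply/seteqP; split=> x //= /(_ 1 erefl)/eqP.
by rewrite meval1 oner_eq0.
Qed.

Lemma zariski_closed1 v : zariski_closed [set v].
Proof.
exists [set f | exists l, f = 'X_l - (v 0 l)%:MP].
apply/seteqP; split=> x /=.
  by move=> -> _ [l ->]; rewrite mevalB mevalXU mevalC subrr.
move=> h; apply/rowP => l; have /eqP := h _ (ex_intro _ l erefl).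
by rewrite mevalB mevalXU mevalC subr_eq0 => /eqP.
Qed.

Lemma zariski_closed_line v r : v 0 r = 1 -> zariski_closed (line v).
Proof.
move=> vr; exists [set f | exists l, f = 'X_l - v 0 l *: 'X_r].
apply/seteqP; split=> x /=.
  move=> [c ->] _ [l ->]; rewrite mevalB mevalZ !mevalXU !mxE vr mulr1.
  by rewrite mulrC subrr.
move=> h; exists (x 0 r); apply/rowP => l; rewrite mxE.
have /eqP := h _ (ex_intro _ l erefl).
by rewrite mevalB mevalZ !mevalXU subr_eq0 mulrC => /eqP.
Qed.

Lemma zariski_closed_bigU (T : eqType) (s : seq T) (F : T -> set 'rV[C]_n) :
  (forall t, t \in s -> zariski_closed (F t)) ->
  zariski_closed [set x | exists2 t, t \in s & F t x].
Proof.
elim: s => [|t s IH] h.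
  rewrite (_ : mkset _ = set0); first exact: zariski_closed0.
  by apply/seteqP; split=> x //= -[].
rewrite (_ : mkset _ = F t `|` [set x | exists2 t, t \in s & F t x]).
  apply: zariski_closedU; first by apply: h; rewrite mem_head.
  by apply: IH => u us; apply: h; rewrite inE us orbT.
apply/seteqP; split=> x /=.
  by move=> [u]; rewrite inE => /orP[/eqP ->|us] Fu; [left|right; exists u].
by move=> [Fx|[u us Fu]]; [exists t; rewrite ?mem_head|exists u; rewrite // inE us orbT].
Qed.

Lemma irreducible_sub_bigU (T : eqType) (s : seq T) (F : T -> set 'rV[C]_n) Y :
  (forall t, t \in s -> zariski_closed (F t)) -> irreducible_closed Y ->
  Y `<=` [set x | exists2 t, t \in s & F t x] ->
  exists2 t, t \in s & Y `<=` F t.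
Proof.
move=> + [_ [y0 Yy0] Yi]; elim: s => [|t s IH] h sub; first by have [] := sub _ Yy0.
have [||/=|ht|hs] := Yi (F t) [set x | exists2 t, t \in s & F t x].
- by apply: h; rewrite mem_head.
- by apply: zariski_closed_bigU => u us; apply: h; rewrite inE us orbT.
- move=> x /sub[u]; rewrite inE => /orP[/eqP ->|us] Fu; first by left.
  by right; exists u.
- by exists t; rewrite ?mem_head.
have [|//|u us Yu] := IH; first by move=> u us; apply: h; rewrite inE us orbT.
by exists u; rewrite // inE us orbT.
Qed.

Lemma restrict_line (v : 'rV[C]_n) (f : {mpoly C[n]}) :
  exists q : {poly C}, forall t, q.[t] = f.@[fun i => (t *: v) 0 i].
Proof.
exists (mmap polyC (fun i => 'X * (v 0 i)%:P) f) => t.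
rewrite mpoly_curve_eval; apply: meval_eq => i.
by rewrite hornerM hornerX hornerC mxE.
Qed.

(** Polynomials restricted to the line are polynomials in t, and C[t] has no zero divisors. *)
Lemma irreducible_line v r : v 0 r = 1 -> irreducible_closed (line v).
Proof.
move=> vr; split; first exact: zariski_closed_line vr.
  by exists 0; exists 0; rewrite scale0r.
move=> _ _ [S ->] [T ->] sub; apply: contrapT => /not_orP[nS nT].
have [f Sf [c fc]] : exists2 f, S f & exists c, f.@[fun i => (c *: v) 0 i] != 0.
  apply: contrapT => H; apply: nS => _ [c ->] f Sf /=; apply/eqP/negPn/negP => h.
  by apply: H; exists f => //; exists c.
have [g Tg [e ge]] : exists2 g, T g & exists c, g.@[fun i => (c *: v) 0 i] != 0.
  apply: contrapT => H; apply: nT => _ [c' ->] g Tg /=; apply/eqP/negPn/negP => h.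
  by apply: H; exists g => //; exists c'.
have [p pE] := restrict_line v f; have [q qE] := restrict_line v g.
have /eqP : p * q = 0.
  apply: poly_eq0_fun => t; rewrite hornerM pE qE.
  have [h|h] : [set x | forall p, S p -> p.@[fun i => x 0 i] = 0] (t *: v) \/
       [set x | forall p, T p -> p.@[fun i => x 0 i] = 0] (t *: v).
  - by apply: sub; exists t.
  - by rewrite (h _ Sf) mul0r.
  - by rewrite (h _ Tg) mulr0.
rewrite mulf_eq0 => /orP[]/eqP h.
  by move: fc; rewrite -pE h horner0 eqxx.
by move: ge; rewrite -qE h horner0 eqxx.
Qed.

Lemma irreducible1 v : irreducible_closed [set v].
Proof.
split; [exact: zariski_closed1|by exists v|].
by move=> Y Z _ _ h; have [Yv|Zv] := h v erefl; [left|right] => _ ->.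
Qed.

(** If Y is not the whole line, some polynomial vanishing on Y restricts to a nonzero polynomial in
    t; Y lies in its finite set of roots, and irreducibility leaves one point. *)
Lemma irreducible_in_line v Y :
  irreducible_closed Y -> Y `<=` line v -> Y = line v \/ exists x, Y = [set x].
Proof.
move=> irY Yl; have [[S SE] [y0 Yy0] _] := irY.
have [lY|nlY] := pselect (line v `<=` Y); first by left; apply/seteqP.
right.
have [f Sf [c fc]] : exists2 f, S f & exists c, f.@[fun i => (c *: v) 0 i] != 0.
  apply: contrapT => H; apply: nlY => _ [c ->]; rewrite SE => f Sf /=.
  by apply/eqP/negPn/negP => h; apply: H; exists f => //; exists c.
have [p pE] := restrict_line v f.
have p0 : p != 0 by apply: contraNneq fc => h; rewrite -pE h horner0.
have [rs rsE] := closed_field_poly_normal p.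
have sub : Y `<=` [set x | exists2 t, t \in rs & [set t *: v] x].
  move=> x Yx; have [t xE] := Yl _ Yx; exists t => //.
  have : root p t by rewrite rootE pE -xE; apply/eqP; move: Yx; rewrite SE; apply.
  by rewrite rsE rootZ ?lead_coef_eq0 // root_prod_XsubC.
have [t _ Yt] := irreducible_sub_bigU (fun t _ => zariski_closed1 (t *: v)) irY sub.
exists (t *: v); apply/seteqP; split => // x ->.
by rewrite -(Yt _ Yy0).
Qed.

(** The chain {0} < line has length 1. In Z_0 < Z_1 < Z_2 the middle term would be the line, leaving
    no room for Z_2, or a point, leaving none for Z_0. *)
Lemma zariski_dim_line v r : v 0 r = 1 -> zariski_dim (line v) = 1%N.
Proof.
move=> vr; have v0 : v != 0.
  by apply/eqP => h; have /eqP := vr; rewrite h mxE eq_sym oner_eq0.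
have ch1 : irreducible_chain (line v) 1.
  exists (fun i => if i is 0%N then [set 0] else line v); split.
    move=> [|i] _; split => //.
    - exact: irreducible1.
    - by move=> _ ->; exists 0; rewrite scale0r.
    - exact: irreducible_line vr.
  move=> [|//] _; split.
    by move=> _ ->; exists 0; rewrite scale0r.
  move=> /(_ v) h; have /h : line v v by exists 1; rewrite scale1r.
  by move=> h0; rewrite h0 eqxx in v0.
have chmax e : irreducible_chain (line v) e -> (e <= 1)%N.
  move=> [Z [hZ ltZ]]; rewrite leqNgt; apply/negP => e2.
  have [irZ0 _] := hZ 0%N (leq0n _).
  have [irZ1 Z1l] := hZ 1%N (ltnW e2); have [_ Z2l] := hZ 2%N e2.
  have [Z01 nZ10] := ltZ 0%N (ltnW e2); have [Z12 nZ21] := ltZ 1%N e2.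
  have [Z1E|[x Z1E]] := irreducible_in_line irZ1 Z1l.
    by apply: nZ21; rewrite Z1E.
  have [_ [y Z0y] _] := irZ0; apply: nZ10; rewrite Z1E => _ ->.
  by have := Z01 _ Z0y; rewrite Z1E => <-.
have [h1 h2] := xgetPex 0%N (ex_intro (fun d => irreducible_chain (line v) d /\
  forall e, irreducible_chain (line v) e -> (e <= d)%N) 1%N (conj ch1 chmax)).
by apply/eqP; rewrite eqn_leq chmax // h2.
Qed.

End Zariski.

(** * Components and number of points of the eigenvarieties *)

Section Varieties.
Local Open Scope classical_set_scope.
Local Open Scope card_scope.
Variables (R : realType) (k n : nat).
Notation C := R[i].
Variables (A : tensor C k n) (lam : C) (N : nat) (p : 'I_N -> 'I_n -> C).
Hypothesis hp : independent_zeros A lam p.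
Hypothesis compl : forall x : 'I_n -> C, (exists i, x i != 0) ->
  (forall i, (sform (eigen_coefs A lam) i).@[x] = 0) ->
  exists k c, forall l, x l = c * p k l.

Definition pt (i : 'I_N) : 'rV[C]_n := \row_l p i l.

Lemma pt_coord i : exists r, pt i 0 r = 1.
Proof. by have [h _ _] := hp; have [r hr] := h i; exists r; rewrite mxE. Qed.

Lemma pt_neq0 i : pt i != 0.
Proof.
have [r hr] := pt_coord i; apply/eqP => h; have /eqP := hr.
by rewrite h mxE eq_sym oner_eq0.
Qed.

Lemma pt_sep i j c : pt j = c *: pt i -> i = j.
Proof.
move=> h; apply/eqP/negPn/negP => ij; have [_ _ hi] := hp.
apply: (hi i j ij); exists c => l.
by have := congr1 (fun v : 'rV[C]_n => v 0 l) h; rewrite !mxE.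
Qed.

Lemma eigen_equation_pt i c : eigen_equation A lam (c *: pt i).
Proof.
apply/eigen_equationP => l; have [_ hz _] := hp.
rewrite (_ : (fun j => _) = fun j => c * p i j); last first.
  by apply/funext => j; rewrite !mxE.
by rewrite (meval_homog_scale _ _ (sform_homog _ _)) hz mulr0.
Qed.

Lemma eigen_equation_line (x : 'rV[C]_n) : x != 0 -> eigen_equation A lam x ->
  exists i c, c != 0 /\ x = c *: pt i.
Proof.
move=> x0 /eigen_equationP hx.
have [|i [c h]] := compl _ hx.
  apply: contrapT => H; move/eqP: x0; apply; apply/rowP => i; rewrite mxE.
  by apply/eqP/negPn/negP => xi; apply: H; exists i.
have xE : x = c *: pt i by apply/rowP => l; rewrite !mxE h.
exists i, c; split=> //; apply: contraNneq x0 => c0.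
by rewrite xE c0 scale0r.
Qed.

Lemma projective_card : projective_eigenvariety A lam #= `I_N.
Proof.
pose f (m : nat) : {vspace 'rV[C]_n} :=
  if insub m is Some i then <[pt i]>%VS else 0%VS.
have fE (i : 'I_N) : f i = <[pt i]>%VS by rewrite /f valK.
have -> : projective_eigenvariety A lam = f @` `I_N.
  apply/seteqP; split=> L /=.
    move=> [dL hL].
    have v0 : vpick L != 0 by rewrite vpick0 -dimv_eq0 dL.
    have LE : L = <[vpick L]>%VS.
      by apply/esym/eqP; rewrite eqEdim -memvE memv_pick dim_vline v0 dL.
    have [i [c [c0 vE]]] := eigen_equation_line v0 (hL _ (memv_pick L)).
    exists (val i); first exact: ltn_ord.
    rewrite fE LE vE; apply/eqP; rewrite eqEsubv -!memvE memvZ ?memv_line // andbT.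
    by rewrite -[X in X \in _](scalerK c0) memvZ // memv_line.
  move=> [m mN <-]; rewrite (fE (Ordinal mN)); split.
    by rewrite dim_vline pt_neq0.
  by move=> x /vlineP[c ->]; exact: eigen_equation_pt.
apply: inj_card_eq => m m' /set_mem /= mN /set_mem /= m'N.
rewrite (fE (Ordinal mN)) (fE (Ordinal m'N)) => h.
have : pt (Ordinal m'N) \in <[pt (Ordinal mN)]>%VS by rewrite h memv_line.
by move=> /vlineP[c /pt_sep] [].
Qed.

Lemma line_sub_eigen i : line (pt i) `<=` affine_eigenvariety A lam.
Proof. by move=> _ [c ->]; exact: eigen_equation_pt. Qed.

Lemma line_pt_inj i j : line (pt i) `<=` line (pt j) -> i = j.
Proof.
move=> h; have [|c] := h (pt i); first by exists 1; rewrite scale1r.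
by move=> /pt_sep ->.
Qed.

Lemma components_lines : (0 < N)%N ->
  irreducible_components (affine_eigenvariety A lam) = range (fun i => line (pt i)).
Proof.
move=> N0.
have in_line Y : irreducible_closed Y -> Y `<=` affine_eigenvariety A lam ->
    exists i, Y `<=` line (pt i).
  move=> irY YV.
  have [i _ h] : exists2 i, i \in enum 'I_N & Y `<=` line (pt i).
    apply: irreducible_sub_bigU => //.
      by move=> i _; have [r hr] := pt_coord i; exact: zariski_closed_line hr.
    move=> x Yx; have hx := YV _ Yx.
    have [->|x0] := eqVneq x 0.
      (* The zero vector lies on every line, but there must be one: for N = 0 the variety would be
         the point 0. *)
      by exists (Ordinal N0); rewrite ?mem_enum //; exists 0; rewrite scale0r.
    have [i [c [_ xE]]] := eigen_equation_line x0 hx.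
    by exists i; rewrite ?mem_enum //; exists c.
  by exists i.
apply/seteqP; split=> X /=.
  move=> [irX XV Xmax]; have [i Xi] := in_line X irX XV; exists i => //.
  apply: Xmax => //; last exact: line_sub_eigen.
  by have [r hr] := pt_coord i; exact: irreducible_line hr.
move=> [i _ <-]; have [r hr] := pt_coord i.
split; [exact: irreducible_line hr|exact: line_sub_eigen|].
move=> Y irY iY YV; have [j Yj] := in_line Y irY YV.
have ij : i = j by apply: line_pt_inj => x /iY /Yj.
by apply/seteqP; split=> //; rewrite ij.
Qed.

(** Every component is a line, of dimension 1, and contributes (k-1)^0 = 1; injections both ways
    show kappa = N. *)
Lemma components_sum (kappa : nat) (X : 'I_kappa -> set 'rV[C]_n) : (0 < N)%N ->
  injective X -> range X = irreducible_components (affine_eigenvariety A lam) ->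
  N = (\sum_(i < kappa) zariski_dim (X i) * (k - 1) ^ (zariski_dim (X i) - 1))%N.
Proof.
move=> N0 Xinj; rewrite components_lines // => rX.
have Xline i : exists j, X i = line (pt j).
  have : range X (X i) by exists i.
  by rewrite rX => -[j _ <-]; exists j.
have lineX j : exists i, line (pt j) = X i.
  have : range (fun i => line (pt i)) (line (pt j)) by exists j.
  by rewrite -rX => -[i _ <-]; exists i.
have [s sE] := choice Xline; have [t tE] := choice lineX.
rewrite (eq_bigr (fun=> 1%N)); last first.
  move=> i _; rewrite sE; have [r hr] := pt_coord (s i).
  by rewrite (zariski_dim_line hr) subnn expn0.
rewrite sum1_card card_ord; apply/eqP; rewrite eqn_leq; apply/andP; split.
  rewrite -[X in (X <= _)%N]card_ord -[X in (_ <= X)%N]card_ord.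
  apply: (leq_card t) => i j ij; apply: line_pt_inj.
  by rewrite !tE ij.
rewrite -[X in (X <= _)%N]card_ord -[X in (_ <= X)%N]card_ord.
by apply: (leq_card s) => i j ij; apply: Xinj; rewrite !sE ij.
Qed.

End Varieties.

(** * Perron-Frobenius theory of uniform hypergraphs *)

Section Perron.
Variables (R : realType) (k n : nat) (H : {set {set 'I_n}}).
Hypotheses (n0 : (0 < n)%N) (k2 : (1 < k)%N).
Hypothesis Huni : forall e, e \in H -> #|e| = k.
Hypothesis Hconn : forall P : 'I_n -> Prop,
  (forall e i j, e \in H -> i \in e -> j \in e -> P i -> P j) ->
  forall i j, P i -> P j.
Notation d := k.-1.

Definition edge_prod (K : comNzRingType) (x : 'I_n -> K) (e : {set 'I_n}) : K :=
  \prod_(j in e) x j.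

(** The i-th partial derivative of [edge_sum], which for an adjacency tensor is the i-th coordinate
    of A x^(k-1). *)
Definition edge_form (K : comNzRingType) (x : 'I_n -> K) (i : 'I_n) : K :=
  \sum_(e in H | i \in e) edge_prod x (e :\ i).

Definition edge_sum (K : comNzRingType) (x : 'I_n -> K) : K :=
  \sum_(e in H) edge_prod x e.

Definition power_sum (K : comNzRingType) (x : 'I_n -> K) : K := \sum_i x i ^+ k.

Lemma edge_prodD1 (K : comNzRingType) (x : 'I_n -> K) (e : {set 'I_n}) i :
  i \in e -> edge_prod x e = x i * edge_prod x (e :\ i).
Proof. by move=> ie; rewrite /edge_prod (big_setD1 i). Qed.

Lemma edge_sum_double (K : comNzRingType) (x F : 'I_n -> K) :
  \sum_i \sum_(e in H | i \in e) edge_prod x e * F i =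
  \sum_(e in H) edge_prod x e * \sum_(i in e) F i.
Proof.
rewrite (exchange_big_dep (fun e => e \in H)) /=; last by move=> i e _ /andP[].
apply: eq_bigr => e eH; rewrite mulr_sumr; apply: eq_bigl => i.
by rewrite eH.
Qed.

(** Euler's identity for a form of degree k. *)
Lemma euler_edge (K : comNzRingType) (x : 'I_n -> K) :
  \sum_i x i * edge_form x i = k%:R * edge_sum x.
Proof.
transitivity (\sum_i \sum_(e in H | i \in e) edge_prod x e * 1).
  apply: eq_bigr => i _; rewrite mulr_sumr; apply: eq_bigr => e /andP[_ ie].
  by rewrite mulr1 (edge_prodD1 _ ie).
rewrite (edge_sum_double x (fun=> 1)) mulr_sumr; apply: eq_bigr => e eH.
by rewrite sumr_const Huni // mulrC.
Qed.

Lemma edge_prod_ge0 (x : 'I_n -> R) (e : {set 'I_n}) : (forall i, 0 <= x i) -> 0 <= edge_prod x e.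
Proof. by move=> h; apply: prodr_ge0. Qed.

Lemma edge_sum_ge0 (x : 'I_n -> R) : (forall i, 0 <= x i) -> 0 <= edge_sum x.
Proof. by move=> h; apply: sumr_ge0 => e _; exact: edge_prod_ge0. Qed.

Lemma edge_form_ge0 (x : 'I_n -> R) i : (forall i, 0 <= x i) -> 0 <= edge_form x i.
Proof. by move=> h; apply: sumr_ge0 => e _; exact: edge_prod_ge0. Qed.

Lemma power_sum_ge0 (x : 'I_n -> R) : (forall i, 0 <= x i) -> 0 <= power_sum x.
Proof. by move=> h; apply: sumr_ge0 => i _; exact: exprn_ge0. Qed.

Lemma power_sum_ge (x : 'I_n -> R) r : (forall i, 0 <= x i) -> x r ^+ k <= power_sum x.
Proof.
move=> h; rewrite /power_sum (bigD1 r) //= lerDl; apply: sumr_ge0 => i _.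
exact: exprn_ge0.
Qed.

Lemma edge_prodZ (K : comNzRingType) c (x : 'I_n -> K) (e : {set 'I_n}) :
  e \in H -> edge_prod (fun i => c * x i) e = c ^+ k * edge_prod x e.
Proof. by move=> eH; rewrite /edge_prod big_split prodr_const Huni. Qed.

Lemma edge_sumZ (K : comNzRingType) c (x : 'I_n -> K) :
  edge_sum (fun i => c * x i) = c ^+ k * edge_sum x.
Proof.
by rewrite /edge_sum mulr_sumr; apply: eq_bigr => e eH; exact: edge_prodZ.
Qed.

Lemma power_sumZ (K : comNzRingType) c (x : 'I_n -> K) :
  power_sum (fun i => c * x i) = c ^+ k * power_sum x.
Proof.
by rewrite /power_sum mulr_sumr; apply: eq_bigr => e _; rewrite exprMn.
Qed.

(** For c the maximum of [edge_sum / power_sum], these are the maximizers; they turn out to be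
    Perron vectors, of eigenvalue k c. *)
Definition extremal (c : R) (y : 'I_n -> R) :=
  [/\ forall i, 0 <= y i, exists i, 0 < y i & edge_sum y = c * power_sum y].

(* The quotient edge_sum / power_sum is homogeneous of degree 0, so it may be
   maximized over the compact set max y = 1. *)
Lemma extremal_ex : exists c y, [/\ 0 <= c, extremal c y &
  forall z : 'I_n -> R, (forall i, 0 <= z i) -> edge_sum z <= c * power_sum z].
Proof.
pose S := [set q : R | exists y : 'I_n -> R,
  [/\ forall i, 0 <= y i <= 1, exists r, y r = 1 & q = edge_sum y / power_sum y]]%classic.
have p1 (y : 'I_n -> R) : (forall i, 0 <= y i <= 1) -> (exists r, y r = 1) -> 1 <= power_sum y.
  move=> h [r yr]; have := power_sum_ge r (fun i => proj1 (andP (h i))).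
  by rewrite yr expr1n.
have Sub q : S q -> q <= #|H|%:R.
  move=> [y [h1 h2 ->]]; have p := p1 _ h1 h2.
  rewrite ler_pdivrMr ?(lt_le_trans ltr01) //.
  apply: (@le_trans _ _ (#|H|%:R * 1)); last by rewrite ler_wpM2l.
  rewrite mulr1 -sumr_const; apply: ler_sum => e _.
  by apply: prodr_ile1.
have hS : has_sup S.
  split; last by exists #|H|%:R => q /Sub.
  exists (edge_sum (fun=> 1) / power_sum (fun=> 1)), (fun=> 1); split=> //.
    by move=> i; rewrite ler01 lexx.
  by exists (Ordinal n0).
have Sy m : exists y : 'I_n -> R, [/\ forall i, 0 <= y i <= 1, exists r, y r = 1 &
    sup S - m.+1%:R^-1 < edge_sum y / power_sum y].
  have [|q [y [h1 h2 ->]] h] := @sup_adherent _ S m.+1%:R^-1 _ hS.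
    by rewrite invr_gt0 ltr0n.
  by exists y.
have [y yE] := choice Sy.
have [U [UU Uge]] := ultrafilter_ex.
have yb m i : `|y m i| <= 1.
  by have [h _ _] := yE m; have /andP[h1 h2] := h i; rewrite ger0_norm.
have [z zE] := choice (fun i => ulim_bounded_real UU (fun m => yb m i)).
have y1 m : exists r, y m r = 1 by case: (yE m).
have [rm rmE] := choice y1.
have [r hr] := ultra_pigeonhole UU rm.
have zr : z r = 1.
  apply: (ulim_uniq UU (zE r)); apply: (ulim_near UU _ (ulim_cst UU 1)).
  by apply: (ultraS UU hr) => m /= <-; rewrite rmE.
have z0 i : 0 <= z i.
  apply: (ulim_ge UU (zE i)); apply: (ultraT UU) => m /=.
  by have [h _ _] := yE m; have /andP[] := h i.
have pz : 0 < power_sum z.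
  apply: lt_le_trans (power_sum_ge r z0); rewrite zr expr1n; exact: ltr01.
have lim_e : ulim U (fun m => edge_sum (y m)) (edge_sum z).
  by apply: (ulim_sum UU) => e; apply: (ulim_prod UU).
have lim_p : ulim U (fun m => power_sum (y m)) (power_sum z).
  by apply: (ulim_sum UU) => i; apply: (ulimX UU).
have lim_q : ulim U (fun m => edge_sum (y m) / power_sum (y m)) (edge_sum z / power_sum z).
  by apply: (ulimM UU) => //; apply: (ulimV UU) => //; exact: lt0r_neq0.
have sup_le : sup S <= edge_sum z / power_sum z.
  have hl : ulim U (fun m => edge_sum (y m) / power_sum (y m) + m.+1%:R^-1)
      (edge_sum z / power_sum z + 0).
    by apply: (ulimD UU) => //; exact: ulim_invS.
  rewrite addr0 in hl; apply: (ulim_ge UU hl); apply: (ultraT UU) => m /=.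
  by have [_ _ h] := yE m; rewrite ltW // -ltrBlDr.
exists (edge_sum z / power_sum z), z; split.
- by rewrite divr_ge0 ?edge_sum_ge0 // ltW.
- split=> //; first by exists r; rewrite zr ltr01.
  by rewrite divfK // lt0r_neq0.
move=> w w0; have [[i wi]|nw] := pselect (exists i, 0 < w i); last first.
  have wz i : w i = 0.
    by apply/eqP; rewrite eq_le w0 andbT leNgt; apply/negP => h; apply: nw; exists i.
  have -> : w = fun i => 0 * (1 : R) by apply/funext => i; rewrite mul0r.
  by rewrite (edge_sumZ 0 (fun=> 1)) expr0n -[k == _]negbK -lt0n (ltnW k2) mul0r
     mulr_ge0 ?divr_ge0 ?edge_sum_ge0 ?power_sum_ge0 // => j; rewrite ?mul0r.
have [s _ hs] := @Order.TotalTheory.arg_maxP _ _ _ i xpredT w isT.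
have ws : 0 < w s by apply: lt_le_trans wi (hs i isT).
have Sw : S (edge_sum (fun i => (w s)^-1 * w i) / power_sum (fun i => (w s)^-1 * w i)).
  exists (fun i => (w s)^-1 * w i); split=> //.
    move=> j; rewrite mulr_ge0 ?invr_ge0 ?(ltW ws) //= mulrC ler_pdivrMr // mul1r.
    exact: hs.
  by exists s; rewrite mulVf // lt0r_neq0.
have pw : 0 < power_sum w by apply: lt_le_trans (power_sum_ge s w0); rewrite exprn_gt0.
have := le_trans (ub_le_sup (proj2 hS) Sw) sup_le.
rewrite edge_sumZ power_sumZ -mulf_div divff ?mul1r ?ler_pdivrMr //.
by rewrite expf_neq0 // invr_eq0 lt0r_neq0.
Qed.

(** * Maximizers of the quotient: critical equation and positivity *)

Section Extremal.
Variable c : R.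
Hypothesis c0 : 0 <= c.
Hypothesis cmax : forall z : 'I_n -> R, (forall i, 0 <= z i) -> edge_sum z <= c * power_sum z.

Definition bump_at (y : 'I_n -> R) (i : 'I_n) (s : R) j := if j == i then y j + s else y j.

(** Edges being sets, the edge sum is affine in each coordinate, with slope [edge_form]. *)
Lemma edge_sum_bump y i s : edge_sum (bump_at y i s) = edge_sum y + s * edge_form y i.
Proof.
have h (e : {set 'I_n}) : i \notin e -> edge_prod (bump_at y i s) e = edge_prod y e.
  move=> ie; apply: eq_bigr => j je; rewrite /bump_at.
  by case: eqP => // ji; rewrite -ji je in ie.
rewrite /edge_sum /edge_form mulr_sumr (bigID (fun e : {set 'I_n} => i \in e)) /=.
rewrite [in RHS](bigID (fun e : {set 'I_n} => i \in e)) /= addrAC -big_split /=.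
congr (_ + _); last by apply: eq_bigr => e /andP[_]; exact: h.
apply: eq_bigr => e /andP[_ ie]; rewrite !(edge_prodD1 _ ie) h ?setD11 //.
by rewrite {1}/bump_at eqxx mulrDl.
Qed.

Lemma power_sum_bump y i s :
  power_sum (bump_at y i s) = power_sum y + ((y i + s) ^+ k - y i ^+ k).
Proof.
rewrite /power_sum !(bigD1 i (P := predT)) //= {1}/bump_at eqxx.
rewrite (eq_bigr (fun j => y j ^+ k)); first by ring.
by move=> j /negPf ji; rewrite /bump_at ji.
Qed.

Lemma extremal_bump y i s : extremal c y -> - y i <= s ->
  s * edge_form y i <= c * (s * \sum_(j < k) (y i + s) ^+ (k.-1 - j) * y i ^+ j).
Proof.
move=> [y0 _ yE] hs.
have := cmax (z := bump_at y i s); rewrite edge_sum_bump power_sum_bump yE.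
rewrite mulrDr lerD2l subrXX addrAC subrr add0r; apply => j.
rewrite /bump_at; case: eqP => [->|_] //.
by rewrite -[0](subrr (y i)) lerD2l.
Qed.

(** Critical point equation for the coordinate i: [extremal_bump] divided by small s > 0 and s < 0
    gives in the limit both inequalities. If y_i = 0, negative s are not allowed, but then the right
    side is 0. *)
Lemma extremal_eigen y i : extremal c y -> edge_form y i = k%:R * c * y i ^+ d.
Proof.
move=> ey; have [y0 _ _] := ey.
have [U [UU Uge]] := ultrafilter_ex.
have slim := ulim_invS (R := R) UU Uge.
have Qlim (s : nat -> R) : ulim U s 0 ->
    ulim U (fun m => c * \sum_(j < k) (y i + s m) ^+ (k.-1 - j) * y i ^+ j)
      (k%:R * c * y i ^+ d).
  move=> hs; have -> : k%:R * c * y i ^+ d = c * \sum_(j < k) (y i + 0) ^+ (k.-1 - j) * y i ^+ j.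
    rewrite addr0 (eq_bigr (fun=> y i ^+ d)) => [|j _].
      by rewrite sumr_const card_ord -[y i ^+ d *+ k]mulr_natl; ring.
    by rewrite -exprD subnK // -ltnS prednK ?(ltnW k2).
  apply: (ulimM UU (ulim_cst UU c)); apply: (ulim_sum UU) => j.
  apply: (ulimM UU); last exact: ulim_cst.
  by apply: (ulimX UU); apply: (ulimD UU (ulim_cst UU _)).
apply/eqP; rewrite eq_le; apply/andP; split.
  apply: (ulim_ge UU (Qlim _ slim)); apply: (ultraT UU) => m /=.
  have s0 : 0 < m.+1%:R^-1 :> R by rewrite invr_gt0 ltr0n.
  have := extremal_bump (i := i) (s := m.+1%:R^-1) ey.
  rewrite [c * (_ * _)]mulrCA ler_pM2l //; apply.
  by apply: le_trans (ltW s0); rewrite oppr_le0.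
have [yi|yi] := eqVneq (y i) 0.
  rewrite yi expr0n -[d == _]negbK -lt0n (d_gt0 k2) mulr0; exact: edge_form_ge0.
have yi0 : 0 < y i by rewrite lt_def yi y0.
(* The negative variation - y_i / (m + 1) keeps the coordinate nonnegative. *)
have slim' : ulim U (fun m => - y i * m.+1%:R^-1) 0.
  by have := ulimM UU (ulim_cst UU (- y i)) slim; rewrite mulr0.
apply: (ulim_le UU (Qlim _ slim')); apply: (ultraT UU) => m /=.
have s0 : 0 < m.+1%:R^-1 :> R by rewrite invr_gt0 ltr0n.
have := extremal_bump (i := i) (s := - y i * m.+1%:R^-1) ey.
rewrite [c * (_ * _)]mulrCA ler_nM2l; last by rewrite mulNr oppr_lt0 mulr_gt0.
apply; rewrite mulNr lerN2 ler_piMr // invf_le1 ?ltr0n // ler1n //.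
Qed.

(** If an edge e carries a positive coordinate and a zero one, raising its set Z of zero coordinates
    to eps adds at least b eps^|Z| to the edge sum and only |Z| eps^k to the power sum. As |Z| < k,
    a small eps contradicts maximality. *)
Lemma extremal_pos y : extremal c y -> forall i, 0 < y i.
Proof.
move=> ey; have [y0 [i0 yi0] yE] := ey.
suff h e i j : e \in H -> i \in e -> j \in e -> 0 < y i -> 0 < y j.
  by move=> j; exact: (@Hconn (fun l => 0 < y l) h i0 j yi0).
move=> eH ie je yi; rewrite lt_def y0 andbT; apply/negP => /eqP yj.
pose Z := [set l in e | y l == 0].
have jZ : j \in Z by rewrite inE je yj eqxx.
pose b := \prod_(l in e :\: Z) y l.
have b0 : 0 < b.
  apply: prodr_gt0 => l; rewrite !inE => /andP[+ le].
  by rewrite le /= lt_def y0 andbT.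
pose a : R := #|Z|%:R.
have a0 : 0 <= a by rewrite ler0n.
(* Chosen so that eps <= 1 and c a eps < b. *)
pose eps := b / (b + c * a + 1).
have den : 0 < b + c * a + 1 by rewrite addr_gt0 // ltr_wpDr // mulr_ge0.
have eps0 : 0 < eps by rewrite divr_gt0.
have eps1 : eps <= 1.
  by rewrite ler_pdivrMr // mul1r -addrA lerDl addr_ge0 // mulr_ge0.
pose z l := if l \in Z then eps else y l.
have zy l : y l <= z l.
  rewrite /z; case: ifP => //; rewrite inE => /andP[_ /eqP ->]; exact: ltW.
have z0 l : 0 <= z l by apply: le_trans (zy l).
have ze : edge_prod z e = eps ^+ #|Z| * b.
  rewrite /edge_prod (bigID (fun l => l \in Z)) /=; congr (_ * _).
    rewrite -prodr_const; apply: eq_big => l; first by rewrite inE andbA andbb.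
    by rewrite /z => /andP[_ ->].
  apply: eq_big => l; first by rewrite finset.in_setD andbC.
  by move=> /andP[_ /negPf lZ]; rewrite /z lZ.
have Gz : edge_sum y + eps ^+ #|Z| * b <= edge_sum z.
  rewrite /edge_sum !(bigD1 e eH) /= -ze.
  have -> : edge_prod y e = 0 by rewrite (edge_prodD1 _ je) yj mul0r.
  rewrite add0r [leRHS]addrC lerD2r; apply: ler_sum => f _.
  by apply: ler_prod => l _; rewrite y0 zy.
have Pz : power_sum z = power_sum y + a * eps ^+ k.
  rewrite /power_sum (bigID (fun l => l \in Z)) /= [in RHS](bigID (fun l => l \in Z)) /=.
  have -> : \sum_(l in Z) y l ^+ k = 0.
    rewrite big1 // => l; rewrite inE => /andP[_ /eqP ->].
    by rewrite expr0n -[k == _]negbK -lt0n (ltnW k2).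
  rewrite add0r addrC; congr (_ + _).
    by apply: eq_bigr => l /negPf lZ; rewrite /z lZ.
  rewrite (eq_bigr (fun=> eps ^+ k)) => [|l lZ]; last by rewrite /z lZ.
  by rewrite sumr_const -mulr_natl.
have Zk : (#|Z| < k)%N.
  rewrite -(Huni eH); apply: proper_card; apply/properP; split.
    by apply/fintype.subsetP => l; rewrite inE => /andP[].
  by exists i => //; rewrite inE ie /= gt_eqF.
have := le_trans Gz (cmax z0); rewrite Pz mulrDr yE lerD2l.
have -> : eps ^+ k = eps ^+ #|Z| * (eps * eps ^+ (k - #|Z|).-1).
  by rewrite -exprS prednK ?subn_gt0 // -exprD subnKC // ltnW.
have -> : c * (a * (eps ^+ #|Z| * (eps * eps ^+ (k - #|Z|).-1))) =
   eps ^+ #|Z| * (c * a * eps * eps ^+ (k - #|Z|).-1) by ring.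
rewrite ler_pM2l ?exprn_gt0 //; apply/negP; rewrite -ltNge.
apply: (@le_lt_trans _ _ (c * a * eps)).
  rewrite ler_piMr ?exprn_ile1 ?(ltW eps0) // mulr_ge0 ?(ltW eps0) //.
  exact: mulr_ge0.
rewrite /eps mulrA ltr_pdivrMr // mulrC ltr_pM2l //.
by rewrite -addrA addrCA ltrDl ltr_pwDr // ltW.
Qed.

End Extremal.

(** * Eigenvalues of maximal modulus *)

Section Eigen.
Notation C := R[i].
Variable A : tensor C k n.
Hypothesis HA : forall i, tensor_form A i =
  \sum_(e in H | i \in e) edge_prod (fun j => 'X_j : {mpoly C[n]}) (e :\ i).

Lemma tensor_apply_edge (x : 'rV[C]_n) i :
  tensor_apply A x i = edge_form (fun j => x 0 j) i.
Proof.
rewrite -tensor_form_eval HA (raddf_sum (meval _)) /=; apply: eq_bigr => e _.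
by rewrite /edge_prod rmorph_prod; apply: eq_bigr => j _; exact: mevalXU.
Qed.

Definition cabs (x : 'rV[C]_n) (i : 'I_n) : R := complex.Re `|x 0 i|.

Lemma cabsE (x : 'rV[C]_n) i : `|x 0 i| = (cabs x i)%:C%C.
Proof. by rewrite /cabs normc_def. Qed.

Lemma cabs_ge0 (x : 'rV[C]_n) i : 0 <= cabs x i.
Proof. rewrite -lecR -cabsE; exact: normr_ge0. Qed.

Lemma edge_prod_cabs (x : 'rV[C]_n) (e : {set 'I_n}) :
  `|edge_prod (fun j => x 0 j) e| = (edge_prod (cabs x) e)%:C%C.
Proof.
rewrite /edge_prod normr_prod rmorph_prod; apply: eq_bigr => j _; exact: cabsE.
Qed.

Lemma edge_form_cabs (x : 'rV[C]_n) i :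
  \sum_(e in H | i \in e) `|edge_prod (fun j => x 0 j) (e :\ i)| = (edge_form (cabs x) i)%:C%C.
Proof.
by rewrite /edge_form rmorph_sum; apply: eq_bigr => e _; exact: edge_prod_cabs.
Qed.

Lemma edge_sum_real (K : comNzRingType) (f : {rmorphism R -> K}) (y : 'I_n -> R) i :
  f (edge_form y i) = edge_form (fun j => f (y j)) i.
Proof.
by rewrite rmorph_sum; apply: eq_bigr => e _; rewrite rmorph_prod.
Qed.

Variables (c : R) (y0 : 'I_n -> R).
Hypotheses (c0 : 0 <= c) (ey0 : extremal c y0).
Hypothesis cmax : forall z : 'I_n -> R, (forall i, 0 <= z i) -> edge_sum z <= c * power_sum z.
Notation mu := (k%:R * c).

Lemma eigenvalue_le (lam : C) (x : 'rV[C]_n) : eigen_equation A lam x ->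
  forall i, `|lam| * `|x 0 i| ^+ d <= (edge_form (cabs x) i)%:C%C.
Proof.
move=> h i; rewrite -normrX -normrM -h tensor_apply_edge -edge_form_cabs.
exact: ler_norm_sum.
Qed.

(** Multiply [eigenvalue_le] by |x_i| and sum over i, using Euler's identity. *)
Lemma eigen_sum (lam : C) (x : 'rV[C]_n) : eigen_equation A lam x ->
  complex.Re `|lam| * power_sum (cabs x) <= k%:R * edge_sum (cabs x).
Proof.
move=> h; rewrite -euler_edge /power_sum mulr_sumr; apply: ler_sum => i _.
have := eigenvalue_le h i; rewrite cabsE -rmorphXn /=.
rewrite (_ : `|lam| = (complex.Re `|lam|)%:C%C); last by rewrite normc_def.
rewrite -rmorphM lecR /= => hi.
rewrite -[k in X in X <= _](prednK (ltnW k2)) exprS mulrCA.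
by apply: ler_wpM2l => //; exact: cabs_ge0.
Qed.

Lemma power_sum_gt0 (x : 'rV[C]_n) : x != 0 -> 0 < power_sum (cabs x).
Proof.
move=> x0; have [i xi] : exists i, x 0 i != 0.
  apply: contrapT => H0; move/eqP: x0; apply; apply/rowP => i; rewrite mxE.
  by apply/eqP/negPn/negP => xi; apply: H0; exists i.
apply: lt_le_trans (power_sum_ge i (cabs_ge0 x)).
by rewrite exprn_gt0 // -ltcR -cabsE normr_gt0.
Qed.

Lemma tensor_eigenvalue_le (lam : C) : tensor_eigenvalue A lam -> `|lam| <= mu%:C%C.
Proof.
move=> [x x0 h]; rewrite (_ : `|lam| = (complex.Re `|lam|)%:C%C); last by rewrite normc_def.
rewrite lecR -(ler_pM2r (power_sum_gt0 x0)); apply: le_trans (eigen_sum h) _.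
by rewrite -mulrA ler_wpM2l // cmax //; exact: cabs_ge0.
Qed.

Lemma tensor_eigenvalue_mu : tensor_eigenvalue A mu%:C%C.
Proof.
have [_ [r yr] _] := ey0; exists (\row_j (y0 j)%:C%C).
  apply/eqP => h; have /eqP := congr1 (fun v : 'rV[C]_n => v 0 r) h.
  by rewrite !mxE (inj_eq (@complexI _)) gt_eqF.
move=> i; rewrite tensor_apply_edge mxE -rmorphXn -rmorphM /=.
rewrite -(extremal_eigen cmax i ey0) edge_sum_real.
by congr edge_form; apply/funext => j; rewrite mxE.
Qed.

Lemma spectral_radiusE : spectral_radius A = mu.
Proof.
rewrite /spectral_radius; set S := mkset _.
have mu0 : 0 <= mu by rewrite mulr_ge0.
have Smu : S mu.
  exists mu%:C%C; first by apply/(char_poly_root n0 k2); exact: tensor_eigenvalue_mu.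
  by rewrite ger0_norm // lecR.
have ub r : S r -> r <= mu.
  move=> [z /(char_poly_root n0 k2)/tensor_eigenvalue_le + zr].
  by rewrite zr lecR.
apply/eqP; rewrite eq_le; apply/andP; split.
  by apply: ge_sup => //; exists mu.
by apply: ub_le_sup => //; exists mu => r; exact: ub.
Qed.

(** For |lambda| = k c, [eigen_sum] is the reverse of the inequality [cmax] at the vector of
    moduli. *)
Lemma eigenvector_extremal (lam : C) (x : 'rV[C]_n) : `|lam| = mu%:C%C ->
  x != 0 -> eigen_equation A lam x -> extremal c (cabs x).
Proof.
move=> hl x0 h; split; first exact: cabs_ge0.
  apply: contrapT => H0; have := power_sum_gt0 x0; rewrite /power_sum big1 ?ltxx // => i _.
  have -> : cabs x i = 0.
    by apply/eqP; rewrite eq_le cabs_ge0 andbT leNgt; apply/negP => hi; apply: H0; exists i.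
  by rewrite expr0n -[k == _]negbK -lt0n (ltnW k2).
apply/eqP; rewrite eq_le cmax ?andTb; last exact: cabs_ge0.
have k0 : 0 < k%:R :> R by rewrite ltr0n ltnW.
rewrite -(ler_pM2l k0) mulrA.
by have := eigen_sum h; rewrite hl.
Qed.

(** Extremality of the moduli makes the triangle inequality for (A x^(k-1))_i an equality, so its
    terms share a phase u, which the eigenvalue equation relates to lambda x_i^(k-1). Eliminating u
    compares the phases of the edge product and of lambda x_i^k. *)
Lemma edge_phase (lam : C) (x : 'rV[C]_n) (e : {set 'I_n}) i : `|lam| = mu%:C%C ->
  x != 0 -> eigen_equation A lam x -> e \in H -> i \in e ->
  edge_prod (fun j => x 0 j) e * (mu%:C%C * (cabs x i)%:C%C ^+ k) =
  (edge_prod (cabs x) e)%:C%C * (lam * x 0 i ^+ k).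
Proof.
move=> hl x0 h eH ie; have ex := eigenvector_extremal hl x0 h.
have hT := extremal_eigen cmax i ex.
have hs : `|\sum_(e in H | i \in e) edge_prod (fun j => x 0 j) (e :\ i)| =
    \sum_(e in H | i \in e) `|edge_prod (fun j => x 0 j) (e :\ i)|.
  have := h i; rewrite tensor_apply_edge /edge_form => ->.
  rewrite edge_form_cabs hT normrM normrX hl cabsE.
  by rewrite -rmorphXn -rmorphM.
have [u _ uE] := normC_sum_eq hs.
have eE f : (f \in H) && (i \in f) -> edge_prod (fun j => x 0 j) (f :\ i) =
    (edge_prod (cabs x) (f :\ i))%:C%C * u.
  by move=> hf; rewrite uE // edge_prod_cabs.
have lE : lam * x 0 i ^+ d = mu%:C%C * (cabs x i)%:C%C ^+ d * u.
  rewrite -h tensor_apply_edge /edge_form (eq_bigr _ eE) -mulr_suml -rmorph_sum.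
  by congr (_ * _); rewrite -/(edge_form _ _) hT rmorphM rmorphXn.
rewrite (edge_prodD1 _ ie) (edge_prodD1 (cabs x) ie) eE ?eH //.
rewrite -[X in _ ^+ X](prednK (ltnW k2)) -[X in x 0 i ^+ X](prednK (ltnW k2)) !exprS.
have -> : lam * (x 0 i * x 0 i ^+ d) = x 0 i * (lam * x 0 i ^+ d) by ring.
by rewrite lE rmorphM /=; ring.
Qed.

Lemma diff_edge_prod (p eta : 'I_n -> C) (f : {set 'I_n}) :
  (forall j, p j != 0) ->
  diff (edge_prod (fun j => 'X_j) f) p eta =
  edge_prod p f * \sum_(j in f) eta j / p j.
Proof.
move=> p0; rewrite /edge_prod.
have hs (s : seq 'I_n) : diff (\prod_(j <- s) 'X_j) p eta =
    \prod_(j <- s) p j * \sum_(j <- s) eta j / p j.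
  elim: s => [|j s IH]; first by rewrite !big_nil -mpolyC1 diffC mulr0.
  rewrite !big_cons diffM diffX IH mevalXU rmorph_prod /=.
  rewrite (eq_bigr p) => [|l _]; last exact: mevalXU.
  by field; exact: p0.
by rewrite -!big_enum /=; exact: hs.
Qed.

Lemma no_edge : mu = 0 -> H = finset.set0.
Proof.
move=> m0; have cz : c = 0.
  move/eqP: m0; rewrite mulf_eq0 pnatr_eq0 => /orP[/eqP k0|/eqP //].
  by move: k2; rewrite k0.
apply/finset.setP => e; rewrite inE; apply/negP => eH.
have := cmax (z := fun=> 1) (fun=> ler01); rewrite cz mul0r leNgt => /negP; apply.
rewrite /edge_sum (bigD1 e eH) /= ltr_wpDr //.
  by apply: sumr_ge0 => f _; apply: edge_prod_ge0.
by apply: prodr_gt0.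
Qed.

Lemma perron_nondegenerate (lam : C) (p : 'I_n -> C) r : `|lam| = mu%:C%C ->
  p r = 1 -> (forall i, (sform (eigen_coefs A lam) i).@[p] = 0) ->
  nondegenerate (eigen_coefs A lam) p r.
Proof.
move=> hl pr pz; split=> // eta theta etar key.
(* If mu = 0 there is no edge, so connectivity leaves the single vertex r, where eta vanishes. *)
have [m0|m0] := eqVneq mu 0.
  have H0 := no_edge m0.
  have one i : i = r.
    apply: (@Hconn (fun l => l = r) _ r i erefl) => e ? ?; by rewrite H0 inE.
  have eta0 l : eta l = 0 by rewrite (one l).
  split=> //; have := key r; rewrite /diff big1 => [|l _]; last by rewrite eta0 mul0r.
  by rewrite add0r pr expr1n mulr1.
pose x : 'rV[C]_n := \row_l p l.
have xp : (fun j => x 0 j) = p by apply/funext => j; rewrite mxE.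
have x0 : x != 0.
  apply/eqP => h; have /eqP := pr.
  by rewrite -xp h mxE eq_sym oner_eq0.
have hx : eigen_equation A lam x by apply/eigen_equationP; rewrite xp.
have ex := eigenvector_extremal hl x0 hx.
pose y i : C := (cabs x i)%:C%C.
have ypos i : 0 < y i by rewrite ltcR; exact: (extremal_pos c0 cmax ex).
have y0' i : y i != 0 by rewrite gt_eqF.
have p0 i : p i != 0 by rewrite -normr_gt0 -xp cabsE ypos.
have [m mE] : exists m : C, m = mu%:C%C by exists mu%:C%C.
have muC : m != 0 by rewrite mE (inj_eq (@complexI _)).
have lam0 : lam != 0 by rewrite -normr_eq0 hl -mE.
have phase e i : e \in H -> i \in e ->
    edge_prod p e * (m * y i ^+ k) = edge_prod y e * (lam * p i ^+ k).
  move=> eH ie; have := edge_phase hl x0 hx eH ie; rewrite xp mxE -mE => ->.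
  by congr (_ * _); rewrite rmorph_prod.
have yE i : m * y i ^+ k = \sum_(e in H | i \in e) edge_prod y e.
  have hT := extremal_eigen cmax i ex.
  have yd : m * y i ^+ d = (edge_form (cabs x) i)%:C%C.
    by rewrite mE hT [RHS]rmorphM [X in _ = _ * X]rmorphXn.
  rewrite -[X in _ ^+ X](prednK (ltnW k2)) exprS mulrCA yd.
  rewrite edge_sum_real mulr_sumr; apply: eq_bigr => e /andP[_ ie].
  by rewrite (edge_prodD1 _ ie).
have yprod e : edge_prod y e != 0 by apply/prodf_neq0.
(* The phase of p_i^k; it is the same at all vertices of an edge, hence everywhere. *)
pose w i := p i ^+ k / y i ^+ k.
have w_edge e i j : e \in H -> i \in e -> j \in e -> w i = w j.
  move=> eH ie je.
  have wE l : l \in e -> w l = edge_prod p e * m / (edge_prod y e * lam).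
    move=> le; rewrite /w; have := phase e l eH le => hph.
    have yk : y l ^+ k != 0 by rewrite expf_neq0.
    apply/eqP; rewrite eqr_div ?mulf_neq0 //; apply/eqP.
    by rewrite -mulrA hph; ring.
  by rewrite !wE.
have wr i : w i = w r.
  apply: (@Hconn (fun l => w l = w r) _ r i erefl) => e l j eH le je <-.
  exact: (w_edge e).
have pk i : p i ^+ k = w r * y i ^+ k.
  by rewrite -(wr i) /w divfK // expf_neq0.
have wr0 : w r != 0 by rewrite /w mulf_neq0 ?invr_eq0 ?expf_neq0.
have pe e : e \in H -> edge_prod p e = w r * lam / m * edge_prod y e.
  move=> eH; have [i ie] : exists i, i \in e.
    by apply/finset.set0Pn; rewrite -card_gt0 Huni // ltnW.
  have := phase e i eH ie; rewrite pk => hph.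
  have yk : m * y i ^+ k != 0 by rewrite mulf_neq0 ?expf_neq0.
  by apply: (mulIf yk); rewrite hph; field.
(* In relative variations the phases of p factor out, and the weights become the positive products
   of the moduli. *)
pose z l := eta l / p l.
pose th := theta * m / lam.
(* The Laplacian of the weighted graph carried by the edges. *)
have lap i : \sum_(e in H | i \in e) edge_prod y e * \sum_(j in e) (z i - z j)
    = - th * y i ^+ k.
  have hk := key i; rewrite sform_eigen in hk.
  have hdiff : diff (lam *: 'X_i ^+ d - tensor_form A i) p eta =
     lam * (d%:R * eta i * p i ^+ d.-1)
      - \sum_(e in H | i \in e) edge_prod p (e :\ i) * \sum_(j in e :\ i) z j.
    rewrite -scaleN1r diffD !diffZ diff_Xn mulN1r; congr (_ - _).
    rewrite HA; elim/big_rec2: _ => [|e q f _ IH].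
      by rewrite -mpolyC0 diffC.
    by rewrite diffD IH diff_edge_prod.
  rewrite hdiff in hk.
  (* Multiplication by p_i completes the products over e minus i to products over e, whose phases
     are known. *)
  have hk2 : lam * d%:R * z i * p i ^+ k
     - \sum_(e in H | i \in e) edge_prod p e * \sum_(j in e :\ i) z j + theta * p i ^+ k = 0.
    rewrite -[RHS](mulr0 (p i)) -[X in _ = _ * X]hk !mulrDr mulrN; congr (_ - _ + _).
    - have -> : eta i = z i * p i by rewrite /z divfK.
      have -> : p i ^+ k = p i * (p i * p i ^+ d.-1).
        by rewrite -!exprS !prednK ?(ltnW k2) // (d_gt0 k2).
      by ring.
    - rewrite mulr_sumr. apply: eq_bigr => e /andP[_ ie].
      by rewrite (edge_prodD1 _ ie) mulrA.
    - by rewrite mulrCA -exprS prednK ?(ltnW k2).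
  have hk3 : w r * lam / m * (m * y i ^+ k * d%:R * z i
     - \sum_(e in H | i \in e) edge_prod y e * \sum_(j in e :\ i) z j + th * y i ^+ k) = 0.
    rewrite -[RHS]hk2 !mulrDr mulrN; congr (_ - _ + _).
    - by rewrite pk; field.
    - rewrite mulr_sumr; apply: eq_bigr => e /andP[eH _].
      by rewrite (pe e eH) !mulrA.
    - by rewrite pk /th; field; rewrite lam0.
  have cf0 : w r * lam / m != 0 by rewrite mulf_neq0 ?invr_eq0 // mulf_neq0.
  have /eqP := hk3; rewrite mulf_eq0 (negPf cf0).
  rewrite orFb addr_eq0 -mulNr => /eqP <-.
  rewrite yE !mulr_suml -sumrB; apply: eq_bigr => e /andP[eH ie].
  rewrite -mulrA -mulrBr; congr (_ * _).
  rewrite (big_setD1 i ie) /= subrr add0r sumrB sumr_const.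
  have -> : #|e :\ i| = d.
    by have := cardsD1 i e; rewrite ie Huni // => ->.
  by rewrite mulr_natl.
have swap (F : 'I_n -> 'I_n -> C) (e : {set 'I_n}) :
    \sum_(i in e) \sum_(j in e) F i j = \sum_(i in e) \sum_(j in e) F j i.
  exact: exchange_big.
have pos : \sum_i y i ^+ k != 0.
  rewrite gt_eqF // (bigD1 r) //= ltr_wpDr ?exprn_gt0 //.
  by apply: sumr_ge0 => i _; rewrite exprn_ge0 // ltW.
(* Summed over all vertices, the Laplacian cancels by antisymmetry in i and j, while the right side
   is - th times a positive number. *)
have th0 : th = 0.
  have : \sum_i \sum_(e in H | i \in e) edge_prod y e * \sum_(j in e) (z i - z j) = 0.
    rewrite (exchange_big_dep (fun e => e \in H)) /=; last by move=> i e _ /andP[].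
    rewrite big1 // => e eH; rewrite (eq_bigl (fun i => i \in e)); last by move=> i; rewrite eH.
    rewrite -mulr_sumr; under eq_bigr do rewrite sumrB.
    by rewrite sumrB swap subrr mulr0.
  rewrite (eq_bigr _ (fun i _ => lap i)) -mulr_sumr => /eqP.
  by rewrite mulf_eq0 oppr_eq0 (negPf pos) orbF => /eqP.
have theta0 : theta = 0.
  by move/eqP: th0; rewrite /th !mulf_eq0 invr_eq0 (negPf lam0) (negPf muC) !orbF => /eqP.
(* Pairing with the conjugate of z and symmetrizing in i and j gives the Dirichlet energy. Its terms
   are nonnegative, so z is constant on every edge. *)
have energy : \sum_(e in H) edge_prod y e * \sum_(i in e) \sum_(j in e) `|z i - z j| ^+ 2 = 0.
  have h1 : \sum_i (z i)^* * (\sum_(e in H | i \in e) edge_prod y e * \sum_(j in e) (z i - z j)) = 0.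
    by rewrite big1 // => i _; rewrite lap th0 oppr0 mul0r mulr0.
  have h2 : \sum_(e in H) edge_prod y e * \sum_(i in e) \sum_(j in e) (z i)^* * (z i - z j) = 0.
    rewrite -[RHS]h1; under [RHS]eq_bigr do rewrite mulr_sumr.
    rewrite (exchange_big_dep (fun e => e \in H)) /=; last by move=> i e _ /andP[].
    apply: eq_bigr => e eH; rewrite mulr_sumr [RHS](eq_bigl (fun i => i \in e)); last first.
      by move=> i; rewrite eH.
    by apply: eq_bigr => i _; rewrite mulrCA [in RHS]mulr_sumr.
  set T := \sum_(e in H) _ in h2.
  transitivity (T + T); last by rewrite h2 addr0.
  rewrite /T -big_split; apply: eq_bigr => e _ /=.
  rewrite -mulrDr; congr (_ * _); rewrite [X in _ = _ + X]swap -big_split /=.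
  apply: eq_bigr => i _; rewrite -big_split; apply: eq_bigr => j _ /=.
  by rewrite normCK rmorphB /=; ring.
have z_edge e i j : e \in H -> i \in e -> j \in e -> z i = z j.
  move=> eH ie je.
  have ge (f : {set 'I_n}) : 0 <= edge_prod y f * \sum_(i in f) \sum_(j in f) `|z i - z j| ^+ 2.
    apply: mulr_ge0; first by apply: prodr_ge0 => l _; exact: ltW.
    by apply: sumr_ge0 => l _; apply: sumr_ge0 => l' _; rewrite exprn_ge0.
  have /eqP := energy; rewrite psumr_eq0 // => /allP/(_ e).
  rewrite mem_index_enum => /(_ isT); rewrite eH implyTb mulf_eq0 (negPf (yprod e)) orFb.
  rewrite psumr_eq0 => [/allP/(_ i)|l _]; last by apply: sumr_ge0 => l' _; rewrite exprn_ge0.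
  rewrite mem_index_enum => /(_ isT); rewrite ie implyTb.
  rewrite psumr_eq0 => [/allP/(_ j)|l _]; last by rewrite exprn_ge0.
  rewrite mem_index_enum => /(_ isT); rewrite je implyTb.
  by rewrite expf_eq0 /= normr_eq0 subr_eq0 => /eqP.
have zr i : z i = 0.
  have <- : z r = 0 by rewrite /z etar mul0r.
  apply: (@Hconn (fun l => z l = z r) _ r i erefl) => e l j eH le je <-.
  exact: (z_edge e).
split=> // l; have := zr l; rewrite /z => /eqP.
by rewrite mulf_eq0 invr_eq0 (negPf (p0 l)) orbF => /eqP.
Qed.

End Eigen.
End Perron.

(** * Connected uniform hypergraphs *)

Section Connectivity.

(** Connectivity as an induction principle: any predicate that propagates along edges holds
    everywhere once it holds somewhere. *)
Definition edge_connected (V : finType) (H : hypergraph V) :=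
  forall P : V -> Prop,
  (forall (e : {set V}) u v, e \in H -> u \in e -> v \in e -> P u -> P v) ->
  forall u v, P u -> P v.

Lemma hconnected_edge (V : finType) (H : hypergraph V) :
  hconnected H -> edge_connected H.
Proof.
move=> [_ hc] P hP u v Pu; have /connectP[p] := hc u v.
elim: p u Pu => [|w p IH] u Pu /=; first by move=> _ ->.
move=> /andP[/existsP[e /and3P[eH ue we]] hp] vE.
by apply: (IH w) => //; exact: (hP e u w).
Qed.

Lemma edge_connected_iso (V V' : finType) (H : hypergraph V) (H' : hypergraph V') :
  hypergraph_iso H H' -> edge_connected H -> edge_connected H'.
Proof.
move=> [f [g fK gK] ->] hc P hP u v.
rewrite -[u]gK -[v]gK; apply: (hc (fun w => P (f w))) => e a b eH ae be.
by apply: (hP (f @: e)); rewrite ?imset_f //; apply: imset_f.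
Qed.

Lemma uniform_iso (k : nat) (V V' : finType) (H : hypergraph V) (H' : hypergraph V') :
  hypergraph_iso H H' -> uniform k H -> uniform k H'.
Proof.
move=> [f fb ->] hu _ /imsetP[e eH ->].
by rewrite card_imset ?hu //; exact: bij_inj.
Qed.

Lemma power_uniform (k : nat) (W : finType) (G : hypergraph W) :
  (2 < k)%N -> uniform 2 G -> uniform k (power k G).
Proof.
move=> k3 G2 _ /imsetP[e _ ->].
have E1 : [set (inl w : power_vertex k G) | w in val e] = inl @: val e by [].
rewrite /power_edge cardsU.
have -> : [set inl w | w in val e] :&: [set inr (e, j) | j : 'I_(k - 2)] =
    finset.set0 :> {set power_vertex k G}.
  by apply/finset.setP => x; rewrite !inE; apply/negP => /andP[/imsetP[w _ ->] /imsetP[j _]].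
rewrite cards0 subn0 card_imset ?(G2 (val e) (valP e)); last by move=> x y [].
rewrite card_imset ?card_ord; last by move=> x y [].
by rewrite subnKC // ltnW.
Qed.

Lemma power_connected (k : nat) (W : finType) (G : hypergraph W) :
  uniform 2 G -> edge_connected G -> edge_connected (power k G).
Proof.
move=> G2 hc P hP.
have inl_edge (e : {e : {set W} | e \in G}) w : w \in val e -> inl w \in power_edge k e.
  by move=> we; rewrite inE; apply/orP; left; apply/imsetP; exists w.
have inr_edge (e : {e : {set W} | e \in G}) j : inr (e, j) \in power_edge k e.
  by rewrite inE; apply/orP; right; apply/imsetP; exists j.
have eP e : power_edge k e \in power k G by apply/imsetP; exists e.
have PW u v : P (inl u) -> P (inl v).
  apply: (hc (fun w => P (inl w))) => e a b eG ae be.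
  by apply: (hP (power_edge k (exist _ e eG))); [exact: eP|exact: inl_edge|exact: inl_edge].
have ex (e : {e : {set W} | e \in G}) : exists w, w \in val e.
  by apply/finset.set0Pn; rewrite -card_gt0 (G2 (val e) (valP e)).
(* A vertex added to an edge shares it with an original vertex, as the edges of G have two
   elements. *)
have toW x : exists w, (P x -> P (inl w)) /\ (P (inl w) -> P x).
  case: x => [w|[e j]]; first by exists w.
  have [w we] := ex e; exists w; split.
    by apply: (hP (power_edge k e)); [exact: eP|exact: inr_edge|exact: inl_edge].
  by apply: (hP (power_edge k e)); [exact: eP|exact: inl_edge|exact: inr_edge].
move=> x y Px; have [u [hu _]] := toW x; have [v [_ hv]] := toW y.
by apply: hv; apply: (PW u); exact: hu.
Qed.

(** A third vertex completes any two distinct ones to an edge. *)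
Lemma complete_connected (V : finType) :
  (2 < #|V|)%N -> edge_connected (complete_uniform 3 V).
Proof.
move=> V3 P hP u v Pu; have [<-//|uv] := eqVneq u v.
have [w wuv] : exists w, w \notin [set u; v].
  apply: contrapT => H0.
  have : (#|V| <= #|[set u; v]|)%N.
    rewrite -cardsT; apply: subset_leq_card; apply/fintype.subsetP => x _.
    by apply/negPn/negP => h; apply: H0; exists x.
  by rewrite cards2 uv leqNgt V3.
apply: (hP (w |: [set u; v]) u v) => //.
- by rewrite inE cardsU1 wuv cards2 uv.
- by rewrite !inE eqxx orbT.
- by rewrite !inE eqxx !orbT.
Qed.

End Connectivity.

(** * From the adjacency tensor to sums over edges *)

Section Adjacency.
Variables (R : realType) (k : nat) (V : finType) (H : hypergraph V).
Notation C := R[i].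
Notation n := #|V|.
Hypotheses (k2 : (1 < k)%N) (Hu : uniform k H).
Notation A := (adjacency_tensor C k H).

(** Edges renumbered by [enum_val], since tensors and polynomials are indexed by ordinals. *)
Definition index_edges : {set {set 'I_n}} :=
  [set e : {set 'I_n} | [set enum_val j | j in e] \in (H : {set {set V}})].

Lemma index_edges_uniform e : e \in index_edges -> #|e| = k.
Proof. by rewrite inE => /Hu; rewrite card_imset //; exact: enum_val_inj. Qed.

Lemma index_edges_connected (P : 'I_n -> Prop) : edge_connected H ->
  (forall (e : {set 'I_n}) i j, e \in index_edges -> i \in e -> j \in e -> P i -> P j) ->
  forall i j, P i -> P j.
Proof.
move=> hc hP i j.
rewrite -(enum_valK i) -(enum_valK j); apply: (hc (fun w => P (enum_rank w))).
move=> e u v eH ue ve.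
apply: (hP [set enum_rank w | w in e]); try exact: imset_f.
rewrite inE -imset_comp (eq_imset (g := id)) ?imset_id // => w /=.
by rewrite enum_rankK.
Qed.

(** Group the tuples t by the set formed by i and their entries. The fibre of an edge e consists of
    the (k-1)! orderings of e minus i, which the factor 1/(k-1)! compensates. *)
Lemma adjacency_form i : tensor_form A i =
  \sum_(e in index_edges | i \in e)
     edge_prod (fun j => 'X_j : {mpoly C[n]}) (e :\ i).
Proof.
pose S (t : k.-1.-tuple 'I_n) : {set 'I_n} := [set j in i :: t].
have AE t : A i t = if S t \in index_edges then ((k.-1)`!%:R)^-1 else 0.
  rewrite /adjacency_tensor inE.
  suff -> : [set enum_val j | j in (i :: t : seq 'I_n)] = [set enum_val j | j in S t] by [].
  have SE j : (j \in S t) = (j \in (i :: t : seq 'I_n)) by rewrite finset.in_set.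
  by apply/finset.setP => v; apply/imsetP/imsetP => -[j jt ->]; exists j;
     rewrite // ?SE // -SE.
rewrite /tensor_form (eq_bigr (fun t : k.-1.-tuple 'I_n => if S t \in index_edges
   then ((k.-1)`!%:R)^-1 *: \prod_(j <- t) 'X_j else 0)); last first.
  by move=> t _; rewrite AE; case: ifP => // _; rewrite scale0r.
rewrite -big_mkcond /=.
rewrite (partition_big S (fun e => (e \in index_edges) && (i \in e))) /=; last first.
  by move=> t ->; rewrite !inE eqxx.
apply: eq_bigr => e /andP[eH ie].
have ek := index_edges_uniform eH.
have ei : #|e :\ i| = k.-1.
  by have := cardsD1 i e; rewrite ie ek => ->.
have St t : (S t == e) = all (mem (e :\ i)) t && uniq t.
  apply/eqP/andP => [SE|[/allP ht ut]].
    have : uniq (i :: t).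
      apply/card_uniqP; have : #|S t| = k by rewrite SE.
      by rewrite /S cardsE => ->; rewrite /= size_tuple prednK // ltnW.
    move=> /= /andP[it ut]; split => //; apply/allP => j jt /=.
    rewrite !inE -SE inE in_cons jt orbT andbT.
    by apply: contraNneq it => <-.
  have it : i \notin t.
    by apply/negP => /ht; rewrite /= !inE eqxx.
  apply/eqP; rewrite eqEcard; apply/andP; split.
    apply/fintype.subsetP => j; rewrite inE in_cons => /orP[/eqP ->//|/ht].
    by rewrite /= !inE => /andP[].
  rewrite ek /S cardsE.
  have /card_uniqP -> : uniq (i :: t) by rewrite /= it.
  by rewrite /= size_tuple prednK // ltnW.
rewrite (eq_bigr (fun=> ((k.-1)`!%:R)^-1 *:
   edge_prod (fun j => 'X_j : {mpoly C[n]}) (e :\ i))); last first.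
  move=> t /andP[_]; rewrite St => /andP[/allP ht ut]; congr (_ *: _).
  rewrite big_uniq //= /edge_prod; apply: eq_bigl.
  apply/subset_cardP; last by apply/fintype.subsetP => j /ht.
  by rewrite ei; have /card_uniqP -> := ut; rewrite size_tuple.
rewrite sumr_const.
have -> : #|[pred t : k.-1.-tuple 'I_n | (S t \in index_edges) && (S t == e)]| = (k.-1)`!.
  have <- : #|[set t : k.-1.-tuple 'I_n | all (mem (e :\ i)) t & uniq t]| = (k.-1)`!.
    by rewrite card_uniq_tuples -ffactnn; congr (_ ^_ _); exact: ei.
  rewrite cardsE; apply: eq_card => t.
  transitivity (S t == e); last by rewrite unfold_in /=; exact: St.
  by rewrite unfold_in /=; case: eqP => [->|]; rewrite ?andbF // eH.
rewrite -scaler_nat scalerA divff ?scale1r // pnatr_eq0 -lt0n.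
exact: fact_gt0.
Qed.

End Adjacency.

Lemma connected_uniform_alg_mult (R : realType) (k : nat) (V : finType)
    (H : hypergraph V) (lam : R[i]) (A := adjacency_tensor R[i] k H) :
  (1 < k)%N -> (0 < #|V|)%N -> uniform k H -> edge_connected H ->
  `|lam| = (spectral_radius A)%:C%C ->
  exists p : 'I_(alg_mult A lam) -> 'I_#|V| -> R[i],
    independent_zeros A lam p /\
    forall x : 'I_#|V| -> R[i], (exists i, x i != 0) ->
      (forall i, (sform (eigen_coefs A lam) i).@[x] = 0) ->
      exists k c, forall l, x l = c * p k l.
Proof.
move=> k2 n0 Hu Hc hl.
have Hu' := index_edges_uniform Hu.
have Hc' P := @index_edges_connected V H P Hc.
have HA := adjacency_form R k2 Hu.
have [c [y [c0 ey cmax]]] := extremal_ex R n0 k2 Hu'.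
have hr := spectral_radiusE n0 k2 Hu' HA c0 ey cmax.
rewrite /A hr in hl.
apply: (eigen_points n0 k2) => p r pr pz.
exact: (perron_nondegenerate (c := c) k2 Hu' Hc' HA c0 cmax hl pr pz).
Qed.

Local Open Scope classical_set_scope.
Local Open Scope card_scope.
Local Open Scope ring_scope.

Theorem theorem1p5 (R : realType) (k : nat) (V : finType) (H : hypergraph V)
    (lam : R[i]) (A := adjacency_tensor R[i] k H) :
  (2 <= k)%N ->
  [\/ uniform k H /\ hypertree H,
      (3 <= k)%N /\
        (exists (W : finType) (G : hypergraph W),
           connected_simple_graph G /\ hypergraph_iso (power k G) H)
    | [/\ k = 3%N, (4 <= #|V|)%N & H = complete_uniform 3 V]] ->
  tensor_eigenvalue A lam ->
  `|lam| = (spectral_radius A)%:C%C ->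
  projective_eigenvariety A lam #= `I_(alg_mult A lam) /\
  (forall (kappa : nat) (X : 'I_kappa -> set 'rV[R[i]]_#|V|),
     injective X ->
     range X = irreducible_components (affine_eigenvariety A lam) ->
     alg_mult A lam =
       (\sum_(i < kappa)
          zariski_dim (X i) * (k - 1) ^ (zariski_dim (X i) - 1))%N).
Proof.
move=> k2 cls ev hl.
have [Hu Hc n0] : [/\ uniform k H, edge_connected H & (0 < #|V|)%N].
  case: cls => [[Hu [Hc _]]|[k3 [W [G [[G2 Gc] iso]]]]|[k3 V4 HE]].
  - by split=> //; [exact: hconnected_edge|case: Hc].
  - split.
    + exact: uniform_iso iso (power_uniform k3 G2).
    + exact: edge_connected_iso iso (power_connected G2 (hconnected_edge Gc)).
    + have [/card_gt0P[w _] _] := Gc; have [f _ _] := iso.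
      by apply/card_gt0P; exists (f (inl w)).
  - split; last exact: leq_trans V4.
    + by move=> e; rewrite HE inE k3 => /eqP.
    + by rewrite HE; apply: complete_connected; exact: ltnW.
have [p [hp compl]] := connected_uniform_alg_mult k2 n0 Hu Hc hl.
(* The given eigenvector ensures that there is at least one line, hence that the components are
   lines. *)
have N0 : (0 < alg_mult A lam)%N.
  have [x x0 hx] := ev.
  have [i _] := eigen_equation_line compl x0 hx.
  exact: leq_ltn_trans (ltn_ord i).
split; first exact: projective_card hp compl.
by move=> kappa X; exact: (components_sum hp compl N0).
Qed.
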